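(* Let $T_{\mathrm{sfp}}$ be the universal theory of unital, projectionless, stably finite C$^*$-algebras, and let enforceability be with respect to $T_{\mathrm{sfp}}$. Let $\mathcal Z$ be the Jiang–Su algebra and $\mathcal U$ a nonprincipal ultrafilter on $\mathbb N$. The following are equivalent: (1) Every unital, projectionless, stably finite C$^*$-algebra is $\mathcal Z^{\mathcal U}$-embeddable. (2) $\mathcal Z$ is enforceable. (3) $\mathcal Z^{\mathcal U}$-embeddability is enforceable, i.e. the property that the compiled C$^*$-algebra embeds into $\mathcal Z^{\mathcal U}$ is enforceable.
   Context: Unital C$^*$-algebras are regarded as structures in a many-sorted continuous language $L$: for each $k\ge1$ a sort for the closed operator-norm ball of radius $k$ with metric $\|x-y\|$, function symbols for the $*$-algebra operations (addition, multiplication, adjoint, multiplication by scalars in $\mathbb Q(i)$), constants $0,1$ and inclusion maps between balls. Embeddings are injective unital $*$-homomorphisms; ultrapowers are norm ultrapowers (for nonseparable algebras, embeddability is into an ultrapower with respect to an ultrafilter on a possibly larger index set). A unital C$^*$-algebra is projectionless if its only projections are $0$ and $1$. $T_{\mathrm{sfp}}$ is a universal $L$-theory whose models are exactly the unital, projectionless, stably finite C$^*$-algebras. Game with respect to $T=T_{\mathrm{sfp}}$. Fix a countable set $C$ of new constant symbols, infinitely many of each sort, and set $L(C)=L\cup C$. A restricted formula is one built using a fixed countable family of continuous connectives whose compositions are uniformly dense among all continuous connectives. A condition is a finite set $p$ of expressions $\varphi<r$, with $\varphi$ a quantifier-free restricted $L(C)$-sentence and $r\in\mathbb R$, such that $T\cup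 p$ is satisfiable. Two players $\forall$ and $\exists$ alternately play conditions $p_0\subseteq p_1\subseteq p_2\subseteq\cdots$ ($\forall$ moves first; each move contains the previous one) for $\omega$ steps; let $\bar p=\bigcup_i p_i$. The play is definitive if for every atomic $L(C)$-sentence $\varphi$ there is a unique real $r$ with $T\cup\bar p\models\varphi=r$; then $\bar p$ determines a prestructure on the algebra of closed $L(C)$-terms, whose completion is the compiled structure. A property $P$ is enforceable (with respect to $T$) if $\exists$ has a strategy guaranteeing, whatever $\forall$ plays, that the play is definitive and the compiled structure has $P$. A structure $A$ is enforceable if the property ''the $L$-reduct of the compiled structure is isomorphic to $A$'' is enforceable. *)

(* Defs.v *)
From HB Require Import structures.
From mathcomp Require Import all_boot all_order all_algebra.
From mathcomp Require Import ring lra complex mxtens.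
From mathcomp Require Import all_classical all_reals all_analysis.
Set Implicit Arguments.
Unset Strict Implicit.
Unset Printing Implicit Defensive.
Import Order.TTheory GRing.Theory Num.Theory numFieldNormedType.Exports.
Local Open Scope complex_scope.
Local Open Scope classical_set_scope.
Local Open Scope ring_scope.
Import ComplexField.Normc.
Local Open Scope quotient_scope.

(* Unital C*-algebras over R[i]. The norm is a field of the mixin, real-valued,
   because the MathComp hierarchy has no structure joining algebras and normed
   modules. Being an [algType], a C*-algebra satisfies 1 != 0. *)
HB.mixin Record Algebra_isCStar (R : realType) A & GRing.Algebra R[i] A := {
  star : A -> A;
  cnorm : A -> R;
  starK : involutive star;
  starD : {morph star : x y / x + y};
  starZ : forall (a : R[i]) (x : A), star (a *: x) = a^*%C *: star x;
  starM : forall x y : A, star (x * y) = star y * star x;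
  cnorm0_eq0 : forall x : A, cnorm x = 0 -> x = 0;
  ler_cnormD : forall x y : A, cnorm (x + y) <= cnorm x + cnorm y;
  cnormZ : forall (a : R[i]) (x : A), cnorm (a *: x) = normc a * cnorm x;
  ler_cnormM : forall x y : A, cnorm (x * y) <= cnorm x * cnorm y;
  cnorm_star_mul : forall x : A, cnorm (star x * x) = cnorm x ^+ 2;
  cnorm_complete : forall u : nat -> A,
    (forall e : R, 0 < e -> exists N, forall m n,
       (N <= m)%N -> (N <= n)%N -> cnorm (u m - u n) < e) ->
    exists l : A, forall e : R, 0 < e -> exists N, forall n,
      (N <= n)%N -> cnorm (u n - l) < e
}.

#[short(type="cstarAlgType")]
HB.structure Definition CStarAlgebra (R : realType) :=
  {A of GRing.Algebra R[i] A & Algebra_isCStar R A}.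

Lemma normc_ge0 (R : rcfType) (a : R[i]) : 0 <= normc a.
Proof. by case: a => a b; exact: sqrtr_ge0. Qed.

Section CStarTheory.
Variables (R : realType) (A : cstarAlgType R).
Implicit Types x y : A.

Lemma cnorm0 : cnorm (0 : A) = 0.
Proof. by rewrite -(scale0r 0) cnormZ normc0 mul0r. Qed.

Lemma cnormN x : cnorm (- x) = cnorm x.
Proof.
by rewrite -scaleN1r cnormZ /normc /= oppr0 expr0n addr0 sqrrN expr1n sqrtr1 mul1r.
Qed.

Lemma cnorm_ge0 x : 0 <= cnorm x.
Proof.
have := ler_cnormD x (- x); rewrite subrr cnorm0 cnormN -mulr2n.
by rewrite pmulrn_lge0.
Qed.

Lemma cnormB x y : cnorm (x - y) = cnorm (y - x).
Proof. by rewrite -cnormN opprB. Qed.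

Lemma ler_cnormB x y : cnorm (x - y) <= cnorm x + cnorm y.
Proof. by rewrite -(cnormN y) ler_cnormD. Qed.

Lemma cnorm_tri z x y : cnorm (x - y) <= cnorm (x - z) + cnorm (z - y).
Proof. by rewrite (le_trans _ (ler_cnormD _ _))// addrA subrK. Qed.

Lemma ler_cnorm_dist x y : `|cnorm x - cnorm y| <= cnorm (x - y).
Proof.
rewrite ler_norml; apply/andP; split.
  rewrite lerNl opprB lerBlDr cnormB.
  by rewrite (le_trans _ (ler_cnormD _ _))// subrK.
by rewrite lerBlDr (le_trans _ (ler_cnormD _ _))// subrK.
Qed.

Lemma star0 : star (0 : A) = 0.
Proof. by apply: (addIr (star 0)); rewrite -starD !add0r. Qed.

Lemma starN x : star (- x) = - star x.
Proof. by apply: (addIr (star x)); rewrite -starD !addNr star0. Qed.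

Lemma starB x y : star (x - y) = star x - star y.
Proof. by rewrite starD starN. Qed.

Lemma star1 : star (1 : A) = 1.
Proof. by rewrite -[LHS]mulr1 -{2}(starK 1) -starM mulr1 starK. Qed.

Lemma cnorm1 : cnorm (1 : A) = 1.
Proof.
have := cnorm_star_mul (1 : A); rewrite mulr1 star1 expr2.
have n0 : cnorm (1 : A) != 0 by apply/eqP => /cnorm0_eq0/eqP; rewrite oner_eq0.
by move=> /(congr1 (fun t => t / cnorm (1 : A))); rewrite mulfK// divff.
Qed.

Lemma cnorm_star x : cnorm (star x) = cnorm x.
Proof.
have le y : cnorm y <= cnorm (star y).
  have [->|y0] := eqVneq y 0; first by rewrite star0.
  have y0' : 0 < cnorm y.
    by rewrite lt_def cnorm_ge0 andbT; apply: contra_neq y0 => /cnorm0_eq0.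
  by rewrite -(ler_pM2r y0') -expr2 -cnorm_star_mul ler_cnormM.
by apply/eqP; rewrite eq_le le andbT -{2}(starK x) le.
Qed.

End CStarTheory.

Section BoundedSequences.
Variables (R : realType) (I : Type) (A : cstarAlgType R).

Record linf := Linf {
  linf_fun :> I -> A;
  linf_bounded : exists M : R, forall i, cnorm (linf_fun i) <= M }.

HB.instance Definition _ := gen_eqMixin linf.
HB.instance Definition _ := gen_choiceMixin linf.

Lemma linfP (x y : linf) : (forall i, x i = y i) -> x = y.
Proof.
case: x y => [x bx] [y by_] /= xy.
have {}xy : x = y by apply/funext.
by subst y; congr Linf; exact: Prop_irrelevance.
Qed.

Lemma linf_cst_bounded (a : A) :
  exists M : R, forall i : I, cnorm ((fun=> a) i) <= M.
Proof. by exists (cnorm a). Qed.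
Lemma linf_add_bounded (x y : linf) :
  exists M : R, forall i, cnorm (x i + y i) <= M.
Proof.
have [M xM] := linf_bounded x; have [N yN] := linf_bounded y.
by exists (M + N) => i; rewrite (le_trans (ler_cnormD _ _))// lerD.
Qed.
Lemma linf_opp_bounded (x : linf) : exists M : R, forall i, cnorm (- x i) <= M.
Proof. by have [M xM] := linf_bounded x; exists M => i; rewrite cnormN. Qed.
Lemma linf_mul_bounded (x y : linf) :
  exists M : R, forall i, cnorm (x i * y i) <= M.
Proof.
have [M xM] := linf_bounded x; have [N yN] := linf_bounded y.
exists (M * N) => i; rewrite (le_trans (ler_cnormM _ _))//.
by rewrite ler_pM// cnorm_ge0.
Qed.
Lemma linf_scale_bounded (a : R[i]) (x : linf) :
  exists M : R, forall i, cnorm (a *: x i) <= M.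
Proof.
have [M xM] := linf_bounded x; exists (normc a * M) => i.
by rewrite cnormZ ler_wpM2l// normc_ge0.
Qed.
Lemma linf_star_bounded (x : linf) :
  exists M : R, forall i, cnorm (star (x i)) <= M.
Proof. by have [M xM] := linf_bounded x; exists M => i; rewrite cnorm_star. Qed.

Definition linf_cst a := Linf (linf_cst_bounded a).
Definition linf_add x y := Linf (linf_add_bounded x y).
Definition linf_opp x := Linf (linf_opp_bounded x).
Definition linf_mul x y := Linf (linf_mul_bounded x y).
Definition linf_scale a x := Linf (linf_scale_bounded a x).
Definition linf_star x := Linf (linf_star_bounded x).

End BoundedSequences.

(* The norm ultrapower of A along V: bounded families modulo those whose norm
   tends to 0 along V, with the norm [lim_V cnorm (x i)]. *)
Section Ultrapower.
Variables (R : realType) (I : Type) (V : set_system I).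
Context {VU : UltraFilter V}.

Lemma ultra_bounded_cvg (f : I -> R) (M : R) :
  (forall i, `|f i| <= M) -> cvg (f i @[i --> V]).
Proof.
move=> fM; have FV : ProperFilter (f @ V) by exact: fmap_proper_filter.
have sub : V (f @^-1` `[- M, M]%classic).
  have VT : V setT by apply: filterT.
  apply: filterS VT => i _ /=; by rewrite in_itv /= -ler_norml.
have [p [_ clp]] := @segment_compact R (- M) M (f @ V) FV sub.
apply/cvg_ex; exists p => B Bp.
have [//|VnB] := in_ultra_setVsetC (f @^-1` B) VU.
by have [y [nBy By]] := clp (~` B) B VnB Bp.
Qed.

Lemma ultra_ler_cvg (f g : I -> R) (l m : R) :
  f i @[i --> V] --> l -> g i @[i --> V] --> m -> (forall i, f i <= g i) ->
  l <= m.
Proof.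
move=> fl gm fg; rewrite -subr_ge0.
have gf : (g i - f i) @[i --> V] --> m - l by exact: cvgB.
rewrite -(cvg_lim _ gf)//; apply: limr_ge; first exact: cvgP gf.
by apply: nearW => i; rewrite subr_ge0.
Qed.

Variable A : cstarAlgType R.
Implicit Types x y : linf I A.

Definition linf_norm x : R := lim (cnorm (x i) @[i --> V]).

Lemma linf_norm_cvg x : cnorm (x i) @[i --> V] --> linf_norm x.
Proof.
have [M xM] := linf_bounded x.
apply: (@ultra_bounded_cvg _ M) => i; by rewrite ger0_norm// cnorm_ge0.
Qed.

Lemma linf_norm_le x r : V [set i | cnorm (x i) <= r] -> linf_norm x <= r.
Proof.
by move=> xr; apply: limr_le; [exact: linf_norm_cvg | exact: xr].
Qed.

Lemma linf_norm_lt x r : linf_norm x < r -> V [set i | cnorm (x i) < r].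
Proof. by move=> xr; exact: (cvgr_lt (linf_norm x) (@linf_norm_cvg x) r xr). Qed.

Lemma linf_norm_ge0 x : 0 <= linf_norm x.
Proof.
apply: limr_ge; first exact: linf_norm_cvg.
by apply: nearW => i; exact: cnorm_ge0.
Qed.

Definition linf_sub x y := linf_add x (linf_opp y).

Definition linf_eqmod x y : bool := `[< linf_norm (linf_sub x y) = 0 >].

Lemma linf_eqmodP x y :
  reflect (forall e : R, 0 < e -> V [set i | cnorm (x i - y i) < e])
          (linf_eqmod x y).
Proof.
apply: (iffP (asboolP _)) => [xy e e0|xy].
  by apply: (@linf_norm_lt (linf_sub x y)); rewrite xy.
apply/eqP; rewrite eq_le linf_norm_ge0 andbT.
apply/ler_addgt0Pl => e e0; rewrite addr0; apply: linf_norm_le.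
by apply: filterS (xy _ e0) => i /= /ltW.
Qed.

Lemma linf_eqmod_refl : reflexive linf_eqmod.
Proof.
move=> x; apply/linf_eqmodP => e e0; have VT : V setT by apply: filterT.
by apply: filterS VT => i _ /=; rewrite subrr cnorm0.
Qed.
Lemma linf_eqmod_sym : symmetric linf_eqmod.
Proof.
move=> x y; apply/linf_eqmodP/linf_eqmodP => h e e0;
by apply: filterS (h e e0) => i /=; rewrite cnormB.
Qed.
Lemma linf_eqmod_trans : transitive linf_eqmod.
Proof.
move=> y x z /linf_eqmodP xy /linf_eqmodP yz; apply/linf_eqmodP => e e0.
have e20 : 0 < e / 2 by rewrite divr_gt0.
apply: filterS2 (xy _ e20) (yz _ e20) => i /= h1 h2.
by rewrite (le_lt_trans (cnorm_tri (y i) _ _))// [e]splitr ltrD.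
Qed.

Canonical linf_eqmod_equiv :=
  EquivRel linf_eqmod linf_eqmod_refl linf_eqmod_sym linf_eqmod_trans.

Definition ultrapower : Type := {eq_quot linf_eqmod_equiv}.
HB.instance Definition _ := Choice.copy ultrapower {eq_quot linf_eqmod_equiv}.

Definition ucls x : ultrapower := \pi_({eq_quot linf_eqmod_equiv})%qT x.
Definition urepr (u : ultrapower) : linf I A :=
  @repr _ {eq_quot linf_eqmod_equiv} u.

Lemma ureprK u : ucls (urepr u) = u.
Proof. exact: (@reprK _ {eq_quot linf_eqmod_equiv}). Qed.

Lemma uclsP x y : ucls x = ucls y <-> linf_eqmod x y.
Proof. by split=> [/eqmodP|h]; [|apply/eqmodP]. Qed.

Lemma ureprP x : linf_eqmod (urepr (ucls x)) x.
Proof. by apply/uclsP; rewrite ureprK. Qed.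

Definition uadd (u v : ultrapower) := ucls (linf_add (urepr u) (urepr v)).
Definition uopp (u : ultrapower) := ucls (linf_opp (urepr u)).
Definition umul (u v : ultrapower) := ucls (linf_mul (urepr u) (urepr v)).
Definition uscale (a : R[i]) (u : ultrapower) := ucls (linf_scale a (urepr u)).
Definition ustar (u : ultrapower) := ucls (linf_star (urepr u)).
Definition unorm (u : ultrapower) : R := linf_norm (urepr u).
Definition ucst (a : A) : ultrapower := ucls (linf_cst I a).

Lemma uaddE x y : uadd (ucls x) (ucls y) = ucls (linf_add x y).
Proof.
apply/uclsP/linf_eqmodP => e e0; have e20 : 0 < e / 2 by rewrite divr_gt0.
apply: filterS2 (linf_eqmodP _ _ (ureprP x) _ e20)
                (linf_eqmodP _ _ (ureprP y) _ e20) => i /= h1 h2.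
by rewrite opprD addrACA (le_lt_trans (ler_cnormD _ _))// [e]splitr ltrD.
Qed.

Lemma uoppE x : uopp (ucls x) = ucls (linf_opp x).
Proof.
apply/uclsP/linf_eqmodP => e e0.
apply: filterS (linf_eqmodP _ _ (ureprP x) _ e0) => i /= h.
by rewrite -opprD cnormN.
Qed.

Lemma ustarE x : ustar (ucls x) = ucls (linf_star x).
Proof.
apply/uclsP/linf_eqmodP => e e0.
apply: filterS (linf_eqmodP _ _ (ureprP x) _ e0) => i /= h.
by rewrite -starB cnorm_star.
Qed.

Lemma uscaleE a x : uscale a (ucls x) = ucls (linf_scale a x).
Proof.
apply/uclsP/linf_eqmodP => e e0.
have a0 : 0 < normc a + 1 by rewrite ltr_wpDl// normc_ge0.
have ea0 : 0 < e / (normc a + 1) by rewrite divr_gt0.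
apply: filterS (linf_eqmodP _ _ (ureprP x) _ ea0) => i /= h.
rewrite -scalerBr cnormZ; move: h; rewrite ltr_pdivlMr//; apply: le_lt_trans.
by rewrite mulrC ler_wpM2l ?cnorm_ge0// lerDl.
Qed.

Lemma umulE x y : umul (ucls x) (ucls y) = ucls (linf_mul x y).
Proof.
apply/uclsP/linf_eqmodP => e e0.
have [M xM] := linf_bounded (urepr (ucls x)).
have [N yN] := linf_bounded y.
have K0 : 0 < `|M| + `|N| + 1 by rewrite ltr_wpDl// addr_ge0.
have ea0 : 0 < e / (`|M| + `|N| + 1) by rewrite divr_gt0.
apply: filterS2 (linf_eqmodP _ _ (ureprP x) _ ea0)
                (linf_eqmodP _ _ (ureprP y) _ ea0) => i /=.
set x' := urepr _ i; set y' := urepr _ i => h1 h2.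
have -> : x' * y' - x i * y i = x' * (y' - y i) + (x' - x i) * y i.
  by rewrite mulrBr mulrBl addrA subrK.
rewrite (le_lt_trans (ler_cnormD _ _))//.
rewrite (@le_lt_trans _ _
  (`|M| * (e / (`|M| + `|N| + 1)) + (e / (`|M| + `|N| + 1)) * `|N|))//.
  apply: lerD; apply: (le_trans (ler_cnormM _ _)); apply: ler_pM;
    rewrite ?cnorm_ge0//;
    by [exact: ltW | exact: le_trans (xM i) (ler_norm _)
       | exact: le_trans (yN i) (ler_norm _)].
rewrite mulrC -mulrDr -mulrA gtr_pMr// ltr_pdivrMl// mulr1.
by rewrite ltrDl.
Qed.

Lemma unormE x : unorm (ucls x) = linf_norm x.
Proof.
apply/eqP; rewrite eq_le; apply/andP; split; apply/ler_addgt0Pl => e e0;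
have e20 : 0 < e / 2 by rewrite divr_gt0.
- apply: linf_norm_le.
  have hx : linf_norm x < linf_norm x + e / 2 by rewrite ltrDl.
  apply: filterS2 (linf_eqmodP _ _ (ureprP x) _ e20) (linf_norm_lt hx) => i /=.
  move=> h1 h2; rewrite -(subrK (x i) (urepr _ i)).
  rewrite (le_trans (ler_cnormD _ _))// [e in leRHS]splitr -addrA lerD ?ltW//.
  by rewrite addrC.
- apply: linf_norm_le.
  have hx : unorm (ucls x) < unorm (ucls x) + e / 2 by rewrite ltrDl.
  apply: filterS2 (linf_eqmodP _ _ (ureprP x) _ e20) (linf_norm_lt hx) => i /=.
  rewrite cnormB => h1 h2; rewrite -(subrK (urepr (ucls x) i) (x i)).
  rewrite (le_trans (ler_cnormD _ _))// [e in leRHS]splitr -addrA lerD ?ltW//.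
  by rewrite addrC.
Qed.

Lemma uW (P : ultrapower -> Prop) : (forall x, P (ucls x)) -> forall u, P u.
Proof. by move=> h u; rewrite -(ureprK u). Qed.

Lemma uaddA : associative uadd.
Proof.
elim/uW => x; elim/uW => y; elim/uW => z; rewrite !uaddE; congr ucls.
by apply: linfP => i /=; rewrite addrA.
Qed.
Lemma uaddC : commutative uadd.
Proof.
elim/uW => x; elim/uW => y; rewrite !uaddE; congr ucls.
by apply: linfP => i /=; rewrite addrC.
Qed.
Lemma uadd0 : left_id (ucst 0) uadd.
Proof.
elim/uW => x; rewrite !uaddE; congr ucls.
by apply: linfP => i /=; rewrite add0r.
Qed.
Lemma uaddN : left_inverse (ucst 0) uopp uadd.
Proof.
elim/uW => x; rewrite uoppE !uaddE; congr ucls.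
by apply: linfP => i /=; rewrite addNr.
Qed.
HB.instance Definition _ :=
  GRing.isZmodule.Build ultrapower uaddA uaddC uadd0 uaddN.

Lemma umulA : associative umul.
Proof.
elim/uW => x; elim/uW => y; elim/uW => z; rewrite !umulE; congr ucls.
by apply: linfP => i /=; rewrite mulrA.
Qed.
Lemma umul1l : left_id (ucst 1) umul.
Proof.
elim/uW => x; rewrite !umulE; congr ucls.
by apply: linfP => i /=; rewrite mul1r.
Qed.
Lemma umul1r : right_id (ucst 1) umul.
Proof.
elim/uW => x; rewrite !umulE; congr ucls.
by apply: linfP => i /=; rewrite mulr1.
Qed.
Lemma umulDl : left_distributive umul +%R.
Proof.
elim/uW => x; elim/uW => y; elim/uW => z.
rewrite /GRing.add /= !(umulE, uaddE); congr ucls.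
by apply: linfP => i /=; rewrite mulrDl.
Qed.
Lemma umulDr : right_distributive umul +%R.
Proof.
elim/uW => x; elim/uW => y; elim/uW => z.
rewrite /GRing.add /= !(umulE, uaddE); congr ucls.
by apply: linfP => i /=; rewrite mulrDr.
Qed.
Lemma u1_neq0 : ucst 1 != (0 : ultrapower).
Proof.
apply/eqP => /uclsP/linf_eqmodP/(_ _ ltr01) /filter_ex [i /=].
by rewrite subr0 cnorm1 ltxx.
Qed.
HB.instance Definition _ := GRing.Zmodule_isNzRing.Build ultrapower
  umulA umul1l umul1r umulDl umulDr u1_neq0.

Lemma uscaleA a b u : uscale a (uscale b u) = uscale (a * b) u.
Proof.
elim/uW: u => x; rewrite !uscaleE; congr ucls.
by apply: linfP => i /=; rewrite scalerA.
Qed.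
Lemma uscale1 : left_id 1 uscale.
Proof.
elim/uW => x; rewrite !uscaleE; congr ucls.
by apply: linfP => i /=; rewrite scale1r.
Qed.
Lemma uscaleDr : right_distributive uscale +%R.
Proof.
move=> a; elim/uW => x; elim/uW => y.
rewrite /GRing.add /= !(uscaleE, uaddE); congr ucls.
by apply: linfP => i /=; rewrite scalerDr.
Qed.
Lemma uscaleDl u : {morph uscale^~ u : a b / a + b}.
Proof.
move=> a b; elim/uW: u => x.
rewrite [RHS]/GRing.add /= !(uscaleE, uaddE); congr ucls.
by apply: linfP => i /=; rewrite scalerDl.
Qed.
HB.instance Definition _ := GRing.Zmodule_isLmodule.Build R[i] ultrapower
  uscaleA uscale1 uscaleDr uscaleDl.

Lemma uscaleAl (a : R[i]) (u v : ultrapower) : a *: (u * v) = (a *: u) * v.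
Proof.
elim/uW: u => x; elim/uW: v => y.
rewrite /GRing.mul /GRing.scale /= !(uscaleE, umulE); congr ucls.
by apply: linfP => i /=; rewrite scalerAl.
Qed.
HB.instance Definition _ :=
  GRing.Lmodule_isLalgebra.Build R[i] ultrapower uscaleAl.
Lemma uscaleAr (a : R[i]) (u v : ultrapower) : a *: (u * v) = u * (a *: v).
Proof.
elim/uW: u => x; elim/uW: v => y.
rewrite /GRing.mul /GRing.scale /= !(uscaleE, umulE); congr ucls.
by apply: linfP => i /=; rewrite scalerAr.
Qed.
HB.instance Definition _ :=
  GRing.Lalgebra_isAlgebra.Build R[i] ultrapower uscaleAr.

Lemma ustarK : involutive ustar.
Proof.
elim/uW => x; rewrite !ustarE; congr ucls.
by apply: linfP => i /=; rewrite starK.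
Qed.
Lemma ustarD : {morph ustar : u v / u + v}.
Proof.
elim/uW => x; elim/uW => y.
rewrite /GRing.add /= !(ustarE, uaddE); congr ucls.
by apply: linfP => i /=; rewrite starD.
Qed.
Lemma ustarZ (a : R[i]) (u : ultrapower) : ustar (a *: u) = a^*%C *: ustar u.
Proof.
elim/uW: u => x; rewrite /GRing.scale /= !(ustarE, uscaleE); congr ucls.
by apply: linfP => i /=; rewrite starZ.
Qed.
Lemma ustarM (u v : ultrapower) : ustar (u * v) = ustar v * ustar u.
Proof.
elim/uW: u => x; elim/uW: v => y.
rewrite /GRing.mul /= !(ustarE, umulE); congr ucls.
by apply: linfP => i /=; rewrite starM.
Qed.

Lemma linf_norm_eq0P x : linf_norm x = 0 -> ucls x = ucst 0.
Proof.
move=> x0; apply/uclsP/linf_eqmodP => e e0.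
have xe : linf_norm x < e by rewrite x0.
by apply: filterS (linf_norm_lt xe) => i /=; rewrite subr0.
Qed.

Lemma unorm0_eq0 (u : ultrapower) : unorm u = 0 -> u = 0.
Proof. elim/uW: u => x; rewrite unormE; exact: linf_norm_eq0P. Qed.

Lemma unormD (u v : ultrapower) : unorm (u + v) <= unorm u + unorm v.
Proof.
elim/uW: u => x; elim/uW: v => y; rewrite {1}/GRing.add /= uaddE !unormE.
apply: (@ultra_ler_cvg _ _ _ _ (@linf_norm_cvg _)
  (cvgD (@linf_norm_cvg x) (@linf_norm_cvg y))).
by move=> i; exact: ler_cnormD.
Qed.

Lemma unormZ (a : R[i]) (u : ultrapower) : unorm (a *: u) = normc a * unorm u.
Proof.
elim/uW: u => x; rewrite /GRing.scale /= uscaleE !unormE.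
have := @linf_norm_cvg (linf_scale a x).
have -> : (fun i => cnorm (linf_scale a x i)) = (fun i => normc a * cnorm (x i)).
  by apply/funext => i /=; rewrite cnormZ.
move/cvg_unique; apply => //; exact: cvgMr (@linf_norm_cvg x).
Qed.

Lemma unormM (u v : ultrapower) : unorm (u * v) <= unorm u * unorm v.
Proof.
elim/uW: u => x; elim/uW: v => y; rewrite {1}/GRing.mul /= umulE !unormE.
apply: (@ultra_ler_cvg _ _ _ _ (@linf_norm_cvg _)
  (cvgM (@linf_norm_cvg x) (@linf_norm_cvg y))).
by move=> i; exact: ler_cnormM.
Qed.

Lemma unorm_star_mul (u : ultrapower) : unorm (ustar u * u) = unorm u ^+ 2.
Proof.
elim/uW: u => x; rewrite /GRing.mul /= ustarE umulE !unormE expr2.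
have := @linf_norm_cvg (linf_mul (linf_star x) x).
have -> : (fun i => cnorm (linf_mul (linf_star x) x i)) =
          (fun i => cnorm (x i) * cnorm (x i)).
  by apply/funext => i /=; rewrite cnorm_star_mul expr2.
move/cvg_unique; apply => //.
exact: cvgM (@linf_norm_cvg x) (@linf_norm_cvg x).
Qed.

Lemma unormB (u v : ultrapower) : unorm (u - v) = unorm (v - u).
Proof.
have -> : u - v = (-1) *: (v - u) by rewrite scaleN1r opprB.
by rewrite unormZ /normc /= oppr0 expr0n addr0 sqrrN expr1n sqrtr1 mul1r.
Qed.

Lemma usubE x y : ucls x - ucls y = ucls (linf_sub x y).
Proof. by rewrite /GRing.add /GRing.opp /= uoppE uaddE. Qed.

(* A sequence that is Cauchy in the quotient is corrected coordinate by
   coordinate: at i, follow the representatives as long as they stay close. *)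
Lemma linf_diagonal (g : nat -> linf I A) :
  (forall j k, V [set i | cnorm (g j i - g k i) < j.+1%:R^-1 + k.+1%:R^-1]) ->
  exists h : linf I A,
    forall k, V [set i | cnorm (g k i - h i) <= 3 * k.+1%:R^-1].
Proof.
move=> gV.
have e_gt0 k : 0 < k.+1%:R^-1 :> R by rewrite invr_gt0.
have e_le j k : (j <= k)%N -> k.+1%:R^-1 <= j.+1%:R^-1 :> R.
  by move=> jk; rewrite lef_pV2 ?posrE// ler_nat ltnS.
pose good i n := forall j k, (j <= n)%N -> (k <= n)%N ->
  cnorm (g j i - g k i) < j.+1%:R^-1 + k.+1%:R^-1.
have goodV n : V [set i | good i n].
  have H : V [set i | forall p : 'I_n.+1 * 'I_n.+1,
      cnorm (g p.1 i - g p.2 i) < p.1.+1%:R^-1 + p.2.+1%:R^-1].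
    by apply: filter_forall => -[j k] /=; exact: gV.
  apply: filterS H => i /= H j k jn kn.
  by have := H (Ordinal (jn : (j < n.+1)%N), Ordinal (kn : (k < n.+1)%N)).
have good0 i : good i 0%N.
  move=> j k; rewrite !leqn0 => /eqP -> /eqP ->.
  by rewrite subrr cnorm0 addr_gt0.
have goodS i m n : (m <= n)%N -> good i n -> good i m.
  by move=> mn gn j k jm km; apply: gn; exact: leq_trans mn.
have hex i : exists a : A,
    forall k, good i k -> cnorm (g k i - a) <= 3 * k.+1%:R^-1.
  have [allg|/existsNP[n0 n0P]] := pselect (forall n, good i n).
    have cau (e : R) : 0 < e -> exists N, forall m n,
        (N <= m)%N -> (N <= n)%N -> cnorm (g m i - g n i) < e.
      move=> e0; have e20 : 0 < e / 2 by rewrite divr_gt0.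
      have [N _ NP] := near_infty_natSinv_lt (PosNum e20).
      exists N => m n Nm Nn; rewrite (lt_trans (allg (maxn m n) m n _ _))//.
      - exact: leq_maxl.
      - exact: leq_maxr.
      - by rewrite [e]splitr ltrD//; exact: NP.
    have [l lP] := cnorm_complete (fun n => g n i) cau.
    exists l => k _.
    have [N NP] := lP _ (e_gt0 k).
    have := NP (maxn N k) (leq_maxl _ _).
    move: (allg (maxn N k) k (maxn N k) (leq_maxr _ _) (leqnn _)).
    move=> h1 h2; rewrite (le_trans (cnorm_tri (g (maxn N k) i) _ _))//.
    have h3 := e_le _ _ (leq_maxr N k).
    move: (k.+1%:R^-1) ((maxn N k).+1%:R^-1) h1 h2 h3 => s t h1 h2 h3; lra.
  have : exists n, `[< ~ good i n >] by exists n0; apply/asboolP.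
  case/ex_minnP => -[|n] /asboolP ng nmin; first by case: ng.
  have gn : good i n.
    apply: contrapT => /asboolP/nmin; by rewrite ltnn.
  exists (g n i) => k gk.
  have kn : (k <= n)%N.
    rewrite leqNgt; apply/negP => nk; apply: ng; exact: goodS gk.
  have := gn k n kn (leqnn _); have := e_le _ _ kn.
  move: (k.+1%:R^-1) (n.+1%:R^-1) (e_gt0 n) => s t t0 h1 h2.
  by apply: ltW; apply: lt_le_trans h2 _; lra.
have [h hP] := choice hex.
have hb : exists M : R, forall i, cnorm (h i) <= M.
  have [M gM] := linf_bounded (g 0%N).
  exists (M + 3) => i; rewrite -(subrK (g 0%N i) (h i)) addrC.
  rewrite (le_trans (ler_cnormD _ _))// lerD// cnormB.
  by have := hP i _ (good0 i); rewrite invr1 mulr1.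
exists (Linf hb) => k; apply: filterS (goodV k) => i /=; exact: hP.
Qed.

Lemma ultrapower_complete (u : nat -> ultrapower) :
  (forall e : R, 0 < e -> exists N, forall m n,
     (N <= m)%N -> (N <= n)%N -> unorm (u m - u n) < e) ->
  exists l : ultrapower, forall e : R, 0 < e -> exists N, forall n,
    (N <= n)%N -> unorm (u n - l) < e.
Proof.
move=> cau.
have e_gt0 k : 0 < k.+1%:R^-1 :> R by rewrite invr_gt0.
have [phi phiP] := choice (fun k => cau _ (e_gt0 k)).
pose g k := urepr (u (phi k)).
have gE k : ucls (g k) = u (phi k) by exact: ureprK.
have [h hP] : exists h : linf I A,
    forall k, V [set i | cnorm (g k i - h i) <= 3 * k.+1%:R^-1].
  apply: linf_diagonal => j k.
  apply: (@linf_norm_lt (linf_sub (g j) (g k))).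
  rewrite -unormE -usubE !gE.
  pose n := maxn (phi j) (phi k).
  have h1 := phiP j (phi j) n (leqnn _) (leq_maxl _ _).
  have h2 := phiP k n (phi k) (leq_maxr _ _) (leqnn _).
  have -> : u (phi j) - u (phi k) = (u (phi j) - u n) + (u n - u (phi k)).
    by rewrite addrA subrK.
  by rewrite (le_lt_trans (unormD _ _))// ltrD.
exists (ucls h) => e e0; have e40 : 0 < e / 4 by rewrite divr_gt0.
have [k _ kP] := near_infty_natSinv_lt (PosNum e40).
have {kP} := kP k (leqnn k); rewrite /= => ke.
exists (phi k) => n kn.
have h1 := phiP k n (phi k) kn (leqnn _).
have h2 : unorm (u (phi k) - ucls h) <= 3 * k.+1%:R^-1.
  by rewrite -gE usubE unormE; apply: linf_norm_le; exact: hP.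
have -> : u n - ucls h = (u n - u (phi k)) + (u (phi k) - ucls h).
  by rewrite addrA subrK.
rewrite (le_lt_trans (unormD _ _))//.
move: (unorm _) (unorm _) (k.+1%:R^-1) h1 h2 ke => s t r h1 h2 h3; lra.
Qed.

HB.instance Definition _ := Algebra_isCStar.Build R ultrapower
  ustarK ustarD ustarZ ustarM unorm0_eq0 unormD unormZ unormM unorm_star_mul
  ultrapower_complete.

End Ultrapower.

Arguments ultrapower {R I} V {VU} A.

Section Embeddings.
Variable R : realType.
Implicit Types A B : cstarAlgType R.

Definition star_preserving A B (f : A -> B) : Prop :=
  forall x, f (star x) = star (f x).

Definition embeds A B : Prop :=
  exists f : {lrmorphism A -> B}, star_preserving f /\ injective f.

Definition isomorphic A B : Prop :=
  exists f : {lrmorphism A -> B}, star_preserving f /\ bijective f.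

Definition separable A : Prop :=
  exists u : nat -> A, forall (x : A) (e : R), 0 < e ->
    exists n, cnorm (x - u n) < e.

Definition nonprincipal I (V : set_system I) : Prop := forall i, ~ V [set i].

(* Nonseparable algebras are too large for [ultrapower U B] with [U] on [nat],
   so for them the index set is existentially quantified. *)
Definition ultrapower_embeddable (U : set_system nat) {UU : UltraFilter U}
    B A : Prop :=
  (separable A /\ embeds A (ultrapower U B)) \/
  (~ separable A /\
   exists (I : Type) (V : set_system I) (VU : UltraFilter V),
     embeds A (ultrapower V B)).

End Embeddings.

Arguments ultrapower_embeddable {R} U {UU} B A.

Section Finiteness.
Variables (R : realType) (A : cstarAlgType R).

Definition projection (p : A) : Prop := star p = p /\ p * p = p.

Definition projectionless : Prop := forall p, projection p -> p = 0 \/ p = 1.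

Definition mxstar n (v : 'M[A]_n) : 'M[A]_n := (map_mx star v)^T.

Definition stably_finite : Prop := forall n (v : 'M[A]_n),
  mxstar v *m v = 1%:M -> v *m mxstar v = 1%:M.

(* The models of the universal theory T_sfp. *)
Definition sfp : Prop := projectionless /\ stably_finite.

Definition closed_ideal (J : set A) : Prop :=
  [/\ J 0,
      forall x y, J x -> J y -> J (x + y),
      forall a x, J x -> J (a * x) /\ J (x * a)
    & forall x, (forall e : R, 0 < e -> exists2 y, J y & cnorm (x - y) < e) ->
      J x].

Definition simple_algebra : Prop :=
  forall J, closed_ideal J -> J = [set 0] \/ J = setT.

Definition tracial_state (tau : A -> R[i]) : Prop :=
  [/\ forall a x y, tau (a *: x + y) = a * tau x + tau y,
      forall x, 0 <= tau (star x * x),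
      tau 1 = 1
    & forall x y, tau (x * y) = tau (y * x)].

End Finiteness.

Section JiangSu.
Variable R : realType.

Definition dimension_drop p q : set (R -> 'M[R[i]]_(p * q)) :=
  [set f : R -> 'M[R[i]]_(p * q) |
   [/\ forall i j, {within `[0, 1], continuous (fun x => f x i j : R[i]^o)},
      exists a : 'M[R[i]]_p, f 0 = a *t 1%:M
    & exists b : 'M[R[i]]_q, f 1 = 1%:M *t b]].

Arguments dimension_drop : clear implicits.

(* An injective unital *-homomorphism from the dimension drop algebra; its
   elements are functions on [0, 1], hence the first clause, which says that
   [mu] only depends on the restriction to [0, 1] and is injective. *)
Definition dimension_drop_embedding p q (A : cstarAlgType R)
    (mu : (R -> 'M[R[i]]_(p * q)) -> A) : Prop :=
  let D := dimension_drop p q in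
  [/\ forall f g, D f -> D g ->
        (mu f = mu g <-> forall x, x \in `[0, 1] -> f x = g x),
      forall f g, D f -> D g ->
        mu (fun x => f x + g x) = mu f + mu g /\
        mu (fun x => f x *m g x) = mu f * mu g,
      forall f, D f ->
        (forall a : R[i], mu (fun x => a *: f x) = a *: mu f) /\
        mu (fun x => (map_mx conjc (f x))^T) = star (mu f)
    & mu (fun=> 1%:M) = 1].

(* The Jiang-Su algebra, up to isomorphism: the simple unital C*-algebra with a
   unique tracial state that is the limit of a sequence of prime dimension drop
   algebras with injective unital connecting maps, i.e. the closure of an
   increasing union of copies of such algebras. *)
Definition jiang_su (Z : cstarAlgType R) : Prop :=
  [/\ simple_algebra Z,
      exists! tau : Z -> R[i], tracial_state tau
    & exists (p q : nat -> nat)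
             (mu : forall n, (R -> 'M[R[i]]_(p n * q n)) -> Z),
      [/\ forall n, [&& 0 < p n, 0 < q n & coprime (p n) (q n)]%N,
          forall n, dimension_drop_embedding (mu n),
          forall n, mu n @` dimension_drop (p n) (q n) `<=`
                    mu n.+1 @` dimension_drop (p n.+1) (q n.+1)
        & forall (z : Z) (e : R), 0 < e ->
          exists n, exists2 f, dimension_drop (p n) (q n) f &
            cnorm (z - mu n f) < e]].

End JiangSu.

(* Closed L(C)-terms; [cterm k] is the set of terms whose sort is the ball of
   radius k. The constants of C of that sort are the [tconst _ i], i : nat.
   [tscale a b] is multiplication by a + bi, with value in any ball of integer
   radius l such that |a + bi| k <= l. *)
Inductive cterm : nat -> Type :=
| tconst k of (0 < k)%N & nat : cterm k
| tzero : cterm 1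
| tone : cterm 1
| tadd j k of cterm j & cterm k : cterm (j + k)
| tmul j k of cterm j & cterm k : cterm (j * k)
| tstar k of cterm k : cterm k
| tscale (a b : rat) k l of (0 < l)%N
    & (a ^+ 2 + b ^+ 2) * k%:R ^+ 2 <= l%:R ^+ 2 & cterm k : cterm l
| tincl k l of (k <= l)%N & cterm k : cterm l.

Section Interpretation.
Variables (R : realType) (A : cstarAlgType R).

Record constants := Constants {
  cval :> nat -> nat -> A;
  cval_ball : forall k i, (0 < k)%N -> cnorm (cval k i) <= k%:R }.

Fixpoint teval (c : constants) k (t : cterm k) : A :=
  match t with
  | tconst k _ i => c k i
  | tzero => 0
  | tone => 1
  | tadd _ _ s t => teval c s + teval c t
  | tmul _ _ s t => teval c s * teval c t
  | tstar _ s => star (teval c s)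
  | tscale a b _ _ _ _ s => (ratr a +i* ratr b)%C *: teval c s
  | tincl _ _ _ s => teval c s
  end.

Lemma teval_ball c k (t : cterm k) : cnorm (teval c t) <= k%:R.
Proof.
elim: t => {k} /= [k k0 i|||j k s IHs t IHt|j k s IHs t IHt|k s IHs
                  |a b k l l0 abkl s IHs|k l kl s IHs].
- exact: cval_ball.
- by rewrite cnorm0.
- by rewrite cnorm1.
- by rewrite natrD (le_trans (ler_cnormD _ _))// lerD.
- by rewrite natrM (le_trans (ler_cnormM _ _))// ler_pM// cnorm_ge0.
- by rewrite cnorm_star.
- rewrite cnormZ (@le_trans _ _ (normc (ratr a +i* ratr b)%C * k%:R))//.
    by rewrite ler_wpM2l// normc_ge0.
  rewrite -(@ler_pXn2r _ 2)// ?nnegrE ?mulr_ge0 ?normc_ge0//.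
  rewrite exprMn /normc sqr_sqrtr ?addr_ge0 ?sqr_ge0//.
  have := abkl; rewrite -(ler_rat R).
  by rewrite !(rmorphM, rmorphD, rmorphXn) /= !ratr_nat.
- by rewrite (le_trans IHs)// ler_nat.
Qed.

End Interpretation.

Record connectives (R : realType) := Connectives {
  conn :> countType;
  arity : conn -> nat;
  conn_fun : forall u : conn, 'rV[R]_(arity u) -> R }.

Section Formulas.
Variables (R : realType) (F : connectives R).

Inductive composition n : Type :=
| cvar of 'I_n
| capp (u : F) of ('I_(arity u) -> composition n).

Fixpoint comp_fun n (g : composition n) (x : 'rV[R]_n) : R :=
  match g with
  | cvar i => x ord0 i
  | capp u gs => conn_fun (\row_i comp_fun (gs i) x)
  end.

(* Formulas take values in bounded intervals, so approximation is uniform on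
   every cube. *)
Definition dense_connectives : Prop :=
  (forall u : F, continuous (@conn_fun R F u)) /\
  forall n (h : 'rV[R]_n.+1 -> R), continuous h ->
    forall M e : R, 0 < e -> exists g : composition n.+1,
      forall x : 'rV[R]_n.+1,
        (forall i, `|x ord0 i| <= M) -> `|h x - comp_fun g x| < e.

Inductive formula : Type :=
| Atom k of cterm k & cterm k
| Conn (u : F) of ('I_(arity u) -> formula).

Section Value.
Variables (A : cstarAlgType R) (c : constants A).

Fixpoint feval (phi : formula) : R :=
  match phi with
  | Atom _ s t => cnorm (teval c s - teval c t)
  | Conn u phis => conn_fun (\row_i feval (phis i))
  end.

End Value.

(* [(phi, r)] stands for the expression phi < r. *)
Definition expression : Type := formula * R.

Definition satisfies (A : cstarAlgType R) (c : constants A)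
    (p : set expression) : Prop :=
  forall phi r, p (phi, r) -> feval c phi < r.

Definition satisfiable (p : set expression) : Prop :=
  exists (A : cstarAlgType R) (c : constants A), sfp A /\ satisfies c p.

Definition entails (p : set expression) (phi : formula) (r : R) : Prop :=
  forall (A : cstarAlgType R) (c : constants A),
    sfp A -> satisfies c p -> feval c phi = r.

Definition definitive (p : set expression) : Prop :=
  forall k (s t : cterm k), exists! r, entails p (Atom s t) r.

(* [A], with [c], is the completion of the prestructure on closed terms in which
   the distance of s and t is the r with T, p |= d(s, t) = r: the evaluation of
   terms preserves distances, and is dense in each sort. *)
Definition compiled (p : set expression) (A : cstarAlgType R)
    (c : constants A) : Prop :=
  (forall k (s t : cterm k) r, entails p (Atom s t) r ->
     cnorm (teval c s - teval c t) = r) /\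
  (forall k (x : A), (0 < k)%N -> cnorm x <= k%:R ->
     forall e : R, 0 < e -> exists t : cterm k, cnorm (x - teval c t) < e).

Record condition := Condition {
  cond_set :> set expression;
  cond_finite : finite_set cond_set;
  cond_sat : satisfiable cond_set }.

(* A strategy of the second player maps the earlier moves and the last move of
   the first player to an answer. *)
Definition strategy : Type := seq condition -> condition -> condition.

Definition legal (sigma : strategy) : Prop :=
  forall h (p : condition), p `<=` sigma h p.

Definition play (p : nat -> condition) : Prop := forall i, p i `<=` p i.+1.

Definition follows (sigma : strategy) (p : nat -> condition) : Prop :=
  forall i, p i.*2.+1 = sigma (mkseq p i.*2) (p i.*2).

Definition enforceable (P : cstarAlgType R -> Prop) : Prop :=
  exists2 sigma, legal sigma &
    forall p, play p -> follows sigma p ->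
      let pbar := \bigcup_i (p i : set expression) in
      definitive pbar /\
      exists (A : cstarAlgType R) (c : constants A), compiled pbar c /\ P A.

Definition enforceable_algebra (B : cstarAlgType R) : Prop :=
  enforceable (fun A => isomorphic A B).

End Formulas.

(* Main.v *)
(** (1) and (3) fail. Let A be the algebra of the paths in M_7 that start in the
    matrices diag(a,a,a,a,a,a,b) and end in the matrices diag(c,c,c,d,d,e,e). The
    rank of a projection is constant along the path, and the only sums that both
    6 + 1 and 3 + 2 + 2 contain are 0 and 7, so A is projectionless. But twice
    these two lists split in a common way, as 14 = 6 + 6 + 2 = 6 + 6 + (1 + 1) =
    (3 + 3) + (2 + 2 + 2) + 2, so that M_2(A) has three nonzero idempotents with
    sum 1. There are no such idempotents in M_2 of an ultrapower of Z: otherwise,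
    as approximate idempotents are close to idempotents, there would be three
    nonzero idempotents with sum close to 1 in M_2 of a prime dimension drop
    algebra, where ranks are multiples of p and of q, hence at least pq, while the
    sum has rank 2pq. So A does not embed in any ultrapower of Z, which refutes
    (1), and (3) fails because the first player can open with a condition that
    describes the three idempotents of M_2(A) approximately. As Z embeds in its
    ultrapower, (2) implies (3). *)

Require Import Defs.
From HB Require Import structures.
From mathcomp Require Import all_boot all_order all_algebra.
From mathcomp Require Import ring lra complex mxtens.
From mathcomp Require Import all_classical all_reals all_analysis.
Set Implicit Arguments.
Unset Strict Implicit.
Unset Printing Implicit Defensive.
Import Order.TTheory GRing.Theory Num.Theory numFieldNormedType.Exports.
Import ComplexField.Normc.
Local Open Scope complex_scope.
Local Open Scope classical_set_scope.
Local Open Scope ring_scope.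

(** * Operator norm of complex matrices *)

(** Working with idempotents rather than projections spares functional calculus in the matrix
    algebra: a polynomial Newton iteration repairs an approximate idempotent, with a tolerance that
    does not depend on the algebra. This uniformity lets a single lemma serve the compiled structure
    of a game, the coordinates of an ultrapower and the stages of the limit that defines Z. The sum
    of the idempotents is never repaired. It only has to stay within 1/4 of 1, because the trace
    sees an error of at most pq/4 where the rank count is off by at least pq; the tolerances 1/16,
    1/8, 1/6, 1/4 are relaxed from one passage to the next. The main obstacle is the limit: the
    copies of the dimension drop algebras in Z are given by purely algebraic embeddings, and norm
    estimates can be pulled back only after these are shown to be isometric. Matrices over an
    algebra are measured by the sum of the norms of their entries, which finitely many atomic
    formulas control. *)

Section ComplexModulus.
Variable R : realType.
Implicit Types a b : R[i].

Lemma normc_norm a : `|a| = (normc a)%:C.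
Proof. by []. Qed.

Lemma ler_normcD a b : normc (a + b) <= normc a + normc b.
Proof. by rewrite -lecR rmorphD /= -!normc_norm ler_normD. Qed.

Lemma normcB a b : normc (a - b) = normc (b - a).
Proof. by apply: complexI; rewrite -!normc_norm distrC. Qed.

Lemma normc_conj a : normc a^*%C = normc a.
Proof. by case: a => x y; rewrite /normc /= sqrrN. Qed.

Lemma normc_real (r : R) : normc r%:C = `|r|.
Proof. by rewrite /normc /= expr0n addr0 sqrtr_sqr. Qed.

Lemma sqr_normcE a : (normc a ^+ 2)%:C = a^*%C * a.
Proof. by rewrite rmorphXn /= -normc_norm sqr_normc mulrC. Qed.

Lemma normc_sum I (r : seq I) (P : pred I) (F : I -> R[i]) :
  normc (\sum_(i <- r | P i) F i) <= \sum_(i <- r | P i) normc (F i).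
Proof.
elim/big_rec2: _ => [|i y x _ h]; first by rewrite normc0.
by rewrite (le_trans (ler_normcD _ _))// lerD2l.
Qed.

Lemma Re_normc a : `|complex.Re a| <= normc a.
Proof. by rewrite -lecR -normc_norm; exact: normc_ge_Re. Qed.

Lemma Im_normc a : `|complex.Im a| <= normc a.
Proof.
case: a => x y; rewrite /normc /= -(sqrtr_sqr y) ler_sqrt ?addr_ge0 ?sqr_ge0//.
by rewrite lerDr sqr_ge0.
Qed.

Lemma normc_le_ReIm a : normc a <= `|complex.Re a| + `|complex.Im a|.
Proof.
rewrite {1}[a]complexE (le_trans (ler_normcD _ _))// normcM !normc_real.
by rewrite {1}/normc /= expr0n expr1n add0r sqrtr1 mul1r.
Qed.

End ComplexModulus.

HB.lock Definition vnorm (R : realType) n (v : 'cV[R[i]]_n) : R :=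
  Num.sqrt (\sum_i normc (v i ord0) ^+ 2).
Arguments vnorm {R n} v.

Section VectorNorm.
Variables (R : realType) (n : nat).
Implicit Types u v : 'cV[R[i]]_n.


Lemma vnorm_sqr v : vnorm v ^+ 2 = \sum_i normc (v i ord0) ^+ 2.
Proof. by rewrite vnorm.unlock sqr_sqrtr// sumr_ge0// => i _; rewrite sqr_ge0. Qed.

Lemma vnorm_ge0 v : 0 <= vnorm v. Proof. by rewrite vnorm.unlock sqrtr_ge0. Qed.

Lemma vnorm0 : vnorm (0 : 'cV[R[i]]_n) = 0.
Proof. by rewrite vnorm.unlock big1 ?sqrtr0// => i _; rewrite mxE normc0 expr0n. Qed.

Lemma vnormZ a v : vnorm (a *: v) = normc a * vnorm v.
Proof.
rewrite vnorm.unlock -(ger0_norm (normc_ge0 a)) -sqrtr_sqr -sqrtrM ?sqr_ge0//.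
congr Num.sqrt; rewrite mulr_sumr; apply: eq_bigr => i _.
by rewrite mxE normcM exprMn.
Qed.

Lemma normc_le_vnorm v i : normc (v i ord0) <= vnorm v.
Proof.
rewrite -(@ler_pXn2r _ 2)// ?nnegrE ?normc_ge0 ?vnorm_ge0// vnorm_sqr.
by rewrite (bigD1 i)//= lerDl sumr_ge0// => j _; rewrite sqr_ge0.
Qed.

Lemma vnorm_eq0 v : vnorm v = 0 -> v = 0.
Proof.
move=> v0; apply/colP => i; rewrite mxE; apply: eq0_normc.
by apply/eqP; rewrite eq_le normc_ge0 andbT -v0 normc_le_vnorm.
Qed.

(** Weighting by the ratio of the norms reduces the claim to the termwise inequality 2ab <=
    (|v|/|u|) a^2 + (|u|/|v|) b^2, whose sides differ by a positive multiple of a square. *)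
Lemma vnorm_cauchy_schwarz u v :
  \sum_i normc (u i ord0) * normc (v i ord0) <= vnorm u * vnorm v.
Proof.
have [->|u0] := eqVneq u 0.
  rewrite vnorm0 mul0r big1// => i _; by rewrite mxE normc0 mul0r.
have [->|v0] := eqVneq v 0.
  rewrite vnorm0 mulr0 big1// => i _; by rewrite mxE normc0 mulr0.
have nu : 0 < vnorm u.
  by rewrite lt_def vnorm_ge0 andbT; apply: contra_neq u0 => /vnorm_eq0.
have nv : 0 < vnorm v.
  by rewrite lt_def vnorm_ge0 andbT; apply: contra_neq v0 => /vnorm_eq0.
rewrite -(@ler_pM2l _ 2)//.
have -> : 2 * (vnorm u * vnorm v) = vnorm v / vnorm u * vnorm u ^+ 2 +
   vnorm u / vnorm v * vnorm v ^+ 2 by field; rewrite !gt_eqF.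
rewrite !vnorm_sqr !mulr_sumr -big_split /=; apply: ler_sum => i _.
set a := normc (u i ord0); set b := normc (v i ord0).
rewrite -subr_ge0.
have -> : vnorm v / vnorm u * a ^+ 2 + vnorm u / vnorm v * b ^+ 2 - 2 * (a * b)
  = (vnorm v * a - vnorm u * b) ^+ 2 / (vnorm u * vnorm v).
  by field; rewrite !gt_eqF.
by rewrite divr_ge0 ?sqr_ge0// mulr_ge0// ltW.
Qed.

Lemma ler_vnormD u v : vnorm (u + v) <= vnorm u + vnorm v.
Proof.
rewrite -(@ler_pXn2r _ 2)// ?nnegrE ?addr_ge0 ?vnorm_ge0// sqrrD !vnorm_sqr.
apply: (@le_trans _ _ (\sum_i (normc (u i ord0) + normc (v i ord0)) ^+ 2)).
  apply: ler_sum => i _; rewrite mxE ler_pXn2r ?nnegrE ?addr_ge0 ?normc_ge0//.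
  exact: ler_normcD.
have -> : \sum_i (normc (u i ord0) + normc (v i ord0)) ^+ 2 =
  \sum_i normc (u i ord0) ^+ 2 +
  (\sum_i normc (u i ord0) * normc (v i ord0)) * 2 + \sum_i normc (v i ord0) ^+ 2.
  by rewrite mulr_suml -!big_split; apply: eq_bigr => i _ /=; ring.
by rewrite lerD2r lerD2l mulr_natr lerMn2r vnorm_cauchy_schwarz.
Qed.

End VectorNorm.

Definition mxadj (R : realType) m n (M : 'M[R[i]]_(m, n)) : 'M[R[i]]_(n, m) :=
  (map_mx conjc M)^T.

Lemma mxadjK (R : realType) m n (M : 'M[R[i]]_(m, n)) : mxadj (mxadj M) = M.
Proof. by apply/matrixP => i j; rewrite !mxE conjcK. Qed.

Lemma mxadjD (R : realType) m n (M N : 'M[R[i]]_(m, n)) :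
  mxadj (M + N) = mxadj M + mxadj N.
Proof. by apply/matrixP => i j; rewrite !mxE rmorphD. Qed.

Lemma mxadjZ (R : realType) m n a (M : 'M[R[i]]_(m, n)) :
  mxadj (a *: M) = a^*%C *: mxadj M.
Proof. by apply/matrixP => i j; rewrite !mxE rmorphM. Qed.

Lemma mxadjM (R : realType) m n p (M : 'M[R[i]]_(m, n)) (N : 'M[R[i]]_(n, p)) :
  mxadj (M *m N) = mxadj N *m mxadj M.
Proof. by rewrite /mxadj map_mxM trmx_mul. Qed.

Lemma mxadj1 (R : realType) n : mxadj (1%:M : 'M[R[i]]_n) = 1%:M.
Proof. by rewrite /mxadj map_mx1 trmx1. Qed.

HB.lock Definition opnorm (R : realType) n (M : 'M[R[i]]_n) : R :=
  sup [set vnorm (M *m v) | v in [set v | vnorm v <= 1]].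
Arguments opnorm {R n} M.

Section OperatorNorm.
Variables (R : realType) (n : nat).
Implicit Types (M N : 'M[R[i]]_n) (v : 'cV[R[i]]_n).


Definition entry_sum M : R := \sum_i \sum_j normc (M i j).

Lemma entry_sum_ge0 M : 0 <= entry_sum M.
Proof.
by apply: sumr_ge0 => i _; apply: sumr_ge0 => j _; exact: normc_ge0.
Qed.

Lemma vnorm_le_sum v : vnorm v <= \sum_i normc (v i ord0).
Proof.
have s0 : 0 <= \sum_i normc (v i ord0) by rewrite sumr_ge0// => i _; exact: normc_ge0.
rewrite -(@ler_pXn2r _ 2)// ?nnegrE ?vnorm_ge0// vnorm_sqr expr2 mulr_suml.
apply: ler_sum => i _; rewrite expr2 ler_wpM2l ?normc_ge0//.
by rewrite (bigD1 i)//= lerDl sumr_ge0// => j _; exact: normc_ge0.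
Qed.

Lemma vnorm_mul_entry_sum M v : vnorm (M *m v) <= entry_sum M * vnorm v.
Proof.
rewrite (le_trans (vnorm_le_sum _))// /entry_sum mulr_suml; apply: ler_sum => i _.
rewrite mxE mulr_suml (le_trans (normc_sum _ _ _))//; apply: ler_sum => j _.
by rewrite normcM ler_wpM2l ?normc_ge0// normc_le_vnorm.
Qed.

Lemma opnorm_has_sup M :
  has_sup [set vnorm (M *m v) | v in [set v | vnorm v <= 1]].
Proof.
split; first by exists (vnorm (M *m 0)), 0 => //=; rewrite vnorm0.
exists (entry_sum M) => _ [v /= v1 <-].
by rewrite (le_trans (vnorm_mul_entry_sum _ _))// ler_piMr// entry_sum_ge0.
Qed.

Lemma opnorm_ge0 M : 0 <= opnorm M.
Proof.
rewrite opnorm.unlock; apply: (@le_trans _ _ (vnorm (M *m 0))); first exact: vnorm_ge0.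
by apply: ub_le_sup; [case: (opnorm_has_sup M)|exists 0 => //=; rewrite vnorm0].
Qed.

Lemma vnorm_mul_opnorm M v : vnorm (M *m v) <= opnorm M * vnorm v.
Proof.
have [->|v0] := eqVneq v 0; first by rewrite mulmx0 vnorm0 mulr0.
have nv : 0 < vnorm v.
  by rewrite lt_def vnorm_ge0 andbT; apply: contra_neq v0 => /vnorm_eq0.
rewrite -ler_pdivrMr// mulrC.
have -> : (vnorm v)^-1 * vnorm (M *m v) = vnorm (M *m ((vnorm v)^-1%:C *: v)).
  by rewrite -scalemxAr vnormZ normc_real ger0_norm// invr_ge0 ltW.
rewrite opnorm.unlock.
apply: ub_le_sup; first by case: (opnorm_has_sup M).
exists ((vnorm v)^-1%:C *: v) => //=.
rewrite vnormZ normc_real ger0_norm ?invr_ge0 ?vnorm_ge0//.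
by rewrite mulVf ?gt_eqF.
Qed.

Lemma opnorm_le M c : 0 <= c -> (forall v, vnorm (M *m v) <= c * vnorm v) ->
  opnorm M <= c.
Proof.
move=> c0 h; rewrite opnorm.unlock; apply: ge_sup; first by case: (opnorm_has_sup M).
by move=> _ [v /= v1 <-]; rewrite (le_trans (h v))// ler_piMr.
Qed.

Lemma opnorm_le_entry_sum M : opnorm M <= entry_sum M.
Proof. by apply: opnorm_le (entry_sum_ge0 M) (vnorm_mul_entry_sum M). Qed.

Lemma normc_le_opnorm M i j : normc (M i j) <= opnorm M.
Proof.
have d1 : vnorm (delta_mx j 0 : 'cV[R[i]]_n) = 1.
  rewrite vnorm.unlock (bigD1 j)//= big1 ?addr0 => [|k kj].
    by rewrite mxE !eqxx normc1 expr1n sqrtr1.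
  by rewrite mxE (negbTE kj) normc0 expr0n.
have := vnorm_mul_opnorm M (delta_mx j 0); rewrite d1 mulr1.
apply: le_trans.
have := normc_le_vnorm (M *m (delta_mx j 0 : 'cV[R[i]]_n)) i.
by rewrite -colE mxE.
Qed.

Lemma opnorm_eq0 M : opnorm M = 0 -> M = 0.
Proof.
move=> M0; apply/matrixP => i j; rewrite mxE; apply: eq0_normc.
by apply/eqP; rewrite eq_le normc_ge0 andbT -M0 normc_le_opnorm.
Qed.

Lemma ler_opnormD M N : opnorm (M + N) <= opnorm M + opnorm N.
Proof.
apply: opnorm_le => [|v]; first by rewrite addr_ge0 ?opnorm_ge0.
by rewrite mulmxDl (le_trans (ler_vnormD _ _))// mulrDl lerD ?vnorm_mul_opnorm.
Qed.

Lemma opnormZ_le a M : opnorm (a *: M) <= normc a * opnorm M.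
Proof.
apply: opnorm_le => [|v]; first by rewrite mulr_ge0 ?normc_ge0 ?opnorm_ge0.
by rewrite -scalemxAl vnormZ -mulrA ler_wpM2l ?normc_ge0 ?vnorm_mul_opnorm.
Qed.

Lemma opnormZ a M : opnorm (a *: M) = normc a * opnorm M.
Proof.
apply/eqP; rewrite eq_le opnormZ_le /=.
have [->|a0] := eqVneq a 0; first by rewrite normc0 mul0r opnorm_ge0.
have na : 0 < normc a.
  by rewrite lt_def normc_ge0 andbT; apply: contra_neq a0 => /eq0_normc.
rewrite -ler_pdivlMl// -normcV -{1}(scale1r M) -(mulVf a0) -scalerA.
exact: opnormZ_le.
Qed.

Lemma opnormN M : opnorm (- M) = opnorm M.
Proof.
by rewrite -scaleN1r opnormZ /normc /= oppr0 expr0n addr0 sqrrN expr1n sqrtr1 mul1r.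
Qed.

Lemma opnormB M N : opnorm (M - N) = opnorm (N - M).
Proof. by rewrite -opnormN opprB. Qed.

Lemma opnorm_tri L M N : opnorm (M - N) <= opnorm (M - L) + opnorm (L - N).
Proof. by have := ler_opnormD (M - L) (L - N); rewrite addrA subrK. Qed.

Lemma ler_opnormM M N : opnorm (M *m N) <= opnorm M * opnorm N.
Proof.
apply: opnorm_le => [|v]; first by rewrite mulr_ge0 ?opnorm_ge0.
rewrite -mulmxA (le_trans (vnorm_mul_opnorm _ _))// -mulrA.
by rewrite ler_wpM2l ?opnorm_ge0 ?vnorm_mul_opnorm.
Qed.

Lemma vnorm_sqr_adj v : (vnorm v ^+ 2)%:C = (mxadj v *m v) ord0 ord0.
Proof.
rewrite vnorm_sqr rmorph_sum mxE; apply: eq_bigr => i _.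
by rewrite /= sqr_normcE !mxE.
Qed.

Lemma normc_dot_le (v w : 'cV[R[i]]_n) :
  normc ((mxadj v *m w) ord0 ord0) <= vnorm v * vnorm w.
Proof.
rewrite mxE (le_trans (normc_sum _ _ _))//.
apply: le_trans (vnorm_cauchy_schwarz v w); apply: ler_sum => i _.
by rewrite normcM !mxE normc_conj.
Qed.

(** |Mv|^2 is the inner product of v with [mxadj M *m M *m v], so Cauchy-Schwarz bounds it by
    [opnorm (mxadj M *m M)] times |v|^2. *)
Lemma opnorm_sqr_le M : opnorm M ^+ 2 <= opnorm (mxadj M *m M).
Proof.
rewrite -[leRHS](sqr_sqrtr (opnorm_ge0 _)).
rewrite ler_pXn2r ?nnegrE ?opnorm_ge0 ?sqrtr_ge0//.
apply: opnorm_le => [|v]; first exact: sqrtr_ge0.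
rewrite -(@ler_pXn2r _ 2)// ?nnegrE ?mulr_ge0 ?sqrtr_ge0 ?vnorm_ge0//.
rewrite exprMn sqr_sqrtr ?opnorm_ge0//.
have -> : vnorm (M *m v) ^+ 2 = normc ((mxadj v *m (mxadj M *m M *m v)) ord0 ord0).
  rewrite -[LHS]ger0_norm ?sqr_ge0// -normc_real vnorm_sqr_adj.
  by rewrite mxadjM !mulmxA.
rewrite (le_trans (normc_dot_le _ _))// mulrC expr2 mulrA.
by rewrite ler_wpM2r ?vnorm_ge0// vnorm_mul_opnorm.
Qed.

(** With L' the adjoint of L, |L|^2 <= |L'L| <= |L'| |L|, and |L| cancels; the converse is the same
    bound for L'. *)
Lemma opnorm_adj M : opnorm (mxadj M) = opnorm M.
Proof.
have le (L : 'M[R[i]]_n) : opnorm L <= opnorm (mxadj L).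
  have [->|L0] := eqVneq (opnorm L) 0; first exact: opnorm_ge0.
  have nL : 0 < opnorm L by rewrite lt_def L0 opnorm_ge0.
  rewrite -(ler_pM2r nL) -expr2 (le_trans (opnorm_sqr_le _))//.
  exact: ler_opnormM.
by apply/eqP; rewrite eq_le le andbT -{2}(mxadjK M) le.
Qed.

Lemma opnorm_adj_mul M : opnorm (mxadj M *m M) = opnorm M ^+ 2.
Proof.
apply/eqP; rewrite eq_le opnorm_sqr_le andbT.
by rewrite (le_trans (ler_opnormM _ _))// opnorm_adj expr2.
Qed.

Lemma opnorm_trace M : normc (\tr M) <= n%:R * opnorm M.
Proof.
rewrite (le_trans (normc_sum _ _ _))//.
apply: (@le_trans _ _ (\sum_(i < n) opnorm M)).
  by apply: ler_sum => i _; exact: normc_le_opnorm.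
by rewrite sumr_const card_ord mulr_natl.
Qed.

End OperatorNorm.

(** * Algebras of matrix-valued paths *)

Section MatrixLimits.
Variable R : realType.

Lemma real_cauchy_complete (u : nat -> R) :
  (forall e : R, 0 < e -> exists N, forall m n,
     (N <= m)%N -> (N <= n)%N -> `|u m - u n| < e) ->
  exists l : R, forall e : R, 0 < e -> exists N, forall n,
    (N <= n)%N -> `|u n - l| < e.
Proof.
move=> cau.
have cu : cvg (u @ \oo).
  apply: cauchy_cvg; apply: cauchy_exP => e e0.
  have [N NP] := cau _ e0; exists (u N).
  by exists N => // m /= Nm; exact: NP.
exists (lim (u @ \oo)) => e e0.
have /cvgrPdist_lt/(_ e e0)[N _ NP] := cu.
by exists N => n Nn; rewrite distrC; exact: NP.
Qed.

Lemma complex_cauchy_complete (u : nat -> R[i]) :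
  (forall e : R, 0 < e -> exists N, forall m n,
     (N <= m)%N -> (N <= n)%N -> normc (u m - u n) < e) ->
  exists l : R[i], forall e : R, 0 < e -> exists N, forall n,
    (N <= n)%N -> normc (u n - l) < e.
Proof.
move=> cau.
have ReB (a b : R[i]) : complex.Re (a - b) = complex.Re a - complex.Re b.
  by case: a b => ? ? [].
have ImB (a b : R[i]) : complex.Im (a - b) = complex.Im a - complex.Im b.
  by case: a b => ? ? [].
have [x xP] : exists x : R, forall e : R, 0 < e -> exists N, forall n,
    (N <= n)%N -> `|complex.Re (u n) - x| < e.
  apply: real_cauchy_complete => e /cau[N NP]; exists N => m n Nm Nn.
  by rewrite -ReB (le_lt_trans (Re_normc _))// NP.
have [y yP] : exists y : R, forall e : R, 0 < e -> exists N, forall n,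
    (N <= n)%N -> `|complex.Im (u n) - y| < e.
  apply: real_cauchy_complete => e /cau[N NP]; exists N => m n Nm Nn.
  by rewrite -ImB (le_lt_trans (Im_normc _))// NP.
exists (x +i* y)%C => e e0; have e20 : 0 < e / 2 by rewrite divr_gt0.
have [N NP] := xP _ e20; have [M MP] := yP _ e20.
exists (maxn N M) => n; rewrite geq_max => /andP[Nn Mn].
rewrite (le_lt_trans (normc_le_ReIm _))// ReB ImB /= [e]splitr.
by rewrite ltrD ?NP ?MP.
Qed.

Lemma mx_cauchy_complete n (u : nat -> 'M[R[i]]_n) :
  (forall e : R, 0 < e -> exists N, forall m k,
     (N <= m)%N -> (N <= k)%N -> opnorm (u m - u k) < e) ->
  exists l, forall e : R, 0 < e -> exists N, forall m,
    (N <= m)%N -> opnorm (u m - l) < e.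
Proof.
move=> cau.
have ex (ij : 'I_n * 'I_n) : exists l : R[i], forall e : R, 0 < e ->
    exists N, forall m, (N <= m)%N -> normc (u m ij.1 ij.2 - l) < e.
  apply: complex_cauchy_complete => e /cau[N NP]; exists N => m k Nm Nk.
  rewrite (le_lt_trans _ (NP m k Nm Nk))//.
  by have := normc_le_opnorm (u m - u k) ij.1 ij.2; rewrite !mxE.
have [l lP] := choice ex.
exists (\matrix_(i, j) l (i, j)) => e e0.
(* One more than the number of entries: positive even for n = 0, and it makes the final inequality
   strict. *)
pose K : R := (n * n).+1%:R.
have K0 : 0 < K by rewrite ltr0n.
have eK0 : 0 < e / K by rewrite divr_gt0.
have [N NP] := choice (fun ij => lP ij _ eK0).
exists (\max_ij N ij) => m Nm.
rewrite (le_lt_trans (opnorm_le_entry_sum _))//.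
apply: (@le_lt_trans _ _ (\sum_(i < n) \sum_(j < n) (e / K))).
  apply: ler_sum => i _; apply: ler_sum => j _; rewrite !mxE ltW//.
  apply: (NP (i, j)); apply: leq_trans Nm.
  exact: (leq_bigmax (F := N) (i, j)).
rewrite !sumr_const !card_ord -mulrnA -mulr_natr mulrAC -mulrA.
by rewrite gtr_pMr// ltr_pdivrMr// mul1r ltr_nat.
Qed.

End MatrixLimits.

Lemma ler_normN (R : realType) (x : R) : - x <= `|x|.
Proof. by rewrite -normrN ler_norm. Qed.

Section Clamp.
Variable R : realType.
Implicit Types x y : R.

Definition clamp x : R := Num.max 0 (Num.min x 1).

Lemma clamp_itv x : clamp x \in `[0, 1].
Proof. by rewrite in_itv /= /clamp le_max lexx ge_max ler01 ge_min lexx orbT. Qed.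

Lemma clamp_id x : x \in `[0, 1] -> clamp x = x.
Proof.
by rewrite in_itv /= => /andP[x0 x1]; rewrite /clamp min_l// max_r.
Qed.

Lemma clampK x : clamp (clamp x) = clamp x.
Proof. exact/clamp_id/clamp_itv. Qed.

Lemma clamp0 : clamp 0 = 0.
Proof. by rewrite clamp_id// in_itv /= lexx ler01. Qed.

Lemma clamp1 : clamp 1 = 1.
Proof. by rewrite clamp_id// in_itv /= lexx ler01. Qed.

Lemma clamp_lip x y : `|clamp x - clamp y| <= `|x - y|.
Proof.
have cl t : [\/ t <= 0 /\ clamp t = 0, 0 <= t <= 1 /\ clamp t = t |
                1 <= t /\ clamp t = 1].
  have [t0|t0] := leP t 0; first by apply: Or31; rewrite /clamp min_l ?max_l//; lra.
  have [t1|t1] := leP t 1; last first.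
    by apply: Or33; rewrite /clamp min_r ?max_r//; lra.
  by apply: Or32; rewrite /clamp min_l // max_r ?(ltW t0).
have := ler_norm (x - y); have := ler_normN (x - y).
have := normr_ge0 (x - y).
by case: (cl x) => -[hx ->]; case: (cl y) => -[hy ->]; rewrite ler_norml => *;
  apply/andP; split; lra.
Qed.

End Clamp.

(** The possible end conditions of paths. Closedness is what makes the path algebras complete. The
    counterexample and the dimension drop algebras are both obtained by a choice of two such
    subalgebras. *)
Record mxsubalg (R : realType) n := MxSubalg {
  mxsubalg_set :> 'M[R[i]]_n -> Prop;
  mxsubalg1 : mxsubalg_set 1%:M;
  mxsubalgD : forall M N, mxsubalg_set M -> mxsubalg_set N -> mxsubalg_set (M + N);
  mxsubalgZ : forall a M, mxsubalg_set M -> mxsubalg_set (a *: M);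
  mxsubalgM : forall M N, mxsubalg_set M -> mxsubalg_set N -> mxsubalg_set (M *m N);
  mxsubalgJ : forall M, mxsubalg_set M -> mxsubalg_set (mxadj M);
  mxsubalg_closed : forall M, (forall e : R, 0 < e ->
    exists2 N, mxsubalg_set N & opnorm (M - N) < e) -> mxsubalg_set M }.

Section PathPredicate.
Variables (R : realType) (n : nat) (S0 S1 : mxsubalg R n).
Implicit Types f g : R -> 'M[R[i]]_n.

Definition mxcont f : Prop := forall x (e : R), 0 < e ->
  exists2 d : R, 0 < d & forall y, `|x - y| < d -> opnorm (f x - f y) < e.

(* The paths are indexed by the whole line, to make equality extensional. *)
Definition is_path f : Prop :=
  [/\ forall x, f x = f (clamp x), mxcont f, S0 (f 0) & S1 (f 1)].

Lemma mxcont_cst M : mxcont (fun=> M).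
Proof.
move=> x e e0; exists 1 => // y _.
by rewrite subrr -(scale0r 0) opnormZ normc0 mul0r.
Qed.

Lemma mxcontD f g : mxcont f -> mxcont g -> mxcont (fun x => f x + g x).
Proof.
move=> cf cg x e e0; have e20 : 0 < e / 2 by rewrite divr_gt0.
have [d d0 dP] := cf x _ e20; have [d' d'0 d'P] := cg x _ e20.
exists (Num.min d d') => [|y]; first by rewrite lt_min d0.
rewrite lt_min => /andP[h1 h2]; rewrite opprD addrACA.
by rewrite (le_lt_trans (ler_opnormD _ _))// [e]splitr ltrD ?dP ?d'P.
Qed.

Lemma mxcontZ a f : mxcont f -> mxcont (fun x => a *: f x).
Proof.
move=> cf x e e0.
have a0 : 0 < normc a + 1 by rewrite ltr_wpDl// normc_ge0.
have ea0 : 0 < e / (normc a + 1) by rewrite divr_gt0.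
have [d d0 dP] := cf x _ ea0; exists d => // y /dP.
rewrite -scalerBr opnormZ ltr_pdivlMr//; apply: le_lt_trans.
by rewrite mulrC ler_wpM2l ?opnorm_ge0// lerDl.
Qed.

Lemma mxcontM f g : mxcont f -> mxcont g -> mxcont (fun x => f x *m g x).
Proof.
move=> cf cg x e e0.
pose K := opnorm (f x) + opnorm (g x) + 2.
have K0 : 0 < K by rewrite ltr_wpDl// addr_ge0 ?opnorm_ge0.
have m0 : 0 < Num.min 1 (e / K / 2).
  by rewrite lt_min ltr01 !divr_gt0.
have [d d0 dP] := cf x _ m0; have [d' d'0 d'P] := cg x _ m0.
exists (Num.min d d') => [|y]; first by rewrite lt_min d0.
rewrite lt_min => /andP[/dP h1 /d'P h2].
move: h1 h2; rewrite !lt_min => /andP[h1 h1'] /andP[h2 h2'].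
(* Apart from differences, only values at x occur, so no bound on f and g near x is required. The
   minimum with 1 makes the quadratic term linear in the tolerance. *)
have -> : f x *m g x - f y *m g y =
    (f x - f y) *m g x + f x *m (g x - g y) - (f x - f y) *m (g x - g y).
  rewrite !(mulmxBl, mulmxBr); move: (f x *m g x) (f y *m g y) => a b.
  move: (f y *m g x) (f x *m g y) => c d0'.
  by apply/matrixP => i j; rewrite !mxE; ring.
rewrite (le_lt_trans (ler_opnormD _ _))// opnormN.
have fg := opnorm_ge0 (f x); have gg := opnorm_ge0 (g x).
have a0 := opnorm_ge0 (f x - f y); have b0 := opnorm_ge0 (g x - g y).
apply: (@le_lt_trans _ _ (opnorm (f x - f y) * opnorm (g x) +
   opnorm (f x) * opnorm (g x - g y) + opnorm (f x - f y) * opnorm (g x - g y))).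
  by rewrite lerD ?ler_opnormM// (le_trans (ler_opnormD _ _))// lerD ?ler_opnormM.
have eK : e / K / 2 * K * 2 = e by field; rewrite gt_eqF.
move: (opnorm (f x - f y)) (opnorm (g x - g y)) (e / K / 2) h1 h1' h2 h2' a0 b0 eK.
rewrite /K => a b k h1 h1' h2 h2' a0 b0 <-.
move: (opnorm (f x)) (opnorm (g x)) fg gg => p q p0 q0.
have k0 : 0 < k by apply: le_lt_trans h1'.
have H1 : a * q <= k * q by rewrite ler_wpM2r// ltW.
have H2 : p * b <= p * k by rewrite ler_wpM2l// ltW.
have H3 : a * b <= k * 1 by rewrite ler_pM// ltW.
nra.
Qed.

Lemma mxcont_adj f : mxcont f -> mxcont (fun x => mxadj (f x)).
Proof.
move=> cf x e /(cf x)[d d0 dP]; exists d => // y /dP.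
by rewrite -[in X in X -> _]opnorm_adj mxadjD -scaleN1r mxadjZ rmorphN1 scaleN1r.
Qed.

Lemma mxcont_limit f : (forall e : R, 0 < e ->
  exists2 g, mxcont g & forall x, opnorm (f x - g x) < e) -> mxcont f.
Proof.
move=> lim x e e0; have e30 : 0 < e / 3 by rewrite divr_gt0.
have [g cg gP] := lim _ e30; have [d d0 dP] := cg x _ e30.
exists d => // y /dP h; have h1 := gP x; have := gP y; rewrite opnormB => h2.
rewrite (le_lt_trans (opnorm_tri (g x) _ _))//.
have := opnorm_tri (g y) (g x) (f y).
move: (opnorm _) (opnorm _) (opnorm _) (opnorm _) h h1 h2 => a b c d1 h h1 h2 h3.
lra.
Qed.

Lemma mxcont_opnorm f : mxcont f -> continuous (fun x => opnorm (f x)).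
Proof.
move=> cf x; apply/cvgrPdist_lt => e /(cf x)[d d0 dP].
near=> y; apply: (@le_lt_trans _ _ (opnorm (f x - f y))).
  rewrite ler_norml; apply/andP; split.
    have := ler_opnormD (f y - f x) (f x); rewrite subrK opnormB; lra.
  have := ler_opnormD (f x - f y) (f y); rewrite subrK; lra.
by apply: dP; near: y; exact: cvgr_dist_lt.
Unshelve. all: by end_near. Qed.

(** All values are attained on the compact interval [0, 1], where the extreme value theorem
    applies. *)
Lemma path_bounded f : is_path f -> exists B : R, forall x, opnorm (f x) <= B.
Proof.
case=> fc cf _ _.
have [c _ cP] : exists2 c : R, c \in `[0, 1] &
    forall t, t \in `[0, 1] -> opnorm (f t) <= opnorm (f c).
  apply: EVT_max; first exact: ler01.
  by apply: continuous_subspaceT; exact: mxcont_opnorm.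
by exists (opnorm (f c)) => x; rewrite fc; apply: cP; exact: clamp_itv.
Qed.

End PathPredicate.

Record path_data (R : realType) := PathData {
  pdim : nat;
  pdim_gt0 : (0 < pdim)%N;
  pleft : mxsubalg R pdim;
  pright : mxsubalg R pdim }.

Section PathAlgebra.
Variables (R : realType) (D : path_data R).
Local Notation n := (pdim D).
Local Notation is_path := (is_path (pleft D) (pright D)).

Record path_alg := Path {
  path_fun :> R -> 'M[R[i]]_n;
  path_funP : is_path path_fun }.

HB.instance Definition _ := gen_eqMixin path_alg.
HB.instance Definition _ := gen_choiceMixin path_alg.

Implicit Types f g : path_alg.

Lemma path_ext f g : (forall x, f x = g x) -> f = g.
Proof.
case: f g => [f pf] [g pg] /= fg.
have {}fg : f = g by apply/funext.
by subst g; congr Path; exact: Prop_irrelevance.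
Qed.

Lemma path_clamp f x : f (clamp x) = f x.
Proof. by case: (path_funP f) => <-. Qed.

Lemma path_cst_proof a : is_path (fun=> a%:M).
Proof.
split=> //; first exact: mxcont_cst.
- by rewrite -scalemx1; apply: mxsubalgZ; exact: mxsubalg1.
- by rewrite -scalemx1; apply: mxsubalgZ; exact: mxsubalg1.
Qed.
Lemma path_add_proof f g : is_path (fun x => f x + g x).
Proof.
have [fc cf f0 f1] := path_funP f; have [gc cg g0 g1] := path_funP g.
split; [by move=> x; rewrite -fc -gc|exact: mxcontD|exact: mxsubalgD|].
exact: mxsubalgD.
Qed.
Lemma path_scale_proof a f : is_path (fun x => a *: f x).
Proof.
have [fc cf f0 f1] := path_funP f.
split; [by move=> x; rewrite -fc|exact: mxcontZ|exact: mxsubalgZ|].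
exact: mxsubalgZ.
Qed.
Lemma path_mul_proof f g : is_path (fun x => f x *m g x).
Proof.
have [fc cf f0 f1] := path_funP f; have [gc cg g0 g1] := path_funP g.
split; [by move=> x; rewrite -fc -gc|exact: mxcontM|exact: mxsubalgM|].
exact: mxsubalgM.
Qed.
Lemma path_star_proof f : is_path (fun x => mxadj (f x)).
Proof.
have [fc cf f0 f1] := path_funP f.
split; [by move=> x; rewrite -fc|exact: mxcont_adj|exact: mxsubalgJ|].
exact: mxsubalgJ.
Qed.

Definition path_cst a := Path (path_cst_proof a).
Definition path_add f g := Path (path_add_proof f g).
Definition path_scale a f := Path (path_scale_proof a f).
Definition path_mul f g := Path (path_mul_proof f g).
Definition path_star f := Path (path_star_proof f).

Lemma path_addA : associative path_add.
Proof. by move=> f g h; apply: path_ext => x /=; rewrite addrA. Qed.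
Lemma path_addC : commutative path_add.
Proof. by move=> f g; apply: path_ext => x /=; rewrite addrC. Qed.
Lemma path_add0 : left_id (path_cst 0) path_add.
Proof. by move=> f; apply: path_ext => x /=; rewrite raddf0 add0r. Qed.
Lemma path_addN : left_inverse (path_cst 0) (path_scale (-1)) path_add.
Proof. by move=> f; apply: path_ext => x /=; rewrite scaleN1r addNr raddf0. Qed.
HB.instance Definition _ :=
  GRing.isZmodule.Build path_alg path_addA path_addC path_add0 path_addN.

Lemma path_mulA : associative path_mul.
Proof. by move=> f g h; apply: path_ext => x /=; rewrite mulmxA. Qed.
Lemma path_mul1l : left_id (path_cst 1) path_mul.
Proof. by move=> f; apply: path_ext => x /=; rewrite mul1mx. Qed.
Lemma path_mul1r : right_id (path_cst 1) path_mul.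
Proof. by move=> f; apply: path_ext => x /=; rewrite mulmx1. Qed.
Lemma path_mulDl : left_distributive path_mul +%R.
Proof. by move=> f g h; apply: path_ext => x /=; rewrite mulmxDl. Qed.
Lemma path_mulDr : right_distributive path_mul +%R.
Proof. by move=> f g h; apply: path_ext => x /=; rewrite mulmxDr. Qed.
Lemma path1_neq0 : path_cst 1 != 0.
Proof.
apply/eqP => /(congr1 (fun f : path_alg => f 0 (Ordinal (pdim_gt0 D))
  (Ordinal (pdim_gt0 D)))); rewrite /= !mxE eqxx !mulr1n => /eqP.
by rewrite oner_eq0.
Qed.
HB.instance Definition _ := GRing.Zmodule_isNzRing.Build path_alg
  path_mulA path_mul1l path_mul1r path_mulDl path_mulDr path1_neq0.

Lemma path_scaleA a b f : path_scale a (path_scale b f) = path_scale (a * b) f.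
Proof. by apply: path_ext => x /=; rewrite scalerA. Qed.
Lemma path_scale1 : left_id 1 path_scale.
Proof. by move=> f; apply: path_ext => x /=; rewrite scale1r. Qed.
Lemma path_scaleDr : right_distributive path_scale +%R.
Proof. by move=> a f g; apply: path_ext => x /=; rewrite scalerDr. Qed.
Lemma path_scaleDl f : {morph path_scale^~ f : a b / a + b}.
Proof. by move=> a b; apply: path_ext => x /=; rewrite scalerDl. Qed.
HB.instance Definition _ := GRing.Zmodule_isLmodule.Build R[i] path_alg
  path_scaleA path_scale1 path_scaleDr path_scaleDl.

Lemma path_scaleAl (a : R[i]) (f g : path_alg) : a *: (f * g) = (a *: f) * g.
Proof. by apply: path_ext => x /=; rewrite scalemxAl. Qed.
HB.instance Definition _ :=
  GRing.Lmodule_isLalgebra.Build R[i] path_alg path_scaleAl.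
Lemma path_scaleAr (a : R[i]) (f g : path_alg) : a *: (f * g) = f * (a *: g).
Proof. by apply: path_ext => x /=; rewrite scalemxAr. Qed.
HB.instance Definition _ :=
  GRing.Lalgebra_isAlgebra.Build R[i] path_alg path_scaleAr.

Lemma pathD f g x : (f + g) x = f x + g x. Proof. by []. Qed.
Lemma pathM f g x : (f * g) x = f x *m g x. Proof. by []. Qed.
Lemma pathZ a f x : (a *: f) x = a *: f x. Proof. by []. Qed.
Lemma path1 x : (1 : path_alg) x = 1%:M. Proof. by []. Qed.
Lemma path0 x : (0 : path_alg) x = 0. Proof. exact: raddf0. Qed.
Lemma pathN f x : (- f) x = - f x.
Proof. by rewrite -scaleN1r pathZ scaleN1r. Qed.
Lemma pathB f g x : (f - g) x = f x - g x. Proof. by rewrite pathD pathN. Qed.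
Lemma path_sum I (r : seq I) (P : pred I) (F : I -> path_alg) x :
  (\sum_(i <- r | P i) F i) x = \sum_(i <- r | P i) F i x.
Proof. by elim/big_rec2: _ => [|i u v _ <-]; rewrite ?path0. Qed.

Definition path_norm f : R := sup (range (fun x => opnorm (f x))).

Lemma path_norm_has_sup f : has_sup (range (fun x => opnorm (f x))).
Proof.
split; first by exists (opnorm (f 0)), 0.
by have [B BP] := path_bounded (path_funP f); exists B => _ [x _ <-].
Qed.

Lemma opnorm_le_path_norm f x : opnorm (f x) <= path_norm f.
Proof. by apply: ub_le_sup; [case: (path_norm_has_sup f)|exists x]. Qed.

Lemma path_norm_le f c : (forall x, opnorm (f x) <= c) -> path_norm f <= c.
Proof.
by move=> h; apply: ge_sup; [case: (path_norm_has_sup f)|move=> _ [x _ <-]].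
Qed.

Lemma path_norm_ge0 f : 0 <= path_norm f.
Proof. exact: le_trans (opnorm_ge0 (f 0)) (opnorm_le_path_norm f 0). Qed.

Lemma path_starK : involutive path_star.
Proof. by move=> f; apply: path_ext => x /=; rewrite mxadjK. Qed.
Lemma path_starD : {morph path_star : f g / f + g}.
Proof. by move=> f g; apply: path_ext => x /=; rewrite mxadjD. Qed.
Lemma path_starZ (a : R[i]) (f : path_alg) :
  path_star (a *: f) = a^*%C *: path_star f.
Proof. by apply: path_ext => x /=; rewrite mxadjZ. Qed.
Lemma path_starM (f g : path_alg) : path_star (f * g) = path_star g * path_star f.
Proof. by apply: path_ext => x /=; rewrite mxadjM. Qed.

Lemma path_norm0_eq0 f : path_norm f = 0 -> f = 0.
Proof.
move=> f0; apply: path_ext => x; rewrite path0; apply: opnorm_eq0.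
by apply/eqP; rewrite eq_le opnorm_ge0 andbT -f0 opnorm_le_path_norm.
Qed.

Lemma path_normD (f g : path_alg) : path_norm (f + g) <= path_norm f + path_norm g.
Proof.
apply: path_norm_le => x; rewrite (le_trans (ler_opnormD _ _))//.
by rewrite lerD// opnorm_le_path_norm.
Qed.

Lemma path_normZ (a : R[i]) (f : path_alg) :
  path_norm (a *: f) = normc a * path_norm f.
Proof.
have le b h : path_norm (b *: h) <= normc b * path_norm h.
  apply: path_norm_le => x; rewrite opnormZ.
  by rewrite ler_wpM2l ?normc_ge0// opnorm_le_path_norm.
apply/eqP; rewrite eq_le le /=.
have [->|a0] := eqVneq a 0; first by rewrite normc0 mul0r path_norm_ge0.
have na : 0 < normc a.
  by rewrite lt_def normc_ge0 andbT; apply: contra_neq a0 => /eq0_normc.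
rewrite -ler_pdivlMl// -normcV -{1}(scale1r f) -(mulVf a0) -scalerA.
exact: le.
Qed.

Lemma path_normM (f g : path_alg) : path_norm (f * g) <= path_norm f * path_norm g.
Proof.
apply: path_norm_le => x; rewrite (le_trans (ler_opnormM _ _))//.
by rewrite ler_pM ?opnorm_ge0 ?opnorm_le_path_norm.
Qed.

Lemma path_norm_star_mul (f : path_alg) :
  path_norm (path_star f * f) = path_norm f ^+ 2.
Proof.
apply/eqP; rewrite eq_le; apply/andP; split.
  apply: path_norm_le => x; rewrite opnorm_adj_mul.
  by rewrite ler_pXn2r ?nnegrE ?opnorm_ge0 ?path_norm_ge0// opnorm_le_path_norm.
rewrite -[leRHS](sqr_sqrtr (path_norm_ge0 _)).
rewrite ler_pXn2r ?nnegrE ?path_norm_ge0 ?sqrtr_ge0//.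
apply: path_norm_le => x.
rewrite -(@ler_pXn2r _ 2)// ?nnegrE ?sqrtr_ge0 ?opnorm_ge0//.
rewrite sqr_sqrtr ?path_norm_ge0// -opnorm_adj_mul.
exact: (opnorm_le_path_norm (path_star f * f)).
Qed.

Lemma path_complete (u : nat -> path_alg) :
  (forall e : R, 0 < e -> exists N, forall m n,
     (N <= m)%N -> (N <= n)%N -> path_norm (u m - u n) < e) ->
  exists l : path_alg, forall e : R, 0 < e -> exists N, forall n,
    (N <= n)%N -> path_norm (u n - l) < e.
Proof.
move=> cau.
have ex (x : R) : exists l : 'M[R[i]]_n, forall e : R, 0 < e ->
    exists N, forall m, (N <= m)%N -> opnorm (u m x - l) < e.
  apply: mx_cauchy_complete => e /cau[N NP]; exists N => m k Nm Nk.
  rewrite (le_lt_trans _ (NP m k Nm Nk))// -pathB.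
  exact: opnorm_le_path_norm.
have [l lP] := choice ex.
have ul (e : R) : 0 < e -> exists N, forall m, (N <= m)%N ->
    forall x, opnorm (u m x - l x) <= e.
  move=> e0; have e20 : 0 < e / 2 by rewrite divr_gt0.
  have [N NP] := cau _ e20; exists N => m Nm x.
  have [M MP] := lP x _ e20; pose k := maxn N M.
  rewrite (le_trans (opnorm_tri (u k x) _ _))// [e]splitr lerD//.
    rewrite -pathB (le_trans (opnorm_le_path_norm _ _))// ltW//.
    by rewrite NP// leq_maxl.
  by rewrite ltW// MP// leq_maxr.
have ul' (e : R) : 0 < e -> exists m, forall x, opnorm (l x - u m x) < e.
  move=> e0; have e20 : 0 < e / 2 by rewrite divr_gt0.
  have [N NP] := ul _ e20; exists N => x; rewrite opnormB.
  by rewrite (le_lt_trans (NP _ _ _))// ltr_pdivrMr// mulr_natr mulr2n ltrDl.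
have lpath : is_path l.
  split.
  - move=> x; apply/eqP; rewrite -subr_eq0; apply/eqP/opnorm_eq0/eqP.
    rewrite eq_le opnorm_ge0 andbT; apply/ler_addgt0Pl => e e0; rewrite addr0.
    have e20 : 0 < e / 2 by rewrite divr_gt0.
    have [m mP] := ul' _ e20.
    rewrite (le_trans (opnorm_tri (u m x) _ _))// [e]splitr lerD ?ltW//.
    by rewrite -path_clamp opnormB mP.
  - apply: mxcont_limit => e /ul'[m mP]; exists (u m) => //.
    by case: (path_funP (u m)).
  - apply: mxsubalg_closed => e /ul'[m mP]; exists (u m 0) => //.
    by case: (path_funP (u m)).
  - apply: mxsubalg_closed => e /ul'[m mP]; exists (u m 1) => //.
    by case: (path_funP (u m)).
exists (Path lpath) => e e0; have e20 : 0 < e / 2 by rewrite divr_gt0.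
have [N NP] := ul _ e20; exists N => m Nm.
apply: (@le_lt_trans _ _ (e / 2)).
  by apply: path_norm_le => x; rewrite pathB; exact: NP.
by rewrite ltr_pdivrMr// mulr_natr mulr2n ltrDl.
Qed.

HB.instance Definition _ := Algebra_isCStar.Build R path_alg
  path_starK path_starD path_starZ path_starM path_norm0_eq0 path_normD
  path_normZ path_normM path_norm_star_mul path_complete.

Lemma pathJ f x : (star f) x = mxadj (f x). Proof. by []. Qed.

Lemma opnorm_le_cnorm f x : opnorm (f x) <= cnorm f.
Proof. exact: opnorm_le_path_norm. Qed.

Lemma cnorm_path_le f c : (forall x, opnorm (f x) <= c) -> cnorm f <= c.
Proof. exact: path_norm_le. Qed.

End PathAlgebra.

(** * Traces of idempotents *)

Section Flatten.
Variables (R : realType) (k n : nat).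
Implicit Types F G : 'I_k -> 'I_k -> 'M[R[i]]_n.

(** Evaluated at a point, a k x k matrix over a path algebra is a block matrix; flattening it makes
    rank, trace and one-sided inverses of complex matrices available. *)
Definition flat F : 'M[R[i]]_(k * n) :=
  \matrix_(a, b) F (mxtens_unindex a).1 (mxtens_unindex b).1
                   (mxtens_unindex a).2 (mxtens_unindex b).2.

Lemma flatE F i j s t :
  flat F (mxtens_index (i, s)) (mxtens_index (j, t)) = F i j s t.
Proof. by rewrite mxE !mxtens_indexK. Qed.

Lemma flat_inj F G : flat F = flat G -> forall i j, F i j = G i j.
Proof. by move=> FG i j; apply/matrixP => s t; rewrite -!flatE FG. Qed.

Lemma sum_mxtens (f : 'I_(k * n) -> R[i]) :
  \sum_a f a = \sum_i \sum_s f (mxtens_index (i, s)).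
Proof.
rewrite pair_big /= (reindex (@mxtens_index k n)) /=; last first.
  by exists (@mxtens_unindex k n) => x _; rewrite ?mxtens_indexK ?mxtens_unindexK.
by apply: eq_bigr => -[].
Qed.

Lemma flat_mul F G : flat F *m flat G = flat (fun i j => \sum_l F i l *m G l j).
Proof.
apply/matrixP => a b; rewrite -(mxtens_unindexK a) -(mxtens_unindexK b).
case: (mxtens_unindex a) => i s; case: (mxtens_unindex b) => j t.
rewrite flatE mxE sum_mxtens summxE; apply: eq_bigr => l _.
by rewrite mxE; apply: eq_bigr => u _; rewrite !flatE.
Qed.

Lemma flat_scalar a : flat (fun i j => (a *+ (i == j))%:M) = a%:M.
Proof.
apply/matrixP => u v; rewrite -(mxtens_unindexK u) -(mxtens_unindexK v).
case: (mxtens_unindex u) => i s; case: (mxtens_unindex v) => j t.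
rewrite flatE !mxE (can_eq (@mxtens_indexK k n)) xpair_eqE.
by case: (i == j); rewrite ?mul0rn.
Qed.

Lemma flat_trace F : \tr (flat F) = \sum_i \tr (F i i).
Proof.
by rewrite /mxtrace sum_mxtens; apply: eq_bigr => i _; apply: eq_bigr => s _;
  rewrite flatE.
Qed.

End Flatten.

(** In the rank factorisation A = CR, idempotency and full rank of the factors force RC = 1, and
    tr(CR) = tr(RC). *)
Lemma idempotent_trace (F : fieldType) n (A : 'M[F]_n) :
  A *m A = A -> \tr A = (\rank A)%:R.
Proof.
move=> AA; have /esym AE := mulmx_base A.
have RC : row_base A *m col_base A = 1%:M.
  apply: (row_full_inj (col_base_full A)); rewrite mulmx1.
  apply: (row_free_inj (row_base_free A)).
  by rewrite mulmxA -mulmxA -AE AA.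
by rewrite {1}AE mxtrace_mulC RC mxtrace1.
Qed.

Section IntegerValued.
Variable R : realType.

Lemma nat_valued_constant (t : R -> R) : continuous t ->
  (forall x, exists m : nat, t x = m%:R) -> forall x y, t x = t y.
Proof.
move=> ct tnat.
suff le x y : x <= y -> t x = t y.
  by move=> x y; case: (leP x y) => [/le//|/ltW/le ->].
move=> xy; apply: contrapT => /eqP txy.
(* Two distinct natural numbers have this half-integer between them. The intermediate value theorem
   would make it a value of t, and doubling then equates an even and an odd number. *)
pose v := Num.min (t x) (t y) + 2^-1.
have [c _ tc] : exists2 c, c \in `[x, y] & t c = v.
  apply: IVT => //; first exact: continuous_subspaceT.
  have [[m mE] [m' m'E]] := (tnat x, tnat y).
  rewrite /v; move: txy; rewrite mE m'E => txy.
  rewrite lerDl invr_ge0 ler0n /=.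
  have [mm|mm] := ltP m%:R (m'%:R : R).
    by move: mm; rewrite ltr_nat -(ler_nat R) -addn1 natrD; lra.
  have {mm txy}: m'%:R < m%:R :> R by rewrite lt_def mm txy.
  by rewrite ltr_nat -(ler_nat R) -addn1 natrD; lra.
have [m mE] := tnat c.
have [m' m'E] : exists m' : nat, Num.min (t x) (t y) = m'%:R.
  by case: (leP (t x) (t y)).
have : (m * 2)%N%:R = (m' * 2 + 1)%N%:R :> R.
  by rewrite natrD !natrM -mE tc /v m'E; lra.
move/eqP; rewrite eqr_nat !muln2 addn1 => /eqP/(congr1 odd).
by rewrite /= !odd_double.
Qed.

Lemma mxcont_trace n (f : R -> 'M[R[i]]_n) : mxcont f ->
  continuous (fun x => complex.Re (\tr (f x))).
Proof.
move=> cf x; apply/cvgrPdist_lt => e e0.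
have ReB (a b : R[i]) : complex.Re (a - b) = complex.Re a - complex.Re b.
  by case: a b => ? ? [].
have n0 : 0 < n%:R + 1 :> R by rewrite ltr_wpDl.
have [d d0 dP] := cf x _ (divr_gt0 e0 n0).
near=> y; rewrite -ReB (le_lt_trans (Re_normc _))//.
have -> : \tr (f x) - \tr (f y) = \tr (f x - f y) by rewrite raddfB.
rewrite (le_lt_trans (opnorm_trace _))//.
have : opnorm (f x - f y) < e / (n%:R + 1).
  by apply: dP; near: y; exact: cvgr_dist_lt.
rewrite ltr_pdivlMr//; apply: le_lt_trans.
by rewrite mulrC ler_wpM2l ?opnorm_ge0// lerDl.
Unshelve. all: by end_near. Qed.

End IntegerValued.

Section PathMatrices.
Variables (R : realType) (D : path_data R).

(** At each point a one-sided inverse of a complex square matrix is two-sided. *)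
Lemma path_stably_finite : stably_finite (path_alg D).
Proof.
move=> k v vv; apply/matrixP => i j; apply: path_ext => x.
pose V := flat (fun i j => v i j x).
pose W := flat (fun i j => mxadj (v j i x)).
have E (i' j' : 'I_k) : (1%:M : 'M[path_alg D]_k) i' j' x = (1 *+ (i' == j'))%:M.
  by rewrite mxE; case: (i' == j') => //; rewrite path0 raddf0.
have WV : W *m V = 1%:M.
  rewrite flat_mul -flat_scalar; congr flat; apply/funext => i'; apply/funext => j'.
  rewrite -E -vv mxE path_sum; apply: eq_bigr => l _.
  by rewrite pathM !mxE pathJ.
have := mulmx1C WV; rewrite flat_mul -flat_scalar => /flat_inj/(_ i j).
rewrite -E => <-; rewrite mxE path_sum; apply: eq_bigr => l _.
by rewrite pathM !mxE pathJ.
Qed.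

(* The trace of an idempotent is its rank, and an integer that depends
   continuously on the point is constant. *)
Lemma path_idempotent_trace k (q : 'M[path_alg D]_k) : q *m q = q ->
  exists r : nat, (forall x, \sum_i \tr (q i i x) = r%:R) /\ (r = 0%N -> q = 0).
Proof.
move=> qq; pose Q x := flat (fun i j => q i j x).
have QQ x : Q x *m Q x = Q x.
  rewrite flat_mul; congr flat; apply/funext => i; apply/funext => j.
  by rewrite -[in RHS]qq mxE path_sum.
have trQ x : \sum_i \tr (q i i x) = (\rank (Q x))%:R.
  by rewrite -idempotent_trace// flat_trace.
pose t x : R := \sum_i complex.Re (\tr (q i i x)).
have tE x : t x = (\rank (Q x))%:R.
  have -> : (\rank (Q x))%:R = complex.Re ((\rank (Q x))%:R : R[i]) :> R.
    by rewrite -(rmorph_nat (real_complex R)).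
  rewrite -trQ /t; elim/big_rec2: _ => // i a b _ ->.
  by case: (\tr _) a => ? ? [].
have ct : continuous t.
  apply: (continuous_big add_continuous) => i _.
  by apply: mxcont_trace; case: (path_funP (q i i)).
have const := nat_valued_constant ct (fun x => ex_intro _ _ (tE x)).
exists (\rank (Q 0)); split=> [x|Q0].
  rewrite trQ; apply/eqP; rewrite eqr_nat -(eqr_nat R) -!tE; apply/eqP.
  exact: const.
(* A rank that vanishes at 0 vanishes at every point, by constancy, and a matrix of rank 0 is
   zero. *)
apply/matrixP => i j; rewrite mxE; apply: path_ext => x; rewrite path0.
have : Q x = flat (fun i j => (0 *+ (i == j))%:M).
  rewrite flat_scalar raddf0; apply/eqP; rewrite -mxrank_eq0.
  by rewrite -(eqr_nat R) -tE (const x 0) tE Q0.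
by move/flat_inj => ->; rewrite mul0rn raddf0.
Qed.

End PathMatrices.

Lemma normc_small_eq0 (R : realType) (a : R[i]) :
  (forall e : R, 0 < e -> normc a < e) -> a = 0.
Proof.
move=> h; apply: eq0_normc; apply/eqP; rewrite eq_le normc_ge0 andbT.
by apply/ler_addgt0Pl => e /h/ltW; rewrite addr0.
Qed.

(** * Diagonal matrices with prescribed equal entries *)

Section DiagonalBlocks.
Variables (R : realType) (n : nat) (beta : 'I_n -> nat).

(** A copy of C^m, with m the number of values of [beta]; the multiplicity of a coordinate is the
    size of the corresponding fibre. *)
Definition diag_blocks (M : 'M[R[i]]_n) : Prop :=
  (forall i j, i != j -> M i j = 0) /\
  (forall i j, beta i = beta j -> M i i = M j j).

Lemma diag_blocks_mul M N i j : diag_blocks M -> diag_blocks N ->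
  (M *m N) i j = (M i i * N i i) *+ (i == j).
Proof.
case=> M0 _ [N0 _]; rewrite mxE (bigD1 i)//= big1 ?addr0 => [|l li].
  by have [<-//|/N0 ->] := eqVneq; rewrite mulr0.
by rewrite M0 1?eq_sym// mul0r.
Qed.

Definition diag_blocks_subalg : mxsubalg R n.
Proof.
exists diag_blocks.
- by split=> [i j ij|i j _]; rewrite !mxE ?(negbTE ij)// !eqxx.
- move=> M N [M0 Mb] [N0 Nb].
  split=> i j ij; rewrite !mxE; first by rewrite M0// N0// addr0.
  by rewrite (Mb _ _ ij) (Nb _ _ ij).
- move=> a M [M0 Mb].
  split=> i j ij; rewrite !mxE; first by rewrite M0// mulr0.
  by rewrite (Mb _ _ ij).
- move=> M N HM HN; split=> i j ij; rewrite !diag_blocks_mul//.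
    by rewrite (negbTE ij).
  by case: HM HN => _ Mb [_ Nb]; rewrite (Mb _ _ ij) (Nb _ _ ij) !eqxx.
- move=> M [M0 Mb]; split=> i j ij; rewrite !mxE.
    by rewrite M0 1?eq_sym// conjc0.
  by rewrite (Mb _ _ ij).
- move=> M lim; split=> i j ij.
    apply: normc_small_eq0 => e /lim[N [N0 _]]; apply: le_lt_trans.
    by have := normc_le_opnorm (M - N) i j; rewrite !mxE N0// subr0.
  apply/eqP; rewrite -subr_eq0; apply/eqP/normc_small_eq0 => e e0.
  have [|N [_ Nb] MN] := lim (e / 2); first by rewrite divr_gt0.
  have h1 := normc_le_opnorm (M - N) i i; have h2 := normc_le_opnorm (M - N) j j.
  move: h1 h2; rewrite !mxE => h1 h2.
  have -> : M i i - M j j = (M i i - N i i) - (M j j - N j j).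
    by rewrite (Nb _ _ ij) opprB addrA subrK.
  rewrite (le_lt_trans (ler_normcD _ _))// normcN [e]splitr.
  by rewrite ltrD// (le_lt_trans _ MN).
Defined.

(** A diagonal entry of an idempotent is 0 or 1 and depends only on its label, so that the trace is
    a sum of sizes of fibres of [beta]. *)
Lemma diag_blocks_idempotent M : diag_blocks M -> M *m M = M ->
  exists chi : nat -> bool, \tr M = (\sum_i (chi (beta i) : nat))%:R.
Proof.
move=> HM MM; exists (fun c => `[< exists2 i, beta i = c & M i i = 1 >]).
rewrite /mxtrace natr_sum; apply: eq_bigr => i _.
have : M i i * M i i = M i i by rewrite -{3}MM diag_blocks_mul// eqxx.
case: asboolP => [[j ji j1] _|no]; first by case: HM => _ Mb; rewrite -(Mb _ _ ji).
move/eqP; rewrite -subr_eq0 -{3}(mulr1 (M i i)) -mulrBr mulf_eq0.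
case/orP=> [/eqP ->//|]; rewrite subr_eq0 => /eqP i1.
by case: no; exists i.
Qed.

End DiagonalBlocks.

(** * A projectionless algebra with three idempotents in its 2 x 2 matrices *)

Section Entries.
Variable R : realType.
Implicit Types h : R -> R[i].

Definition ccont h : Prop := forall x (e : R), 0 < e ->
  exists2 d : R, 0 < d & forall y, `|x - y| < d -> normc (h x - h y) < e.

Lemma ccont_real (f : R -> R) : continuous f -> ccont (fun x => (f x)%:C).
Proof.
move=> cf x e e0; have /cvgrPdist_lt/(_ e e0)/nbhs_ballP[d d0 dP] := cf x.
exists d => // y xy; rewrite -rmorphB normc_real; exact: dP.
Qed.

Lemma mxcont_entry n (f : R -> 'M[R[i]]_n) i j :
  mxcont f -> ccont (fun x => f x i j).
Proof.
move=> cf x e /(cf x)[d d0 dP]; exists d => // y /dP; apply: le_lt_trans.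
by have := normc_le_opnorm (f x - f y) i j; rewrite !mxE.
Qed.

Lemma mxcont_entries n (f : R -> 'M[R[i]]_n) :
  (forall i j, ccont (fun x => f x i j)) -> mxcont f.
Proof.
move=> cf x e e0.
pose K : R := (n * n).+1%:R.
have eK0 : 0 < e / K by rewrite divr_gt0// ltr0n.
have ex (ij : 'I_n * 'I_n) : exists d : R, 0 < d /\ forall y, `|x - y| < d ->
    normc (f x ij.1 ij.2 - f y ij.1 ij.2) < e / K.
  by have [d d0 dP] := cf ij.1 ij.2 x _ eK0; exists d.
have [d dP] := choice ex.
exists (\big[Num.min/1]_ij d ij) => [|y xy].
  by elim/big_ind: _ => // [a b a0 b0|ij _]; [rewrite lt_min a0|case: (dP ij)].
have xyd ij : `|x - y| < d ij.
  rewrite (lt_le_trans xy)// (bigD1 ij)//= ge_min lexx//.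
rewrite (le_lt_trans (opnorm_le_entry_sum _))//.
apply: (@le_lt_trans _ _ (\sum_(i < n) \sum_(j < n) (e / K))).
  apply: ler_sum => i _; apply: ler_sum => j _; rewrite !mxE ltW//.
  by have [_] := dP (i, j); apply; exact: xyd.
rewrite !sumr_const !card_ord -mulrnA -mulr_natr mulrAC -mulrA.
by rewrite gtr_pMr// ltr_pdivrMr ?ltr0n// mul1r ltr_nat.
Qed.

Lemma clamp_continuous : continuous (@clamp R).
Proof.
move=> x; apply/cvgrPdist_lt => e e0; apply/nbhs_ballP; exists e => // y xy.
exact: le_lt_trans (clamp_lip _ _) xy.
Qed.

End Entries.

Definition unflat (R : realType) k n (M : 'M[R[i]]_(k * n)) (i j : 'I_k) :
    'M[R[i]]_n :=
  \matrix_(s, t) M (mxtens_index (i, s)) (mxtens_index (j, t)).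

Lemma unflatK (R : realType) k n (M : 'M[R[i]]_(k * n)) : flat (unflat M) = M.
Proof.
by apply/matrixP => a b; rewrite !mxE -!surjective_pairing !mxtens_unindexK.
Qed.

Lemma unflatM (R : realType) k n (M N : 'M[R[i]]_(k * n)) i j :
  unflat (M *m N) i j = \sum_l unflat M i l *m unflat N l j.
Proof.
by move: i j; apply: flat_inj; rewrite -flat_mul !unflatK.
Qed.

Section Counterexample.
Variable R : realType.

(* The pair (copy i, coordinate s) has the number i * 7 + s. Three colours for
   the 14 pairs give three projections of M_2(M_7). Both colour and its
   composition with swap are constant on the pairs with the same copy and the
   same end block, at 0 and at 1 respectively, and rotating each pair of swapped
   coordinates joins one colouring to the other. *)
Definition swap (m : nat) : nat :=
  match m with
  | 3 => 7 | 7 => 3 | 4 => 8 | 8 => 4 | 5 => 9 | 9 => 5 | 6 => 12 | 12 => 6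
  | _ => m
  end%N.

Lemma swapK : involutive swap.
Proof. by do 13 (case=> //). Qed.

Lemma swap_lt m : (m < 2 * 7)%N -> (swap m < 2 * 7)%N.
Proof. by do 14 (case: m => [|m] //). Qed.

Definition swap_ord (a : 'I_(2 * 7)) := Ordinal (swap_lt (ltn_ord a)).

Lemma swap_ordK : involutive swap_ord.
Proof. by move=> a; apply: val_inj; exact: swapK. Qed.

(** Every swapped pair has one member in each copy, so the two members get opposite signs, as the
    off-diagonal entries of a plane rotation must. The value 0 at fixed points leaves these rows
    those of the identity. *)
Definition swap_sign (a : 'I_(2 * 7)) : R :=
  if swap_ord a == a then 0 else if (a < 7)%N then 1 else -1.

Lemma swap_signN a : swap_sign (swap_ord a) = - swap_sign a.
Proof.
rewrite /swap_sign swap_ordK eq_sym; case: eqP => [_|ne]; first by rewrite oppr0.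
suff -> : (swap_ord a < 7)%N = ~~ (a < 7)%N by case: (a < 7)%N; rewrite ?opprK.
case: a ne => m mlt /= ne.
have {}ne : swap m <> m by move=> h; apply: ne; exact: val_inj.
by move: m mlt ne; do 13 (case=> //).
Qed.

(** At 0 the block of size 6 of each copy has its own colour, and the two blocks of size 1 share
    colour 2. After [swap], colour 0 consists of both blocks of size 3, colour 2 of the last block
    of size 2 of the second copy, and colour 1 of the other three blocks of size 2. *)
Definition colour (m : nat) : nat := if (m %% 7 == 6)%N then 2%N else (m %/ 7)%N.

Section Rotation.
Variables c s : R.

Definition rot_diag a : R := if swap_ord a == a then 1 else c.

Definition rotation : 'M[R[i]]_(2 * 7) :=
  \matrix_(a, b) (rot_diag a *+ (b == a) + s * swap_sign a *+ (b == swap_ord a))%:C.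

Lemma rotation_sum a (f : 'I_(2 * 7) -> R[i]) :
  \sum_b rotation a b * f b =
  (rot_diag a)%:C * f a + (s * swap_sign a)%:C * f (swap_ord a).
Proof.
under eq_bigr do rewrite mxE rmorphD mulrDl !rmorphMn /=.
rewrite big_split /=; congr (_ + _).
  rewrite (bigD1 a)//= eqxx mulr1n big1 ?addr0// => b /negbTE ->.
  by rewrite mulr0n mul0r.
rewrite (bigD1 (swap_ord a))//= eqxx mulr1n big1 ?addr0// => b /negbTE ->.
by rewrite mulr0n mul0r.
Qed.

(** This closed form serves three times: at (c, s) = (1, 0) it leaves [chi], at (0, 1) it gives
    [chi] composed with the swap, both diagonal, and for the constant [chi] = 1 it shows that the
    rotation is unitary. *)
Lemma rotation_conj (chi : 'I_(2 * 7) -> R) a b :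
  (rotation *m diag_mx (\row_j (chi j)%:C) *m mxadj rotation) a b =
  ((rot_diag a ^+ 2 * chi a + s ^+ 2 * swap_sign a ^+ 2 * chi (swap_ord a))
     *+ (a == b)
   + s * rot_diag a * swap_sign a * (chi (swap_ord a) - chi a)
     *+ (swap_ord a == b))%:C.
Proof.
rewrite -mulmxA mxE.
transitivity (\sum_j rotation a j * ((chi j)%:C * rotation b j)).
  apply: eq_bigr => j _; congr (_ * _).
  by rewrite mul_diag_mx !mxE conjc_real.
rewrite (rotation_sum a (fun j => (chi j)%:C * rotation b j)) !mxE.
rewrite -!rmorphM -rmorphD /=.
congr (_%:C).
have e2 : swap_ord (swap_ord a) = a by exact: swap_ordK.
have -> : (swap_ord a == swap_ord b) = (a == b) by exact: (can_eq swap_ordK).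
have -> : (a == swap_ord b) = (swap_ord a == b).
  by rewrite -(can_eq swap_ordK) swap_ordK.
have [<-|ab] := eqVneq a b; rewrite /= ?mulr1n ?mulr0n.
  have [e|ne] := eqVneq (swap_ord a) a; rewrite /= ?mulr1n ?mulr0n.
    by rewrite /swap_sign /rot_diag e eqxx !(mulr0, mul0r); ring.
  by ring.
have [<-|_] := eqVneq (swap_ord a) b; rewrite /= ?mulr1n ?mulr0n; last by ring.
rewrite swap_signN.
have -> : rot_diag (swap_ord a) = rot_diag a.
  by rewrite /rot_diag swap_ordK eq_sym.
by ring.
Qed.

Lemma rotation_unitary : c ^+ 2 + s ^+ 2 = 1 -> rotation *m mxadj rotation = 1%:M.
Proof.
move=> cs; have := rotation_conj (fun=> 1).
have -> : diag_mx (\row_j (1 : R)%:C) = 1%:M :> 'M[R[i]]_(2 * 7).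
  by apply/matrixP => i j; rewrite !mxE.
rewrite mulmx1 => E; apply/matrixP => a b; rewrite E !mxE subrr mulr0 mul0rn addr0.
rewrite !mulr1 rmorphMn /= /rot_diag /swap_sign; congr (_ *+ _).
case: ifP => _; first by rewrite expr1n expr0n mulr0 addr0.
by case: ifP => _; rewrite ?sqrrN expr1n mulr1 cs.
Qed.

End Rotation.

End Counterexample.

Section CounterexampleAlgebra.
Variable R : realType.

Definition block0 (i : 'I_7) : nat := (i == 6 :> nat)%N.
Definition block1 (i : 'I_7) : nat := ((3 <= i) + (5 <= i))%N.

(* C*-algebra of paths in M_7 from diag(a,a,a,a,a,a,b) to diag(c,c,c,d,d,e,e). *)
Definition rigid_data : path_data R :=
  @PathData R 7 isT (diag_blocks_subalg R block0) (diag_blocks_subalg R block1).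

Local Notation A0 := (path_alg rigid_data).

(* The ranks available at the ends are 6a + b and 3c + 2d + 2e with a, b, c, d,
   e in {0, 1}, and the only common ones are 0 and 7. *)
Lemma rigid_projectionless : projectionless A0.
Proof.
move=> p [_ pp].
have idem1 (r : A0) : r * r = r -> (r%:M : 'M[A0]_1) *m r%:M = r%:M.
  by move=> rr; rewrite -scalar_mxM rr.
have tr1 (r : A0) x : \sum_(i < 1) \tr ((r%:M : 'M[A0]_1) i i x) = \tr (r x).
  by rewrite big_ord_recl big_ord0 addr0 mxE eqxx mulr1n.
have [r [rP r0]] := path_idempotent_trace (idem1 p pp).
(* Only rank 0 is known to determine an idempotent, so rank 7 of p is treated as rank 0 of the
   complement. *)
have qq : (1 - p) * (1 - p) = 1 - p.
  by rewrite mulrBl mul1r mulrBr mulr1 pp subrr subr0.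
have [r' [r'P r'0]] := path_idempotent_trace (idem1 _ qq).
have rr' : (r + r' = 7)%N.
  apply/eqP; rewrite -(eqr_nat R[i]) natrD -(rP 0) -(r'P 0) !tr1.
  by rewrite pathB raddfB /= addrC subrK mxtrace1.
have pM x : p x *m p x = p x by rewrite -pathM pp.
have [_ _ p0 p1] := path_funP p.
have [chi /= chiE] := diag_blocks_idempotent p0 (pM 0).
have [psi /= psiE] := diag_blocks_idempotent p1 (pM 1).
have /eqP := rP 0; rewrite tr1 chiE eqr_nat => /eqP rE0.
have /eqP := rP 1; rewrite tr1 psiE eqr_nat => /eqP rE1.
have [r_0|r_7] : r = 0%N \/ r = 7%N.
  move: rE0 rE1; rewrite !big_ord_recl !big_ord0 /block0 /block1 /=.
  by case: (chi _) (chi _) (psi _) (psi _) (psi _) => [] [] [] [] [] /= <-;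
    auto.
- left; have /matrixP/(_ 0 0) := r0 r_0.
  by rewrite !mxE eqxx mulr1n.
- right; have r'_0 : r' = 0%N by apply/eqP; rewrite -(eqn_add2l 7) -{1}r_7 rr'.
  have /matrixP/(_ 0 0) := r'0 r'_0.
  by rewrite !mxE eqxx mulr1n => /eqP; rewrite subr_eq0 => /eqP.
Qed.

Lemma rigid_sfp : sfp A0.
Proof. by split; [exact: rigid_projectionless|exact: path_stably_finite]. Qed.

Definition rigid_colour (k : 'I_3) (a : 'I_(2 * 7)) : R := (colour a == k)%:R.

(** The square roots of 1 - x and x parametrise a quarter turn, from the identity at 0 to the full
    exchange of the swapped pairs at 1. *)
Definition rigid_rotation (x : R) : 'M[R[i]]_(2 * 7) :=
  rotation (Num.sqrt (1 - clamp x)) (Num.sqrt (clamp x)).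

Lemma clamp_ge0 (x : R) : 0 <= clamp x.
Proof. by have := clamp_itv x; rewrite in_itv => /andP[]. Qed.

Lemma clamp_le1 (x : R) : 0 <= 1 - clamp x.
Proof. by have := clamp_itv x; rewrite in_itv /= subr_ge0 => /andP[]. Qed.

Lemma rigid_rotation_unitary x :
  rigid_rotation x *m mxadj (rigid_rotation x) = 1%:M.
Proof.
apply: rotation_unitary.
by rewrite !sqr_sqrtr ?clamp_ge0 ?clamp_le1// subrK.
Qed.

Lemma rigid_rotation_cont : mxcont rigid_rotation.
Proof.
have ct : continuous (fun x : R => Num.sqrt (clamp x)).
  move=> x; apply: continuous_comp; first exact: clamp_continuous.
  exact: sqrt_continuous.
have cc : continuous (fun x : R => Num.sqrt (1 - clamp x)).
  move=> x; apply: (@continuous_comp _ _ _ (fun x => 1 - clamp x)).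
    by apply: cvgB; [exact: cvg_cst|exact: clamp_continuous].
  exact: sqrt_continuous.
apply: mxcont_entries => a b.
have -> : (fun x => rigid_rotation x a b) = (fun x =>
    ((if swap_ord a == a then 1 else Num.sqrt (1 - clamp x)) *+ (b == a) +
    Num.sqrt (clamp x) * swap_sign R a *+ (b == swap_ord a))%:C).
  by apply/funext => x; rewrite mxE.
apply: ccont_real => x; apply: cvgD.
  case: (b == a); last exact: cvg_cst.
  by case: (swap_ord a == a); [exact: cvg_cst|exact: cc].
case: (b == swap_ord a); last exact: cvg_cst.
rewrite /= /GRing.natmul /=.
by apply: cvgM; [exact: ct|exact: cvg_cst].
Qed.

Definition rigid_flat k (x : R) : 'M[R[i]]_(2 * 7) :=
  rigid_rotation x *m diag_mx (\row_a (rigid_colour k a)%:C) *m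
    mxadj (rigid_rotation x).

Lemma rigid_flat0 k a b :
  rigid_flat k 0 a b = (rigid_colour k a)%:C *+ (a == b).
Proof.
rewrite /rigid_flat /rigid_rotation clamp0 subr0 sqrtr0 sqrtr1 rotation_conj.
rewrite /rot_diag if_same expr1n !mul0r mul0rn addr0 mul1r expr0n !mul0r addr0.
by rewrite rmorphMn.
Qed.

Lemma rigid_flat1 k a b :
  rigid_flat k 1 a b = (rigid_colour k (swap_ord a))%:C *+ (a == b).
Proof.
rewrite /rigid_flat /rigid_rotation clamp1 subrr sqrtr0 sqrtr1 rotation_conj.
rewrite -rmorphMn /=; congr (_%:C); rewrite /rot_diag /swap_sign.
have [e|ne] := eqVneq (swap_ord a) a.
  by rewrite e expr1n expr0n !(mulr0, mul0r, mul1r, addr0, mul0rn).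
rewrite !(mulr0, mul0r, mul0rn) expr0n mul0r add0r addr0 expr1n mul1r.
by case: ifP => _; rewrite ?sqrrN expr1n mul1r.
Qed.

Lemma colour_block0 (i : 'I_2) (s t : 'I_7) : block0 s = block0 t ->
  colour (i * 7 + s)%N = colour (i * 7 + t)%N.
Proof.
pose P i s t := ((s == 6) == (t == 6)) ==>
  (colour (i * 7 + s)%N == colour (i * 7 + t)%N).
(* The finite check is moved to lists of natural numbers, on which it evaluates. *)
have : all (fun i => all (fun s => all (P i s) (iota 0 7)) (iota 0 7)) (iota 0 2).
  by vm_compute.
have mem n (u : 'I_n) : (u : nat) \in iota 0 n by rewrite mem_iota ltn_ord.
move=> /allP/(_ _ (mem _ i))/allP/(_ _ (mem _ s))/allP/(_ _ (mem _ t))/implyP h st.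
by apply/eqP/h; move: st; rewrite /block0; do 2 case: eqP.
Qed.

Lemma colour_block1 (i : 'I_2) (s t : 'I_7) : block1 s = block1 t ->
  colour (swap (i * 7 + s)) = colour (swap (i * 7 + t)).
Proof.
pose P i s t := (((3 <= s) + (5 <= s))%N == ((3 <= t) + (5 <= t))%N) ==>
  (colour (swap (i * 7 + s)) == colour (swap (i * 7 + t))).
have : all (fun i => all (fun s => all (P i s) (iota 0 7)) (iota 0 7)) (iota 0 2).
  by vm_compute.
have mem n (u : 'I_n) : (u : nat) \in iota 0 n by rewrite mem_iota ltn_ord.
move=> /allP/(_ _ (mem _ i))/allP/(_ _ (mem _ s))/allP/(_ _ (mem _ t))/implyP h st.
exact/eqP/h/eqP.
Qed.

(** At both ends the 14 x 14 matrix is diagonal, and its entries depend only on the copy and on the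
    end block. Its four 7 x 7 blocks therefore satisfy the end conditions, the off-diagonal ones
    being zero there. *)
Lemma rigid_idempotent_path k i j : is_path
  (diag_blocks_subalg R block0) (diag_blocks_subalg R block1)
  (fun x => unflat (rigid_flat k x) i j).
Proof.
split.
- by move=> x; rewrite /rigid_flat /rigid_rotation clampK.
- have cf : mxcont (rigid_flat k).
    apply: mxcontM; last exact/mxcont_adj/rigid_rotation_cont.
    by apply: mxcontM (mxcont_cst _); exact: rigid_rotation_cont.
  apply: mxcont_entries => s t.
  have -> : (fun x => unflat (rigid_flat k x) i j s t) =
    (fun x => rigid_flat k x (mxtens_index (i, s)) (mxtens_index (j, t))).
    by apply/funext => x; rewrite mxE.
  exact: mxcont_entry.
- split=> [s t st|s t st]; rewrite [LHS]mxE 1?[RHS]mxE !rigid_flat0.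
    by rewrite (can_eq (@mxtens_indexK 2 7)) xpair_eqE (negbTE st) andbF.
  rewrite !(can_eq (@mxtens_indexK 2 7)) !xpair_eqE !eqxx !andbT.
  rewrite /rigid_colour; congr (_ *+ _); congr (_%:C); congr (_ == _)%:R.
  exact: colour_block0.
- split=> [s t st|s t st]; rewrite [LHS]mxE 1?[RHS]mxE !rigid_flat1.
    by rewrite (can_eq (@mxtens_indexK 2 7)) xpair_eqE (negbTE st) andbF.
  rewrite !(can_eq (@mxtens_indexK 2 7)) !xpair_eqE !eqxx !andbT.
  rewrite /rigid_colour; congr (_ *+ _); congr (_%:C); congr (_ == _)%:R.
  exact: colour_block1.
Qed.

Definition rigid_idempotent k : 'M[A0]_2 :=
  \matrix_(i, j) Path (rigid_idempotent_path k i j : is_path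
     (pleft rigid_data) (pright rigid_data) _).

Lemma rigid_idempotentE k i j x :
  rigid_idempotent k i j x = unflat (rigid_flat k x) i j.
Proof. by rewrite mxE. Qed.

Lemma rigid_idempotent_idem k :
  rigid_idempotent k *m rigid_idempotent k = rigid_idempotent k.
Proof.
apply/matrixP => i j; rewrite mxE; apply: path_ext => x.
rewrite path_sum rigid_idempotentE.
under eq_bigr do rewrite pathM !rigid_idempotentE.
rewrite -unflatM; congr (unflat _ i j).
rewrite /rigid_flat !mulmxA -(mulmxA _ (mxadj _) (rigid_rotation x)).
rewrite (mulmx1C (rigid_rotation_unitary x)) mulmx1.
rewrite -(mulmxA _ (diag_mx _) (diag_mx _)) mulmx_diag; congr (_ *m diag_mx _ *m _).
apply/rowP => a; rewrite !mxE -rmorphM /rigid_colour.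
by case: (_ == _); rewrite ?mul0r ?mul1r.
Qed.

Lemma rigid_idempotent_sum : \sum_k rigid_idempotent k = 1%:M.
Proof.
apply/matrixP => i j; rewrite summxE; apply: path_ext => x; rewrite path_sum.
under eq_bigr do rewrite rigid_idempotentE.
have -> : \sum_k unflat (rigid_flat k x) i j = unflat (\sum_k rigid_flat k x) i j.
  apply/matrixP => s t; rewrite summxE !mxE summxE.
  by apply: eq_bigr => k _; rewrite mxE.
have -> : \sum_k rigid_flat k x = 1%:M.
  rewrite -(rigid_rotation_unitary x) /rigid_flat -mulmx_suml -mulmx_sumr.
  suff -> : \sum_k diag_mx (\row_a (rigid_colour k a)%:C) = 1%:M by rewrite mulmx1.
  apply/matrixP => a b; rewrite summxE mxE.
  under eq_bigr do rewrite !mxE.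
  rewrite sumrMnl; congr (_ *+ _).
  under eq_bigr do rewrite rmorph_nat.
  rewrite -natr_sum !big_ord_recl big_ord0.
  suff -> : forall m, (m < 2 * 7)%N ->
    ((colour m == 0%N) + ((colour m == 1%N) + ((colour m == 2%N) + 0)) = 1)%N => //.
  by do 14 (case=> //).
apply/matrixP => s t; rewrite !mxE (can_eq (@mxtens_indexK 2 7)) xpair_eqE.
by case: (i == j); rewrite ?path0 !mxE.
Qed.

(** At 0 the diagonal entry at an index of colour k is 1; the indices 0, 7 and 6 have the colours 0,
    1 and 2. That a single entry is large is how a formula can say that the idempotent is
    nonzero. *)
Lemma rigid_idempotent_norm k : exists i, 1 <= cnorm (rigid_idempotent k i i).
Proof.
have key (i : 'I_2) (s : 'I_7) : colour (i * 7 + s) = k ->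
    1 <= cnorm (rigid_idempotent k i i).
  move=> ck; rewrite (le_trans _ (opnorm_le_cnorm _ 0))//.
  rewrite (le_trans _ (normc_le_opnorm _ s s))// rigid_idempotentE mxE rigid_flat0.
  rewrite eqxx mulr1n /rigid_colour.
  have -> : colour (mxtens_index (i, s)) = k by exact: ck.
  by rewrite eqxx normc_real normr1.
case: k key => -[|[|[|//]]] hk key.
- by exists 0; exact: (key 0 0).
- by exists 1; exact: (key 1 0).
- by exists 0; exact: (key 0 (Ordinal (isT : 6 < 7)%N)).
Qed.

End CounterexampleAlgebra.

(** * Lifting of approximate idempotents *)

Section MatrixNorm.
Variables (R : realType) (A : cstarAlgType R).

(** Not the C*-norm of the matrix algebra, but submultiplicative and complete, which is all that the
    Newton iteration uses, and directly readable from the entries. *)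
Definition mnorm k (M : 'M[A]_k) : R := \sum_i \sum_j cnorm (M i j).

Lemma mnorm_ge0 k (M : 'M[A]_k) : 0 <= mnorm M.
Proof. by do 2![apply: sumr_ge0 => ? _]; exact: cnorm_ge0. Qed.

Lemma cnorm_le_mnorm k (M : 'M[A]_k) i j : cnorm (M i j) <= mnorm M.
Proof.
rewrite /mnorm (bigD1 i)//= (bigD1 j)//= -addrA lerDl addr_ge0//.
  by apply: sumr_ge0 => ? _; exact: cnorm_ge0.
by do 2![apply: sumr_ge0 => ? _]; exact: cnorm_ge0.
Qed.

Lemma mnorm_lt k (M : 'M[A]_k) (e : R) : 0 < e ->
  (forall i j, cnorm (M i j) < e) -> mnorm M <= (k * k)%:R * e.
Proof.
move=> e0 h; apply: (@le_trans _ _ (\sum_(i < k) \sum_(j < k) e)).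
  by apply: ler_sum => i _; apply: ler_sum => j _; exact: ltW.
by rewrite !sumr_const !card_ord -mulrnA mulr_natl.
Qed.

Lemma mnorm_eq0 k (M : 'M[A]_k) : mnorm M = 0 -> M = 0.
Proof.
move=> M0; apply/matrixP => i j; rewrite mxE; apply: cnorm0_eq0.
by apply/eqP; rewrite eq_le cnorm_ge0 andbT -M0 cnorm_le_mnorm.
Qed.

Lemma mnorm0 k : mnorm (0 : 'M[A]_k) = 0.
Proof. by do 2![apply: big1 => ? _]; rewrite mxE cnorm0. Qed.

Lemma ler_mnormD k (M N : 'M[A]_k) : mnorm (M + N) <= mnorm M + mnorm N.
Proof.
rewrite /mnorm -big_split; apply: ler_sum => i _; rewrite -big_split.
by apply: ler_sum => j _; rewrite mxE ler_cnormD.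
Qed.

Lemma mnormN k (M : 'M[A]_k) : mnorm (- M) = mnorm M.
Proof.
by apply: eq_bigr => i _; apply: eq_bigr => j _; rewrite mxE cnormN.
Qed.

Lemma mnormB k (M N : 'M[A]_k) : mnorm (M - N) = mnorm (N - M).
Proof. by rewrite -mnormN opprB. Qed.

Lemma mnorm_tri k (L M N : 'M[A]_k) : mnorm (M - N) <= mnorm (M - L) + mnorm (L - N).
Proof. by have := ler_mnormD (M - L) (L - N); rewrite addrA subrK. Qed.

Lemma ler_mnormM k (M N : 'M[A]_k) : mnorm (M *m N) <= mnorm M * mnorm N.
Proof.
rewrite {2}/mnorm mulr_suml; apply: ler_sum => i _.
apply: (@le_trans _ _ (\sum_j \sum_l cnorm (M i l) * cnorm (N l j))).
  apply: ler_sum => j _; rewrite mxE.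
  elim/big_rec2: _ => [|l x y _ h]; first by rewrite cnorm0.
  by rewrite (le_trans (ler_cnormD _ _))// lerD// ler_cnormM.
rewrite exchange_big mulr_suml; apply: ler_sum => l _.
rewrite -mulr_sumr ler_wpM2l ?cnorm_ge0// [leRHS](bigD1 l)//= lerDl.
by do 2![apply: sumr_ge0 => ? _]; exact: cnorm_ge0.
Qed.

Lemma mnorm_complete k (u : nat -> 'M[A]_k) :
  (forall e : R, 0 < e -> exists N, forall m n,
     (N <= m)%N -> (N <= n)%N -> mnorm (u m - u n) < e) ->
  exists l, forall e : R, 0 < e -> exists N, forall n,
    (N <= n)%N -> mnorm (u n - l) < e.
Proof.
move=> cau.
have ex (ij : 'I_k * 'I_k) : exists l : A, forall e : R, 0 < e ->
    exists N, forall m, (N <= m)%N -> cnorm (u m ij.1 ij.2 - l) < e.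
  apply: cnorm_complete => e /cau[N NP]; exists N => m n Nm Nn.
  rewrite (le_lt_trans _ (NP m n Nm Nn))//.
  by have := cnorm_le_mnorm (u m - u n) ij.1 ij.2; rewrite !mxE.
have [l lP] := choice ex.
exists (\matrix_(i, j) l (i, j)) => e e0.
pose K : R := (k * k).+1%:R.
have K0 : 0 < K by rewrite ltr0n.
have eK0 : 0 < e / K by rewrite divr_gt0.
have [N NP] := choice (fun ij => lP ij _ eK0).
exists (\max_ij N ij) => m Nm.
apply: (@le_lt_trans _ _ ((k * k)%:R * (e / K))).
  apply: mnorm_lt => // i j; rewrite !mxE.
  apply: (NP (i, j)); apply: leq_trans Nm.
  exact: (leq_bigmax (F := N) (i, j)).
by rewrite mulrCA gtr_pMr// ltr_pdivrMr// mul1r ltr_nat.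
Qed.

End MatrixNorm.

(* One Newton step towards an idempotent: with e = h^2 - h, the step is
   3h^2 - 2h^3 and the new defect is 4e^3 - 3e^2. *)
Definition idem_step (S : nzRingType) (h : S) : S :=
  h - (h * (h * h - h) + h * (h * h - h) - (h * h - h)).

(** Only one element of the noncommutative ring is involved, so the identity is checked in the
    commutative ring of integer polynomials and evaluated at h. *)
Lemma idem_stepE (S : nzRingType) (h : S) (e := h * h - h) :
  idem_step h * idem_step h - idem_step h =
  e * (e * e) + e * (e * e) + (e * (e * e) + e * (e * e)) - (e * e + e * e + e * e).
Proof.
have cf : commr_rmorph (intr : int -> S) h by move=> n; exact: commr_int.
pose x : {poly int} := 'X; pose d := x * x - x.
have : idem_step x * idem_step x - idem_step x =
  d * (d * d) + d * (d * d) + (d * (d * d) + d * (d * d)) - (d * d + d * d + d * d).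
  by rewrite /idem_step /d; ring.
move=> /(congr1 (horner_morph cf)).
rewrite /d /idem_step !(rmorphM, rmorphD, rmorphN) /= /x.
by rewrite !horner_morphX.
Qed.

Lemma addr_cancel4 (V : zmodType) (x a b c d : V) :
  x + (a + (b + (c - d))) - a - b - c + d = x.
Proof.
rewrite (addrC a) addrA addrK (addrC b) addrA addrK (addrC c) addrA addrK.
exact: subrK.
Qed.

Section IdempotentLifting.
Variables (R : realType) (A : cstarAlgType R) (k : nat).
Implicit Types h q : 'M[A]_k.+1.

Lemma ler_mnormMr h q : mnorm (h * q) <= mnorm h * mnorm q.
Proof. exact: ler_mnormM. Qed.

(** A defect x <= 1/16 becomes at most 4x^3 + 3x^2 <= 13x/64 <= x/4. A step moves an iterate of norm
    at most K + 1 by at most 2K + 3 times its defect, so the displacements are dominated by a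
    geometric series with sum 4/3 (2K + 3) times the initial defect; the factor 2 in the hypothesis
    covers 4/3. *)
Lemma idempotent_lift h (K tau : R) : mnorm h <= K ->
  mnorm (h *m h - h) <= 16^-1 ->
  2 * (2 * K + 3) * mnorm (h *m h - h) <= tau -> tau <= 1 ->
  exists2 q : 'M[A]_k.+1, q *m q = q & mnorm (q - h) <= tau.
Proof.
move=> hK; rewrite mulmxE; set e0 := mnorm _ => e0le e0tau tau1.
have e00 : 0 <= e0 by exact: mnorm_ge0.
have K0 : 0 <= K := le_trans (mnorm_ge0 h) hK.
pose u n := iter n (@idem_step _) h; pose e n := u n * u n - u n.
pose r n : R := 4^-1 ^+ n; pose C := 2 * K + 3.
have {}e0tau : 2 * (C * e0) <= tau by rewrite mulrA.
have r0 n : 0 <= r n by rewrite exprn_ge0.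
have r1 n : r n <= 1 by rewrite exprn_ile1//; lra.
have rS n : r n.+1 = r n / 4 by rewrite /r exprS mulrC.
have eP n : mnorm (e n) <= e0 * r n.
  elim: n => [|n IH]; first by rewrite /r expr0 mulr1.
  rewrite /e [u n.+1]/(idem_step (u n)) idem_stepE -/(e n).
  set x := mnorm (e n) in IH.
  have x0 : 0 <= x by exact: mnorm_ge0.
  have x16 : x <= 16^-1 by rewrite (le_trans IH)// (le_trans _ e0le)// ler_piMr.
  have h2 : mnorm (e n * e n) <= x * x by exact: ler_mnormMr.
  have h3 : mnorm (e n * (e n * e n)) <= x * (x * x).
    by rewrite (le_trans (ler_mnormMr _ _))// ler_wpM2l.
  apply: (@le_trans _ _ (x * (x * x) + x * (x * x) + (x * (x * x) + x * (x * x))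
     + (x * x + x * x + x * x))).
    rewrite (le_trans (ler_mnormD _ _))// mnormN.
    by apply: lerD; do 3?[rewrite (le_trans (ler_mnormD _ _))//; apply: lerD => //].
  rewrite rS (mulrA e0); move: (e0 * r n) IH => y IH.
  have : x * x <= x / 16 by rewrite ler_wpM2l.
  have : x * (x * x) <= x / 256.
    by rewrite ler_wpM2l// -(_ : 16^-1 * 16^-1 = 256^-1) ?ler_pM//; lra.
  lra.
have step n : mnorm (u n) <= K + 1 -> mnorm (u n.+1 - u n) <= C * (e0 * r n).
  move=> un; rewrite [u n.+1]/(idem_step (u n)) /idem_step addrAC subrr add0r mnormN.
  rewrite -/(e n); apply: (@le_trans _ _ ((K + 1) * mnorm (e n) +
    (K + 1) * mnorm (e n) + mnorm (e n))).
    rewrite (le_trans (ler_mnormD _ _))// mnormN lerD// (le_trans (ler_mnormD _ _))//.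
    by apply: lerD; rewrite (le_trans (ler_mnormMr _ _))// ler_wpM2r ?mnorm_ge0.
  have := eP n; have := mnorm_ge0 (e n); rewrite /C.
  move: (mnorm _) (e0 * r n) => a b a0 ab; nra.
have Ce0 : C * e0 * (4 / 3) <= 1.
  have C0 : 0 <= C * e0 by rewrite mulr_ge0 /C//; lra.
  by move: e0tau tau1 C0; move: (C * e0) => a; lra.
(* The bound on a step presupposes that the iterate has norm at most K + 1, which follows from the
   sum of the earlier steps; hence one induction for both. The difference of powers makes the
   geometric sum telescope exactly. *)
have tele n m : mnorm (u (n + m)%N - u n) <= C * e0 * (4 / 3) * (r n - r (n + m)%N) /\
    mnorm (u (n + m)%N) <= K + 1.
  suff main p : (forall m, (m <= p)%N ->
      mnorm (u m) <= K + 1) /\ (forall n m, (n + m <= p)%N ->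
    mnorm (u (n + m)%N - u n) <= C * e0 * (4 / 3) * (r n - r (n + m)%N)).
    by have [h1 h2] := main (n + m)%N; split; [exact: h2|exact: h1].
  elim: p => [|p [IH1 IH2]].
    split=> [[|//] _|[|//] [|//] _]; last by rewrite !subrr mnorm0 mulr0.
    by rewrite (le_trans hK)// lerDl.
  have H2 n' m' : (n' + m' <= p.+1)%N ->
      mnorm (u (n' + m')%N - u n') <= C * e0 * (4 / 3) * (r n' - r (n' + m')%N).
    case: m' => [|m']; first by rewrite addn0 !subrr mnorm0 mulr0.
    rewrite addnS ltnS => nm.
    rewrite (le_trans (mnorm_tri (u (n' + m')%N) _ _))//.
    have := step _ (IH1 _ nm); have := IH2 _ _ nm; rewrite rS.
    move: (r n') (r (n' + m')%N) (mnorm _) (mnorm _) => a b c d h1 h2.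
    have -> : C * e0 * (4 / 3) * (a - b / 4) =
      C * (e0 * b) + C * e0 * (4 / 3) * (a - b) by lra.
    exact: lerD.
  split=> // m'; rewrite leq_eqVlt => /orP[/eqP ->|]; last exact: IH1.
  have := H2 0%N p.+1 (leqnn _); rewrite add0n -[u 0%N]/h -[r 0%N]/(4^-1 ^+ 0) expr0 => h1.
  rewrite -(subrK h (u p.+1)) (le_trans (ler_mnormD _ _))// addrC lerD//.
  rewrite (le_trans h1)// (le_trans _ Ce0)// ler_piMr//; last by rewrite lerBlDr lerDl.
  by rewrite !mulr_ge0 /C//; lra.
have rlim (x : R) : 0 < x -> exists n, r n < x.
  move=> x0.
  have : (fun n => 4^-1 ^+ n : R) @ \oo --> (0 : R).
    by apply: cvg_expr; rewrite ger0_norm; lra.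
  move=> /cvgrPdist_lt/(_ _ x0)[N _ NP]; exists N.
  by have := NP N (leqnn N); rewrite /= sub0r normrN ger0_norm ?exprn_ge0.
have rmono n m : (n <= m)%N -> r m <= r n.
  by move=> nm; rewrite ler_wiXn2l//; lra.
have cau (x : R) : 0 < x -> exists N, forall m n,
    (N <= m)%N -> (N <= n)%N -> mnorm (u m - u n) < x.
  move=> x0; have [N Nx] := rlim (x / 2) (divr_gt0 x0 (ltr0n _ 2)).
  have half m : (N <= m)%N -> mnorm (u m - u N) < x / 2.
    move=> Nm; have [] := tele N (m - N)%N; rewrite subnKC// => h1 _.
    rewrite (le_lt_trans h1)// (le_lt_trans _ Nx)//.
    rewrite (@le_trans _ _ (1 * (r N - r m)))//; last first.
      by rewrite mul1r lerBlDr lerDl.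
    by rewrite ler_wpM2r// subr_ge0 rmono.
  exists N => m n /half hm /half hn.
  by rewrite (le_lt_trans (mnorm_tri (u N) _ _))// [x]splitr ltrD// mnormB.
have [q qP] := mnorm_complete cau.
exists q; last first.
  apply/ler_addgt0Pl => x x0; have [N NP] := qP _ x0.
  rewrite (le_trans (mnorm_tri (u N) _ _))// lerD//.
    by rewrite mnormB ltW// NP.
  have [] := tele 0%N N; rewrite add0n => h1 _; rewrite (le_trans h1)//.
  apply: le_trans e0tau; rewrite -[r 0%N]/(4^-1 ^+ 0) expr0.
  rewrite (@le_trans _ _ (C * e0 * (4 / 3)))//.
    rewrite ler_piMr//; last by rewrite lerBlDr lerDl.
    by rewrite !mulr_ge0 /C//; lra.
  have C0 : 0 <= C * e0 by rewrite mulr_ge0 /C//; lra.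
  by move: C0; move: (C * e0) => a; lra.
apply/eqP; rewrite -subr_eq0; apply/eqP/mnorm_eq0/eqP.
rewrite eq_le mnorm_ge0 andbT; apply/ler_addgt0Pl => x x0; rewrite addr0.
pose L := 2 * mnorm q + 3.
have L0 : 0 < L by rewrite /L; have := mnorm_ge0 q; lra.
pose y := Num.min 1 (x / L).
have y0 : 0 < y by rewrite lt_min ltr01 divr_gt0.
have [N NP] := qP _ y0; have [M Mx] := rlim _ y0.
pose m := maxn N M.
have um := NP m (leq_maxl _ _).
have em : mnorm (e m) <= y.
  rewrite (le_trans (eP m))// (@le_trans _ _ (1 * r m))//.
    by rewrite ler_wpM2r//; lra.
  by rewrite mul1r ltW// (le_lt_trans _ Mx)// rmono// leq_maxr.
have [d uE] : exists d, u m = q + d by exists (u m - q); rewrite addrC subrK.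
have {}um : mnorm d < y by rewrite -[d](addKr q) -uE addrC.
(* With [u m] = q + d, every term on the right becomes small with y, which bounds the defect of the
   limit. *)
have qE : q * q - q = e m - q * d - d * q - d * d + d.
  rewrite -[LHS](addr_cancel4 _ (q * d) (d * q) (d * d) d) /e uE mulrDl !mulrDr.
  do 4 congr (_ + _); rewrite opprD !addrA; congr (_ - d).
  by rewrite [in RHS](addrAC _ (d * d)) [in RHS](addrAC _ (d * q)) [in RHS](addrAC _ (q * d)).
rewrite qE.
have y1 : y <= 1 by rewrite ge_min lexx.
have yL : y * L <= x by rewrite -ler_pdivlMr// ge_min lexx orbT.
have h1 := ler_mnormMr q d; have h2 := ler_mnormMr d q; have h3 := ler_mnormMr d d.
rewrite (le_trans (ler_mnormD _ _))//.
have := ler_mnormD (e m - q * d - d * q) (- (d * d)).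
have := ler_mnormD (e m - q * d) (- (d * q)).
have := ler_mnormD (e m) (- (q * d)).
rewrite !mnormN => t1 t2 t3.
have d0 := mnorm_ge0 d; have q0 := mnorm_ge0 q.
apply: le_trans yL; rewrite /L.
have qd : mnorm q * mnorm d <= mnorm q * y by rewrite ler_wpM2l// ltW.
have dd : mnorm d * mnorm d <= y * 1 by rewrite ler_pM// ltW// (lt_le_trans um).
rewrite (mulrC (mnorm d)) in h2.
lra.
Qed.

End IdempotentLifting.

(** * Contractivity of *-homomorphisms *)

Section GeometricSequences.
Variables (R : realType) (A : cstarAlgType R).

Lemma geometric_vanish (r C x : R) : 0 <= r < 1 -> 0 < x ->
  exists N, forall n, (N <= n)%N -> C * r ^+ n < x.
Proof.
move=> /andP[r0 r1] x0.
have C0 : 0 < `|C| + 1 by rewrite ltr_wpDl.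
have : (fun n => r ^+ n : R) @ \oo --> (0 : R) by apply: cvg_expr; rewrite ger0_norm.
move=> /cvgrPdist_lt/(_ _ (divr_gt0 x0 C0))[N _ NP]; exists N => n Nn.
have := NP n Nn; rewrite /= sub0r normrN ger0_norm ?exprn_ge0// ltr_pdivlMr//.
apply: le_lt_trans; rewrite mulrC ler_wpM2l ?exprn_ge0//.
by rewrite (le_trans (ler_norm _))// lerDl.
Qed.

Lemma cnorm_geometric_cauchy (u : nat -> A) (C r : R) : 0 <= r < 1 ->
  (forall n, cnorm (u n.+1 - u n) <= C * r ^+ n) ->
  exists l : A, forall e : R, 0 < e -> exists N, forall n,
      (N <= n)%N -> cnorm (u n - l) < e.
Proof.
move=> r01 step; have /andP[r0 r1] := r01.
have s0 : 0 < 1 - r by rewrite subr_gt0.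
have C0 : 0 <= C by have := step 0%N; rewrite expr0 mulr1; exact: le_trans (cnorm_ge0 _).
have tele n m : cnorm (u (n + m)%N - u n) <= C / (1 - r) * r ^+ n * (1 - r ^+ m).
  elim: m => [|m IH]; first by rewrite addn0 !subrr cnorm0 mulr0.
  rewrite addnS (le_trans (cnorm_tri (u (n + m)%N) _ _))//.
  rewrite (le_trans (lerD (step _) IH))//.
  by rewrite exprD exprS le_eqVlt; apply/orP; left; apply/eqP; field; rewrite gt_eqF.
apply: cnorm_complete => x x0.
have [N NP] := geometric_vanish (C / (1 - r)) r01 (divr_gt0 x0 (ltr0n _ 2)).
have half m : (N <= m)%N -> cnorm (u m - u N) < x / 2.
  move=> Nm; have := tele N (m - N)%N; rewrite subnKC// => h1.
  rewrite (le_lt_trans h1)// (le_lt_trans _ (NP N (leqnn N)))//.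
  rewrite ler_piMr//; last by rewrite lerBlDr lerDl exprn_ge0.
  by rewrite mulr_ge0 ?exprn_ge0// divr_ge0// ltW.
exists N => m n /half hm /half hn.
by rewrite (le_lt_trans (cnorm_tri (u N) _ _))// [x]splitr ltrD// cnormB.
Qed.

End GeometricSequences.

Section SquareRoot.
Variables (R : realType) (A : cstarAlgType R).
Implicit Types a b s t : A.

Lemma cnorm_small_eq0 a : (forall e : R, 0 < e -> cnorm a <= e) -> a = 0.
Proof.
move=> h; apply: cnorm0_eq0; apply/eqP; rewrite eq_le cnorm_ge0 andbT.
by apply/ler_addgt0Pl => e /h; rewrite addr0.
Qed.

Lemma cnorm_half a : cnorm ((2^-1 : R)%:C *: a) = cnorm a / 2.
Proof. by rewrite cnormZ normc_real ger0_norm ?invr_ge0// mulrC. Qed.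

Lemma scale_half_double a : (2^-1 : R)%:C *: a + (2^-1 : R)%:C *: a = a.
Proof.
rewrite -scalerDl -rmorphD (_ : 2^-1 + 2^-1 = 1 :> R) ?scale1r//; lra.
Qed.

(* 1 - s is the fixed point of t |-> (b + t^2) / 2, a contraction of the ball of
   radius |b|. *)
Lemma cstar_sqrt a b : star b = b -> a * b = b * a -> cnorm b < 1 ->
  exists s, [/\ star s = s, a * s = s * a & s * s = 1 - b].
Proof.
move=> sb ab b1; pose r := cnorm b.
have r0 : 0 <= r by exact: cnorm_ge0.
pose half : R[i] := (2^-1 : R)%:C.
pose F t := half *: (b + t * t); pose u n := iter n F 0.
have star_u n : star (u n) = u n.
  elim: n => [|n IH]; first exact: star0.
  by rewrite /= starZ starD starM sb IH conjc_real.
have comm_u n : a * u n = u n * a.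
  elim: n => [|n IH]; first by rewrite mulr0 mul0r.
  rewrite /= -scalerAr -scalerAl mulrDr mulrDl ab; congr (_ *: (_ + _)).
  by rewrite mulrA IH -mulrA IH mulrA.
have norm_u n : cnorm (u n) <= r.
  elim: n => [|n IH]; first by rewrite cnorm0.
  rewrite /= cnorm_half ler_pdivrMr// mulr_natr mulr2n.
  rewrite (le_trans (ler_cnormD _ _))// lerD2l (le_trans (ler_cnormM _ _))//.
  by rewrite -[leRHS]mulr1 ler_pM ?cnorm_ge0// (le_trans IH)// ltW.
have sqB s t : s * s - t * t = s * (s - t) + (s - t) * t.
  by rewrite mulrBr mulrBl addrA subrK.
have step n : cnorm (u n.+1 - u n) <= r * r ^+ n.
  elim: n => [|n IH]; first by rewrite expr0 mulr1 subr0 norm_u.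
  rewrite [u n.+2]/= [u n.+1 in X in _ - X]/= -scalerBr cnorm_half.
  rewrite opprD addrACA subrr add0r sqB ler_pdivrMr//.
  rewrite (le_trans (ler_cnormD _ _))// exprS.
  have h1 : cnorm (u n.+1 * (u n.+1 - u n)) <= r * (r * r ^+ n).
    by rewrite (le_trans (ler_cnormM _ _))// ler_pM ?cnorm_ge0.
  have h2 : cnorm ((u n.+1 - u n) * u n) <= r * (r * r ^+ n).
    by rewrite (le_trans (ler_cnormM _ _))// mulrC ler_pM ?cnorm_ge0.
  by rewrite mulr_natr mulr2n lerD.
have [t tP] := cnorm_geometric_cauchy (introT andP (conj r0 b1)) step.
have star_t : star t = t.
  apply/eqP; rewrite -subr_eq0; apply/eqP/cnorm_small_eq0 => e e0.
  have [N NP] := tP _ (divr_gt0 e0 (ltr0n _ 2)); have h := NP N (leqnn N).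
  rewrite (le_trans (cnorm_tri (u N) _ _))// [e]splitr ltW// ltrD//.
  by rewrite -{1}(star_u N) -starB cnorm_star cnormB.
have comm_t : a * t = t * a.
  apply/eqP; rewrite -subr_eq0; apply/eqP/cnorm_small_eq0 => e e0.
  have K0 : 0 < 2 * cnorm a + 1 by rewrite ltr_wpDl// mulr_ge0// cnorm_ge0.
  have [N NP] := tP _ (divr_gt0 e0 K0); have h := NP N (leqnn N).
  have -> : a * t - t * a = (u N - t) * a - a * (u N - t).
    by rewrite mulrBl mulrBr comm_u opprB [RHS]addrC addrA subrK.
  rewrite (le_trans (ler_cnormB _ _))//.
  have h1 := ler_cnormM (u N - t) a; have h2 := ler_cnormM a (u N - t).
  move: h; rewrite ltr_pdivlMr// => h.
  have := cnorm_ge0 a; have := cnorm_ge0 (u N - t).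
  move: h1 h2 h; move: (cnorm (u N - t)) (cnorm a) => x y; nra.
have fix_t : t + t = b + t * t.
  apply/eqP; rewrite -subr_eq0; apply/eqP/cnorm_small_eq0 => e e0.
  have t0 := cnorm_ge0 t.
  have K0 : 0 < 2 * (cnorm t + 4) by lra.
  have [N NP] := tP _ (divr_gt0 e0 K0); have h := NP N (leqnn N).
  have h' := NP N.+1 (leqnSn N).
  have uE : u N.+1 + u N.+1 = b + u N * u N by exact: scale_half_double.
  have -> : t + t - (b + t * t) =
    (u N * u N - t * t) - ((u N.+1 - t) + (u N.+1 - t)).
    have aux (p q c d : A) : p - q - (c + p - d) = d - (c + q).
      by rewrite opprB addrC -addrA opprD -addrA addKr -opprD.
    by rewrite addrACA uE -opprD aux.
  rewrite (le_trans (ler_cnormB _ _))// sqB.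
  have h1 := ler_cnormD (u N * (u N - t)) ((u N - t) * t).
  have h2 := ler_cnormM (u N) (u N - t); have h3 := ler_cnormM (u N - t) t.
  have h4 := ler_cnormD (u N.+1 - t) (u N.+1 - t).
  have h5 := le_lt_trans (norm_u N) b1.
  move: h h'; rewrite !ltr_pdivlMr// => h h'.
  have := cnorm_ge0 (u N - t); have := cnorm_ge0 (u N.+1 - t).
  have := cnorm_ge0 (u N).
  move: h1 h2 h3 h4 h5 h h'.
  move: (cnorm (u N * (u N - t) + _)) (cnorm (u N.+1 - t + _)) (cnorm (u N * _)).
  move: (cnorm (_ * t)).
  move: (cnorm (u N - t)) (cnorm (u N.+1 - t)) (cnorm (u N)) (cnorm t) t0 => x x' z y t0.
  move=> p1 p2 p3 p4 h1 h2 h3 h4 h5 h h' z0 x'0 x0.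
  have : z * x <= x by rewrite ler_piMl// ltW.
  have : x' * y >= 0 by rewrite mulr_ge0.
  lra.
exists (1 - t); split.
- by rewrite starB star1 star_t.
- by rewrite mulrBr mulrBl mulr1 mul1r comm_t.
- by rewrite mulrBr mulr1 mulrBl mul1r opprB addrACA -opprD fix_t (addrC b) addrKA.
Qed.

End SquareRoot.

Section StarHomomorphisms.
Variables (R : realType) (A B : cstarAlgType R).

(** A predicate on plain functions, because the embeddings of dimension drop algebras are given as
    plain functions. *)
Definition unital_star_hom (f : A -> B) : Prop :=
  [/\ forall x y, f (x + y) = f x + f y,
      forall x y, f (x * y) = f x * f y,
      forall (a : R[i]) x, f (a *: x) = a *: f x,
      forall x, f (star x) = star (f x)
    & f 1 = 1].

Variable f : A -> B.
Hypothesis hf : unital_star_hom f.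

Lemma star_hom0 : f 0 = 0.
Proof. by case: hf => _ _ fZ _ _; rewrite -(scale0r 0) fZ scale0r. Qed.

Lemma star_homB x y : f (x - y) = f x - f y.
Proof.
case: hf => fD _ fZ _ _.
have h1 := fD x (- y).
have h2 := fZ (-1) y.
rewrite scaleN1r in h2.
rewrite scaleN1r in h2.
by rewrite h1 h2.
Qed.

Lemma star_hom_sum I (r : seq I) (P : pred I) (F : I -> A) :
  f (\sum_(i <- r | P i) F i) = \sum_(i <- r | P i) f (F i).
Proof.
by case: hf => fD _ _ _ _; elim/big_rec2: _ => [|i u v _ <-]; rewrite ?star_hom0.
Qed.

(* A self-adjoint a of norm < 1 is the real part of the unitary
   a + i sqrt(1 - a^2). *)
Lemma star_hom_contractive x : cnorm (f x) <= cnorm x.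
Proof.
case: hf => fD fM fZ fS f1.
have key a : star a = a -> cnorm a < 1 -> cnorm (f a) <= 1.
  move=> sa a1.
  have [|||s [ss as_ s2]] := @cstar_sqrt R A a (a * a).
  - by rewrite starM sa.
  - by rewrite mulrA.
  - by rewrite -{1}sa cnorm_star_mul expr_lt1 ?cnorm_ge0.
  pose u := a + 'i%C *: s.
  have su : star u = a - 'i%C *: s.
    rewrite starD starZ sa ss (_ : 'i%C^*%C = - 'i%C) ?scaleNr//.
    by apply/eqP; rewrite eq_complex /= oppr0 !eqxx.
  have uu : star u * u = 1.
    have ii : 'i%C * 'i%C = -1 :> R[i] by rewrite -expr2 sqr_i.
    rewrite su mulrDr !mulrBl -!scalerAl -!scalerAr scalerA ii s2 as_.
    by rewrite scaleN1r opprK addrA subrK addrC subrK.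
  have aE : a = (2^-1 : R)%:C *: (u + star u).
    by rewrite su addrACA subrr addr0 scalerDr scale_half_double.
  have fu1 : cnorm (f u) = 1.
    have := cnorm_star_mul (f u); rewrite -fS -fM uu f1 cnorm1 => /esym/eqP.
    by rewrite sqrf_eq1 => /orP[/eqP//|/eqP h]; have := cnorm_ge0 (f u); rewrite h; lra.
  rewrite aE fZ fD fS cnorm_half ler_pdivrMr// mul1r.
  by rewrite (le_trans (ler_cnormD _ _))// cnorm_star fu1; lra.
(* The C*-identity replaces x by the self-adjoint a = [star x * x]; dividing a by |a| + e brings its
   norm below 1, and e is arbitrary. *)
rewrite -(@ler_pXn2r _ 2)// ?nnegrE ?cnorm_ge0// -!cnorm_star_mul -fS -fM.
set a := star x * x; have sa : star a = a by rewrite starM starK.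
apply/ler_addgt0Pl => e e0; set k := e + cnorm a.
have k0 : 0 < k by rewrite ltr_wpDr// cnorm_ge0.
have ki0 : 0 <= k^-1 by rewrite invr_ge0 ltW.
have := key ((k^-1)%:C *: a); rewrite starZ sa conjc_real => /(_ erefl).
rewrite fZ !cnormZ normc_real ger0_norm// mulrC ltr_pdivrMr// mul1r ltrDr.
by move=> /(_ e0); rewrite ler_pdivrMl// mulr1.
Qed.

End StarHomomorphisms.

(** The C*-identity for a self-adjoint element is the case n = 1; powers of a remain self-adjoint,
    so it iterates. *)
Lemma cnorm_expr2n (R : realType) (A : cstarAlgType R) (a : A) n : star a = a -> cnorm (a ^+ (2 ^ n)) = cnorm a ^+ (2 ^ n).
Proof.
move=> sa; elim: n => [|n IH]; first by rewrite expn0 !expr1.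
have sX k : star (a ^+ k) = a ^+ k.
  by elim: k => [|k IHk]; rewrite ?star1// [in LHS]exprSr starM sa IHk -exprS.
by rewrite expnSr !exprM -IH expr2 -{1}sX cnorm_star_mul.
Qed.

(** If |f a| < |a| for a self-adjoint a, then |a|^(2^n) = |a^(2^n)| <= C |f a|^(2^n) fails for large
    n. A crude lower bound on f thus improves to an isometry. *)
Lemma star_hom_isometric (R : realType) (A B : cstarAlgType R) (f : A -> B) (C : R) :
  unital_star_hom f -> (forall x, cnorm x <= C * cnorm (f x)) ->
  forall x, cnorm (f x) = cnorm x.
Proof.
move=> hf fC x; apply/eqP; rewrite eq_le star_hom_contractive//=.
case: (hf) => fD fM fZ fS f1.
rewrite leNgt; apply/negP => fx.
pose a := star x * x; have sa : star a = a by rewrite starM starK.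
have sfa : star (f a) = f a by rewrite -fS sa.
have fa : cnorm (f a) < cnorm a.
  by rewrite fM fS !cnorm_star_mul ltr_pXn2r ?nnegrE ?cnorm_ge0.
have a0 : 0 < cnorm a := le_lt_trans (cnorm_ge0 _) fa.
have fX n : f (a ^+ n) = f a ^+ n.
  by elim: n => [|n IH]; rewrite ?f1// !exprS fM IH.
pose r := cnorm (f a) / cnorm a.
have r01 : 0 <= r < 1.
  by rewrite divr_ge0 ?cnorm_ge0//= ltr_pdivrMr// mul1r.
have [N NP] := geometric_vanish C r01 ltr01.
have := NP (2 ^ N)%N (ltnW (ltn_expl N (ltnSn 1))).
rewrite expr_div_n mulrA ltr_pdivrMr ?exprn_gt0// mul1r -!cnorm_expr2n//.
by rewrite -fX ltNge fC.
Qed.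

(** * Dimension drop algebras *)

(** A common form of a |-> a (x) 1 and a |-> 1 (x) a, the embeddings of multiplicity c. The indices
    [amp_index] cut out a corner in which the argument reappears, and [amp_bound] controls an image
    by the entries of its argument. *)
Record amplification (R : realType) m n (c : nat) := Amplification {
  amp :> 'M[R[i]]_m -> 'M[R[i]]_n;
  amp_index : 'I_m -> 'I_n;
  ampD : forall M N, amp (M + N) = amp M + amp N;
  ampZ : forall a M, amp (a *: M) = a *: amp M;
  ampM : forall M N, amp (M *m N) = amp M *m amp N;
  amp1 : amp 1%:M = 1%:M;
  ampJ : forall M, amp (mxadj M) = mxadj (amp M);
  amp_trace : forall M, \tr (amp M) = c%:R * \tr M;
  amp_entry : forall M i j, amp M (amp_index i) (amp_index j) = M i j;
  amp_bound : forall (M : 'M[R[i]]_m) (e : R), 0 <= e -> (forall i j, normc (M i j) <= e) ->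
    forall s t, normc (amp M s t) <= e }.

Section AmplificationImage.
Variables (R : realType) (m n c : nat) (phi : amplification R m n c).

Definition amp_image : mxsubalg R n.
Proof.
exists (fun M => exists a, M = phi a).
- by exists 1%:M; rewrite amp1.
- by move=> _ _ [a ->] [b ->]; exists (a + b); rewrite ampD.
- by move=> x _ [a ->]; exists (x *: a); rewrite ampZ.
- by move=> _ _ [a ->] [b ->]; exists (a *m b); rewrite ampM.
- by move=> _ [a ->]; exists (mxadj a); rewrite ampJ.
(* The preimage is read off the corner of the limit itself, so no limit of preimages has to be
   taken. *)
move=> M lim; pose a := \matrix_(i, j) M (amp_index phi i) (amp_index phi j).
exists a; apply/matrixP => s t; apply/eqP; rewrite -subr_eq0; apply/eqP.
apply: normc_small_eq0 => e e0; have e20 : 0 < e / 2 by rewrite divr_gt0.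
have [_ [b ->] Mb] := lim _ e20.
have ampB x y : phi (x - y) = phi x - phi y.
  by rewrite ampD -(scaleN1r y) ampZ scaleN1r.
have -> : M s t - phi a s t = (M - phi b) s t + (phi (b - a)) s t.
  by rewrite ampB !mxE addrA subrK.
rewrite (le_lt_trans (ler_normcD _ _))// [e]splitr ltr_leD//.
  by rewrite (le_lt_trans _ Mb)// normc_le_opnorm.
apply: amp_bound => [|i j]; first exact: ltW.
rewrite -(amp_entry phi (b - a)) ampB !mxE.
have -> : phi a (amp_index phi i) (amp_index phi j) =
  M (amp_index phi i) (amp_index phi j) by rewrite amp_entry mxE.
rewrite normcB ltW// (le_lt_trans _ Mb)//.
by have := normc_le_opnorm (M - phi b) (amp_index phi i) (amp_index phi j); rewrite !mxE.
Defined.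

(** The preimages of the entries again form an idempotent matrix, as the corner recovers them from
    their images; its rank is multiplied by c. *)
Lemma amp_image_trace k (F : 'I_k -> 'I_k -> 'M[R[i]]_n) :
  (forall i j, amp_image (F i j)) ->
  (forall i j, \sum_l F i l *m F l j = F i j) ->
  exists r : nat, \sum_i \tr (F i i) = (c * r)%:R.
Proof.
move=> FA FF.
have [a aP] := choice (fun ij : 'I_k * 'I_k => FA ij.1 ij.2).
pose f i j := a (i, j); have fE i j : F i j = phi (f i j) := aP (i, j).
have ff i j : \sum_l f i l *m f l j = f i j.
  apply/matrixP => s t; rewrite -(amp_entry phi (f i j)) -fE -FF !summxE.
  by apply: eq_bigr => l _; rewrite !fE -ampM amp_entry.
exists (\rank (flat f)).
rewrite natrM -idempotent_trace; last first.
  by rewrite flat_mul; congr flat; apply/funext => i; apply/funext => j.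
by rewrite flat_trace mulr_sumr; apply: eq_bigr => i _; rewrite fE amp_trace.
Qed.

End AmplificationImage.

Section TensorAmplifications.
Variables (R : realType) (p q : nat).

Lemma tensmxZl (a : R[i]) m n m' n' (M : 'M[R[i]]_(m, n)) (N : 'M[R[i]]_(m', n')) :
  (a *: M) *t N = a *: (M *t N).
Proof.
apply/matrixP => s t; rewrite -(mxtens_unindexK s) -(mxtens_unindexK t).
case: (mxtens_unindex s) (mxtens_unindex t) => i k [j l].
by rewrite [RHS]mxE !tensmxE mxE mulrA.
Qed.

Lemma tensmxZr (a : R[i]) m n m' n' (M : 'M[R[i]]_(m, n)) (N : 'M[R[i]]_(m', n')) :
  M *t (a *: N) = a *: (M *t N).
Proof.
apply/matrixP => s t; rewrite -(mxtens_unindexK s) -(mxtens_unindexK t).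
case: (mxtens_unindex s) (mxtens_unindex t) => i k [j l].
by rewrite [RHS]mxE !tensmxE mxE mulrCA.
Qed.

Lemma tensmxDl m n m' n' (M M' : 'M[R[i]]_(m, n)) (N : 'M[R[i]]_(m', n')) :
  (M + M') *t N = M *t N + M' *t N.
Proof.
apply/matrixP => s t; rewrite -(mxtens_unindexK s) -(mxtens_unindexK t).
case: (mxtens_unindex s) (mxtens_unindex t) => i k [j l].
by rewrite [RHS]mxE !tensmxE mxE mulrDl.
Qed.

Lemma tensmxDr m n m' n' (M : 'M[R[i]]_(m, n)) (N N' : 'M[R[i]]_(m', n')) :
  M *t (N + N') = M *t N + M *t N'.
Proof.
apply/matrixP => s t; rewrite -(mxtens_unindexK s) -(mxtens_unindexK t).
case: (mxtens_unindex s) (mxtens_unindex t) => i k [j l].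
by rewrite [RHS]mxE !tensmxE mxE mulrDr.
Qed.

Lemma tensmx11 : (1%:M : 'M[R[i]]_p) *t (1%:M : 'M[R[i]]_q) = 1%:M.
Proof.
apply/matrixP => s t; rewrite -(mxtens_unindexK s) -(mxtens_unindexK t).
case: (mxtens_unindex s) (mxtens_unindex t) => i k [j l].
rewrite tensmxE !mxE (can_eq (@mxtens_indexK p q)) xpair_eqE.
by case: (i == j); case: (k == l); rewrite ?(mulr1, mulr0).
Qed.

Lemma mxadj_tens m n m' n' (M : 'M[R[i]]_(m, n)) (N : 'M[R[i]]_(m', n')) :
  mxadj (M *t N) = mxadj M *t mxadj N.
Proof. by rewrite /mxadj map_mxT trmx_tens. Qed.

Lemma tensmx_trace (M : 'M[R[i]]_p) (N : 'M[R[i]]_q) : \tr (M *t N) = \tr M * \tr N.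
Proof.
rewrite /mxtrace sum_mxtens mulr_suml; apply: eq_bigr => i _.
by rewrite mulr_sumr; apply: eq_bigr => k _; rewrite tensmxE.
Qed.

Definition tens_left : (0 < q)%N -> amplification R p (p * q) q.
Proof.
move=> q0.
exists (fun a => a *t 1%:M) (fun i => mxtens_index (i, Ordinal q0)).
- by move=> M N; rewrite tensmxDl.
- by move=> a M; rewrite tensmxZl.
- by move=> M N; rewrite tensmx_mul mulmx1.
- exact: tensmx11.
- by move=> M; rewrite mxadj_tens mxadj1.
- by move=> M; rewrite tensmx_trace mxtrace1 mulrC.
- by move=> M i j; rewrite tensmxE mxE eqxx mulr1.
- move=> M e e0 h s t; rewrite -(mxtens_unindexK s) -(mxtens_unindexK t).
  case: (mxtens_unindex s) (mxtens_unindex t) => i k [j l].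
  by rewrite tensmxE mxE; case: (k == l); rewrite ?mulr1// mulr0 normc0.
Defined.

Definition tens_right : (0 < p)%N -> amplification R q (p * q) p.
Proof.
move=> p0.
exists (fun a => 1%:M *t a) (fun i => mxtens_index (Ordinal p0, i)).
- by move=> M N; rewrite tensmxDr.
- by move=> a M; rewrite tensmxZr.
- by move=> M N; rewrite tensmx_mul mulmx1.
- exact: tensmx11.
- by move=> M; rewrite mxadj_tens mxadj1.
- by move=> M; rewrite tensmx_trace mxtrace1.
- by move=> M i j; rewrite tensmxE mxE eqxx mul1r.
- move=> M e e0 h s t; rewrite -(mxtens_unindexK s) -(mxtens_unindexK t).
  case: (mxtens_unindex s) (mxtens_unindex t) => i k [j l].
  by rewrite tensmxE mxE; case: (i == j); rewrite ?mul1r// mul0r normc0.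
Defined.

End TensorAmplifications.

Section ComplexContinuity.
Variable R : realType.
Implicit Types h : R -> R[i].

Lemma complex_gt0_real (e : R[i]) : 0 < e -> exists2 r : R, 0 < r & e = r%:C.
Proof.
case: e => r s; rewrite ltcE /= => /andP[/eqP -> r0].
by exists r.
Qed.

Lemma ccont_continuous h : ccont h -> continuous (h : R -> R[i]^o).
Proof.
move=> ch x; apply/cvgrPdist_lt => _ /complex_gt0_real[e e0 ->].
have [d d0 dP] := ch x _ e0; apply/nbhs_ballP; exists d => // y xy.
by rewrite normc_norm ltcR; exact: dP.
Qed.

Lemma within_continuous_clamp h :
  {within `[0, 1], continuous (h : R -> R[i]^o)} -> ccont (fun x => h (clamp x)).
Proof.
move=> /subspace_continuousP ch x e e0.
have /cvgrPdist_lt/(_ e%:C) := ch _ (clamp_itv x).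
rewrite ltcR => /(_ e0) /nbhs_ballP[d d0 dP]; exists d => // y xy.
have := dP (clamp y) _ (clamp_itv y).
rewrite normc_norm ltcR; apply; exact: le_lt_trans (clamp_lip _ _) xy.
Qed.

End ComplexContinuity.

Section DimensionDrop.
Variables (R : realType) (p q : nat) (p0 : (0 < p)%N) (q0 : (0 < q)%N).
Variables (Z : cstarAlgType R) (mu : (R -> 'M[R[i]]_(p * q)) -> Z).
Hypothesis mu_emb : dimension_drop_embedding mu.

Lemma drop_dim_gt0 : (0 < p * q)%N. Proof. by rewrite muln_gt0 p0. Qed.

(** As a path algebra, the dimension drop algebra acquires the C*-norm that the description of [mu]
    leaves out. The multiplicities of its end values are q at 0 and p at 1. *)
Definition drop_data : path_data R :=
  PathData drop_dim_gt0 (amp_image (tens_left R p q0)) (amp_image (tens_right R q p0)).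

Local Notation DA := (path_alg drop_data).
Local Notation D := (@dimension_drop R p q).

Lemma drop_path_in (f : DA) : D f.
Proof.
have [_ cf f0 f1] := path_funP f; split=> // i j.
by apply/continuous_subspaceT/ccont_continuous; exact: mxcont_entry.
Qed.

Lemma path_of_drop f : D f -> exists g : DA, forall x, x \in `[0, 1] -> f x = g x.
Proof.
case=> cf f0 f1.
have pf : is_path (pleft drop_data) (pright drop_data) (fun x => f (clamp x)).
  split.
  - by move=> x; rewrite clampK.
  - by apply: mxcont_entries => i j; exact: (within_continuous_clamp (cf i j)).
  - by rewrite clamp0.
  - by rewrite clamp1.
by exists (Path pf) => x x01; rewrite /= clamp_id.
Qed.

Definition drop_hom (f : DA) : Z := mu f.

Lemma drop_hom_star_hom : unital_star_hom drop_hom.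
Proof.
case: mu_emb => _ muDM muZS mu1; split.
- by move=> f g; case: (muDM _ _ (drop_path_in f) (drop_path_in g)).
- by move=> f g; case: (muDM _ _ (drop_path_in f) (drop_path_in g)).
- by move=> a f; case: (muZS _ (drop_path_in f)) => h _; exact: h.
- by move=> f; case: (muZS _ (drop_path_in f)).
- exact: mu1.
Qed.

Lemma drop_hom_eq f : D f -> exists g : DA, drop_hom g = mu f.
Proof.
move=> Df; have [g gP] := path_of_drop Df; exists g.
case: mu_emb => inj _ _ _.
by apply/(inj _ _ (drop_path_in g) Df) => x /gP.
Qed.

Lemma drop_hom_eq0 (f : DA) : drop_hom f = 0 -> f = 0.
Proof.
rewrite -(star_hom0 drop_hom_star_hom) => h.
case: mu_emb => inj _ _ _; apply: path_ext => x.
rewrite -(path_clamp f) -(path_clamp (0 : DA)).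
have /(inj _ _ (drop_path_in f) (drop_path_in 0)) := h.
by apply; exact: clamp_itv.
Qed.

Section Bump.
Variables (b : R -> R) (i j : 'I_(p * q)).
Hypotheses (cb : continuous b) (b_0 : b 0 = 0) (b_1 : b 1 = 0).

(** A path that vanishes at both ends satisfies any end conditions, so every matrix unit becomes
    available away from the ends. *)
Lemma bump_path : is_path (pleft drop_data) (pright drop_data)
  (fun x => (b (clamp x))%:C *: delta_mx i j).
Proof.
have z n (S : mxsubalg R n) : S 0 by rewrite -(scale0r 1%:M); apply/mxsubalgZ/mxsubalg1.
split.
- by move=> x; rewrite clampK.
- apply: mxcont_entries => s t.
  have -> : (fun x => ((b (clamp x))%:C *: delta_mx i j : 'M[R[i]]_(p * q)) s t) =
      (fun x => (b (clamp x) * ((s == i) && (t == j))%:R)%:C).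
    by apply/funext => x; rewrite !mxE rmorphM rmorph_nat.
  apply: ccont_real => x; apply: cvgM; last exact: cvg_cst.
  by apply: continuous_comp; [exact: clamp_continuous|exact: cb].
- by rewrite clamp0 b_0 scale0r; exact: z.
- by rewrite clamp1 b_1 scale0r; exact: z.
Qed.

Definition bump : DA := Path bump_path.

Lemma bumpE x : x \in `[0, 1] -> bump x = (b x)%:C *: delta_mx i j.
Proof. by move=> x01; rewrite /= clamp_id. Qed.

End Bump.

Lemma opnorm_scale_delta (a : R[i]) (i j : 'I_(p * q)) :
  opnorm (a *: delta_mx i j) <= normc a.
Proof.
rewrite (le_trans (opnorm_le_entry_sum _))// /entry_sum (bigD1 i)//=.
rewrite [X in _ + X]big1 ?addr0 => [|s si].
  rewrite (bigD1 j)//= big1 ?addr0 => [|t tj]; rewrite !mxE eqxx ?(negbTE tj).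
    by rewrite eqxx mulr1.
  by rewrite mulr0 normc0.
by apply: big1 => t _; rewrite !mxE (negbTE si) mulr0 normc0.
Qed.

Lemma delta_mul_delta (M : 'M[R[i]]_(p * q)) (i j k l : 'I_(p * q)) :
  delta_mx k i *m M *m delta_mx j l = M i j *: delta_mx k l.
Proof.
rewrite -(mul_delta_mx (0 : 'I_1) k i) -(mul_delta_mx (0 : 'I_1) j l) !mulmxA.
rewrite -(mulmxA _ (delta_mx 0 i)) -(mulmxA _ _ (delta_mx j 0)) -rowE -colE.
have -> : col j (row i M) = (M i j)%:M by apply/matrixP => s t; rewrite !ord1 !mxE eqxx.
by rewrite mul_mx_scalar -scalemxAl mul_delta_mx.
Qed.

Lemma path_cnorm_le_itv (f : DA) c :
  (forall x, x \in `[0, 1] -> opnorm (f x) <= c) -> cnorm f <= c.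
Proof.
by move=> h; apply: cnorm_path_le => x; rewrite -path_clamp h// clamp_itv.
Qed.

(* With b and c bumps at x0, c supported where b = 1, and s the entry (i, j) of
   f, the element c e_ii is its own product with (b^2 s / s(x0)) e_ii up to
   b^2 (s / s(x0) - 1) e_ii, and the image of the former has norm at most
   |mu f| / |s(x0)|. If this is less than 1 then mu kills c e_ii. *)
Lemma drop_entry_interior (f : DA) i j x0 : 0 < x0 < 1 ->
  normc (f x0 i j) <= cnorm (drop_hom f).
Proof.
move=> /andP[x00 x01]; rewrite leNgt; apply/negP => fs.
set rho := cnorm _ in fs; set s0 := f x0 i j in fs.
have s0n : 0 < normc s0 := le_lt_trans (cnorm_ge0 _) fs.
(* Half of the gap, so that rho + eta is still smaller than |s0|. *)
pose eta := (normc s0 - rho) / 2.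
have eta0 : 0 < eta by rewrite divr_gt0// subr_gt0.
have [_ cf _ _] := path_funP f.
have [d1 d10 d1P] := mxcont_entry i j cf x0 eta0.
(* At most the distance from x0 to either end, which makes the bumps vanish at 0 and 1. *)
pose d := Num.min d1 (Num.min x0 (1 - x0)).
have d0 : 0 < d by rewrite !lt_min d10 x00 subr_gt0.
have dx0 : d <= x0 by rewrite !ge_min lexx orbT.
have dx1 : d <= 1 - x0 by rewrite !ge_min lexx !orbT.
(* On this scale, b is 1 for t <= 1 and 0 for t >= 2, that is, at distance at least d from x0, while
   c is 0 for t >= 1. *)
pose t x := 2 * `|x - x0| / d.
have ct : continuous t.
  move=> x; apply: cvgMr_tmp; apply: cvgMl_tmp.
  by apply: cvg_norm; apply: cvgB; [exact: cvg_id|exact: cvg_cst].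
pose b x := clamp (2 - t x); pose c x := clamp (1 - t x).
have cb : continuous b.
  move=> x; apply: (@continuous_comp _ _ _ (fun x => 2 - t x)).
    by apply: cvgB; [exact: cvg_cst|exact: ct].
  exact: clamp_continuous.
have cc : continuous c.
  move=> x; apply: (@continuous_comp _ _ _ (fun x => 1 - t x)).
    by apply: cvgB; [exact: cvg_cst|exact: ct].
  exact: clamp_continuous.
have clamp_neg (y : R) : y <= 0 -> clamp y = 0.
  by move=> y0; rewrite /clamp min_l ?max_l//; lra.
have clamp_big (y : R) : 1 <= y -> clamp y = 1.
  by move=> y1; rewrite /clamp min_r// max_r.
have t_far x : d <= `|x - x0| -> 2 <= t x.
  by move=> h; rewrite /t ler_pdivlMr// ler_pM2l.
have t_0 : 2 <= t 0.
  by apply: t_far; rewrite sub0r normrN (ger0_norm (ltW x00)).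
have t_1 : 2 <= t 1.
  by apply: t_far; rewrite ger0_norm// subr_ge0 ltW.
have b_0 : b 0 = 0 by apply: clamp_neg; lra.
have b_1 : b 1 = 0 by apply: clamp_neg; lra.
have c_0 : c 0 = 0 by apply: clamp_neg; lra.
have c_1 : c 1 = 0 by apply: clamp_neg; lra.
have cbE x : c x * b x = c x.
  have [h|h] := leP (t x) 1.
    by rewrite /b clamp_big ?mulr1//; lra.
  by rewrite /c clamp_neg ?mul0r//; lra.
have b01 x : 0 <= b x <= 1 by have := clamp_itv (2 - t x); rewrite in_itv.
pose C := bump i i cc c_0 c_1; pose Bi := bump i i cb b_0 b_1.
pose Bj := bump j i cb b_0 b_1.
pose L := s0^-1 *: (Bi * f * Bj); pose K := L - Bi * Bi.
have normB k l : cnorm (bump k l cb b_0 b_1) <= 1.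
  apply: path_cnorm_le_itv => x x01'; rewrite bumpE//.
  rewrite (le_trans (opnorm_scale_delta _ _ _))// normc_real.
  by have /andP[b0 b1] := b01 x; rewrite ger0_norm.
have LE x : x \in `[0, 1] -> L x = ((b x)%:C * (b x)%:C * (s0^-1 * f x i j)) *: delta_mx i i.
  move=> x01'; rewrite pathZ !pathM !bumpE// -!scalemxAl -!scalemxAr !scalerA.
  rewrite delta_mul_delta !scalerA; congr (_ *: _); ring.
have BB x : x \in `[0, 1] -> (Bi * Bi) x = ((b x)%:C * (b x)%:C) *: delta_mx i i.
  by move=> x01'; rewrite pathM !bumpE// -scalemxAl -scalemxAr scalerA mul_delta_mx.
have normK : cnorm K <= eta / normc s0.
  apply: path_cnorm_le_itv => x x01'; rewrite pathB LE// BB// -scalerBl.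
  rewrite (le_trans (opnorm_scale_delta _ _ _))//.
  have -> : (b x)%:C * (b x)%:C * (s0^-1 * f x i j) - (b x)%:C * (b x)%:C =
    (b x * b x)%:C * (s0^-1 * (f x i j - s0)).
    rewrite rmorphM mulrBr mulVf ?mulrBr ?mulr1//.
    by apply/eqP => s00; move: s0n; rewrite s00 normc0 ltxx.
  rewrite (normcM (b x * b x)%:C) (normcM s0^-1) normc_real normcV.
  rewrite mulrCA [eta / _]mulrC.
  rewrite ler_wpM2l ?invr_ge0 ?normc_ge0//.
  have /andP[b0 b1] := b01 x; rewrite ger0_norm ?mulr_ge0//.
  have [h'|h'] := ltP `|x - x0| d; last first.
    have -> : b x = 0 by apply: clamp_neg; have := t_far _ h'; lra.
    by rewrite !mul0r ltW.
  have : normc (f x i j - s0) < eta.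
    rewrite normcB; apply: d1P; rewrite distrC (lt_le_trans h')//.
    by rewrite ge_min lexx.
  have := normc_ge0 (f x i j - s0).
  move: (normc _) => y y0 /ltW ye.
  apply: le_trans ye; by rewrite ler_piMl// mulr_ile1.
have CC : C = C * (Bi * Bi).
  apply: path_ext => x; rewrite -path_clamp -[RHS]path_clamp.
  rewrite pathM BB ?clamp_itv// bumpE ?clamp_itv// -scalemxAl -scalemxAr scalerA.
  by rewrite mul_delta_mx -!rmorphM mulrA !cbE.
have hom := drop_hom_star_hom.
have [hD hM hZ _ _] := hom.
have normL : cnorm (drop_hom L) <= rho / normc s0.
  rewrite hZ !hM cnormZ normcV mulrC ler_wpM2r ?invr_ge0 ?normc_ge0//.
  rewrite (le_trans (ler_cnormM _ _))// -[leRHS]mulr1.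
  rewrite ler_pM ?cnorm_ge0//; last first.
    by rewrite (le_trans (star_hom_contractive hom _))// normB.
  rewrite (le_trans (ler_cnormM _ _))// -[leRHS]mul1r.
  by rewrite ler_pM ?cnorm_ge0// (le_trans (star_hom_contractive hom _))// normB.
have C0 : drop_hom C = 0.
  have CE : drop_hom C = drop_hom C * (drop_hom L - drop_hom K).
    by rewrite -star_homB// -hM /K opprB addrC subrK -CC.
  have k1 : (rho + eta) / normc s0 < 1.
    by rewrite ltr_pdivrMr// mul1r /eta; lra.
  have le1 : cnorm (drop_hom C) <= cnorm (drop_hom C) * ((rho + eta) / normc s0).
    rewrite {1}CE (le_trans (ler_cnormM _ _))// ler_wpM2l ?cnorm_ge0//.
    rewrite (le_trans (ler_cnormB _ _))// mulrDl lerD//.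
    by rewrite (le_trans (star_hom_contractive hom _)).
  apply: cnorm0_eq0; apply/eqP; rewrite eq_le cnorm_ge0 andbT leNgt.
  apply/negP => c00; move: le1; rewrite -{1}[cnorm _]mulr1 ler_pM2l//.
  by rewrite leNgt k1.
have := drop_hom_eq0 C0 => /(congr1 (fun g : DA => g x0 i i)).
rewrite path0 bumpE ?in_itv /= ?(ltW x00) ?(ltW x01)// !mxE !eqxx mulr1.
have -> : c x0 = 1 by apply: clamp_big; rewrite /t subrr normr0 mulr0 mul0r subr0.
by move/eqP; rewrite oner_eq0.
Qed.

(** By continuity: the point y is obtained by moving x slightly towards the middle of the interval,
    into its interior. *)
Lemma drop_entry (f : DA) i j x : normc (f x i j) <= cnorm (drop_hom f).
Proof.
rewrite -path_clamp; have := clamp_itv x; move: (clamp x) => {}x.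
rewrite in_itv /= => /andP[x0 x1]; apply/ler_addgt0Pl => e e0.
have [_ cf _ _] := path_funP f.
have [d d0 dP] := mxcont_entry i j cf x e0.
pose y := if x < 2^-1 then x + Num.min (d / 2) 4^-1 else x - Num.min (d / 2) 4^-1.
have m0 : 0 < Num.min (d / 2) 4^-1 by rewrite lt_min divr_gt0//= invr_gt0.
have m4 : Num.min (d / 2) 4^-1 <= 4^-1 by rewrite ge_min lexx orbT.
have md : Num.min (d / 2) 4^-1 <= d / 2 by rewrite ge_min lexx.
have y01 : 0 < y < 1 by rewrite /y; case: (ltP x 2^-1) => h; apply/andP; split; lra.
have xy : `|x - y| < d.
  by rewrite /y; case: (ltP x 2^-1) => h; rewrite ltr_norml; apply/andP; split; lra.
rewrite -(subrK (f y i j) (f x i j)) (le_trans (ler_normcD _ _))//.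
by rewrite lerD ?drop_entry_interior// ltW// dP.
Qed.

(** The bound on entries only gives an equivalence of norms with constant (pq)^2, which
    [star_hom_isometric] sharpens. *)
Lemma drop_hom_isometric (f : DA) : cnorm (drop_hom f) = cnorm f.
Proof.
apply: (star_hom_isometric (C := ((p * q) * (p * q))%:R) drop_hom_star_hom) => g.
apply: cnorm_path_le => x; rewrite (le_trans (opnorm_le_entry_sum _))//.
apply: (@le_trans _ _ (\sum_(i < p * q) \sum_(j < p * q) cnorm (drop_hom g))).
  by apply: ler_sum => i _; apply: ler_sum => j _; exact: drop_entry.
by rewrite !sumr_const !card_ord -mulrnA mulr_natl.
Qed.

End DimensionDrop.

(** * Partitions of unity by three idempotents *)

Section NearPartitions.
Variable R : realType.
Implicit Types A B : cstarAlgType R.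

(** The idempotents are exact and the sum is not: each of them can be repaired independently of the
    others, and the integrality of ranks tolerates an error in the sum. *)
Definition near_partition A (c : R) : Prop :=
  exists e : 'I_3 -> 'M[A]_2, [/\ forall k, e k *m e k = e k,
    forall k, e k != 0 & mnorm (\sum_k e k - 1%:M) < c].

Lemma idempotent_mnorm_ge1 A n (e : 'M[A]_n) : e *m e = e -> e != 0 -> 1 <= mnorm e.
Proof.
move=> ee e0; have n0 : 0 < mnorm e.
  by rewrite lt_def mnorm_ge0 andbT; apply: contra_neq e0 => /mnorm_eq0.
by rewrite -(ler_pM2r n0) mul1r -{1}ee ler_mnormM.
Qed.

Lemma near_partition_hom A B (f : A -> B) (c : R) : unital_star_hom f ->
  injective f -> near_partition A c -> near_partition B c.
Proof.
move=> hf fI [e [ee e0 ec]]; have [fD fM fZ fS f1] := hf.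
have mapM (M N : 'M[A]_2) : map_mx f (M *m N) = map_mx f M *m map_mx f N.
  by apply/matrixP => i j; rewrite !mxE star_hom_sum//; apply: eq_bigr => l _; rewrite fM !mxE.
exists (fun k => map_mx f (e k)); split=> [k|k|].
- by rewrite -mapM ee.
- apply: contra (e0 k) => /eqP/matrixP ek; apply/eqP/matrixP => i j.
  by have := ek i j; rewrite !mxE -(star_hom0 hf) => /fI.
- apply: le_lt_trans ec; apply: ler_sum => i _; apply: ler_sum => j _.
  apply: le_trans (star_hom_contractive hf _).
  rewrite le_eqVlt; apply/orP; left; apply/eqP; congr cnorm.
  rewrite !mxE star_homB// !summxE star_hom_sum//; congr (_ - _).
    by apply: eq_bigr => k _; rewrite mxE.
  by case: (i == j); rewrite ?f1 ?star_hom0.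
Qed.

(** Moving each matrix by at most 1/4 keeps it nonzero, in view of the lower bound 1/2, and moving
    it by at most (c' - c)/4 spends three quarters of the slack in the sum. It matters that [eps] is
    chosen before the algebra: the algebra may come from a later play or be a stage of a limit. *)
Lemma near_partition_lift (K c c' : R) : 0 <= K -> c < c' -> exists2 eps : R, 0 < eps &
  forall A (h : 'I_3 -> 'M[A]_2),
    (forall k, mnorm (h k) <= K) -> (forall k, 2^-1 < mnorm (h k)) ->
    (forall k, mnorm (h k *m h k - h k) < eps) ->
    mnorm (\sum_k h k - 1%:M) < c -> near_partition A c'.
Proof.
move=> K0 cc'; pose tau := Num.min 4^-1 ((c' - c) / 4).
have tau0 : 0 < tau by rewrite lt_min invr_gt0 ltr0n divr_gt0// subr_gt0.
have tau4 : tau <= 4^-1 by rewrite ge_min lexx.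
have tauc : tau <= (c' - c) / 4 by rewrite ge_min lexx orbT.
have L0 : 0 < 2 * (2 * K + 3) by lra.
exists (Num.min 16^-1 (tau / (2 * (2 * K + 3)))).
  by rewrite lt_min invr_gt0 ltr0n divr_gt0.
move=> A h hK h2 hh hc.
have ex k : exists q : 'M[A]_2, q *m q = q /\ mnorm (q - h k) <= tau.
  have := hh k; rewrite lt_min => /andP[h16 ht].
  have [|||q qq qh] := @idempotent_lift R A 1 (h k) K tau (hK k).
  - exact: ltW.
  - by rewrite mulrC -ler_pdivlMr// ltW.
  - lra.
  - by exists q.
have [q qP] := choice ex; exists q; split=> [k|k|].
- by case: (qP k).
- apply/eqP => q0; have [_] := qP k; rewrite q0 sub0r mnormN.
  by move: (h2 k); lra.
- have -> : \sum_k q k - 1%:M = \sum_k (q k - h k) + (\sum_k h k - 1%:M).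
    by rewrite sumrB addrA subrK.
  rewrite (le_lt_trans (ler_mnormD _ _))//.
  have : mnorm (\sum_k (q k - h k)) <= 3 * tau.
    rewrite !big_ord_recl big_ord0 addr0.
    rewrite (le_trans (ler_mnormD _ _))//.
    have := ler_mnormD (q (lift ord0 ord0) - h (lift ord0 ord0))
      (q (lift ord0 (lift ord0 ord0)) - h (lift ord0 (lift ord0 ord0))).
    have [_] := qP ord0; have [_] := qP (lift ord0 ord0).
    have [_] := qP (lift ord0 (lift ord0 ord0)); lra.
  move: hc tauc; lra.
Qed.

Lemma idempotent_perturb A n (e M : 'M[A]_n) (eta : R) : e *m e = e ->
  mnorm (M - e) <= eta -> eta <= 1 ->
  mnorm (M *m M - M) <= eta * (2 * mnorm e + 2).
Proof.
move=> ee Me eta1; have [d ME] : exists d, M = e + d by exists (M - e); rewrite addrC subrK.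
have {}Me : mnorm d <= eta by rewrite -[d](addKr e) -ME addrC.
have -> : M *m M - M = e *m d + d *m e + d *m d - d.
  have aux (x a b c y : 'M[A]_n) : x + a + (b + c) - (x + y) = b + a + c - y.
    by rewrite opprD addrA (addrAC _ _ (- x)) (addrC x) addrK addrA (addrC a).
  by rewrite ME mulmxDr !mulmxDl ee aux.
have d0 := mnorm_ge0 d; have e0 := mnorm_ge0 e.
have h1 := ler_mnormM e d; have h2 := ler_mnormM d e; have h3 := ler_mnormM d d.
have := ler_mnormD (e *m d + d *m e + d *m d) (- d).
have := ler_mnormD (e *m d + d *m e) (d *m d).
have := ler_mnormD (e *m d) (d *m e); rewrite mnormN.
have : mnorm e * mnorm d <= mnorm e * eta by rewrite ler_wpM2l.
have : mnorm d * mnorm d <= eta * 1 by rewrite ler_pM// (le_trans Me).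
rewrite (mulrC (mnorm d)) in h2; lra.
Qed.

(* The ranks are multiples of p and of q, hence of pq, and add up to about 2pq. *)
Lemma drop_no_near_partition p q (p0 : (0 < p)%N) (q0 : (0 < q)%N) :
  coprime p q -> ~ near_partition (path_alg (drop_data R p0 q0)) 4^-1.
Proof.
move=> pq [e [ee e0 ec]].
have [r rP] := choice (fun k => path_idempotent_trace (ee k)).
have rdvd k : (p * q %| r k)%N.
  have idem x i j : \sum_l e k i l x *m e k l j x = e k i j x.
    by rewrite -[in RHS]ee mxE path_sum.
  have dvd m c (phi : amplification R m (p * q) c) x :
      (forall i j, amp_image phi (e k i j x)) -> (c %| r k)%N.
    move=> im; have [m' mE] := amp_image_trace im (idem x).
    have /eqP := mE; rewrite (rP k).1 eqr_nat => /eqP ->; exact: dvdn_mulr.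
  rewrite Gauss_dvd//; apply/andP; split.
    by apply: (dvd _ _ (tens_right R q p0) 1) => i j; case: (path_funP (e k i j)).
  by apply: (dvd _ _ (tens_left R p q0) 0) => i j; case: (path_funP (e k i j)).
have rge k : (p * q <= r k)%N.
  apply: dvdn_leq => //; rewrite lt0n; apply/eqP => /(rP k).2/eqP.
  by rewrite (negbTE (e0 k)).
set M := \sum_k e k - 1%:M in ec.
have trM : \sum_i \tr (M i i 0) = (\sum_k r k)%:R - (2 * (p * q))%:R :> R[i].
  have ME i : \tr (M i i 0) = \sum_k \tr (e k i i 0) - (p * q)%:R.
    rewrite -raddf_sum -(mxtrace1 _ (p * q)) -raddfB /=; congr (\tr _).
    by rewrite /M mxE summxE !mxE pathD path_sum pathN eqxx mulr1n path1.
  rewrite (eq_bigr _ (fun i _ => ME i)).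
  rewrite sumrB exchange_big /= natr_sum; congr (_ - _).
    by apply: eq_bigr => k _; rewrite (rP k).1.
  by rewrite sumr_const card_ord (mulnC 2) (natrM _ _ 2) mulr_natr.
(* The ranks exceed 2pq by at least pq, whereas the trace of the error is at most pq/4. *)
have : normc (\sum_i \tr (M i i 0)) <= (p * q)%:R * mnorm M.
  rewrite (le_trans (normc_sum _ _ _))// /mnorm mulr_sumr; apply: ler_sum => i _.
  rewrite (le_trans (opnorm_trace _))// ler_wpM2l//.
  rewrite (le_trans (opnorm_le_cnorm _ _))// (bigD1 i)//= lerDl.
  by apply: sumr_ge0 => j _; exact: cnorm_ge0.
rewrite trM => /(le_trans (Re_normc _)).
have -> : complex.Re ((\sum_k r k)%:R - (2 * (p * q))%:R : R[i]) =
    (\sum_k r k)%:R - (2 * (p * q))%:R :> R.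
  by rewrite -!(rmorph_nat (real_complex R)) -rmorphB.
move=> /(le_trans (ler_norm _)).
have : (3 * (p * q))%:R <= (\sum_k r k)%:R :> R.
  by rewrite ler_nat !big_ord_recl big_ord0 addn0 !mulSn mul0n addn0 !leq_add.
have N0 : 0 < (p * q)%:R :> R by rewrite ltr0n muln_gt0 p0.
have : (p * q)%:R * mnorm M <= (p * q)%:R * 4^-1 by rewrite ler_wpM2l// ltW.
rewrite (natrM _ 3) (natrM _ 2); lra.
Qed.

(** The twelve entries are approximated at various stages, and the increasing images bring them to a
    common stage N. As [psi N] is isometric, the estimates hold inside that dimension drop algebra,
    where the approximate idempotents are lifted. *)
Lemma jiang_su_no_near_partition (Z : cstarAlgType R) (c : R) : jiang_su Z ->
  c < 4^-1 -> ~ near_partition Z c.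
Proof.
case=> _ _ [p [q [mu [pq muE muS muD]]]] c4 [e [ee e0 ec]].
have p0 n : (0 < p n)%N by case/and3P: (pq n).
have q0 n : (0 < q n)%N by case/and3P: (pq n).
pose psi n := @drop_hom R (p n) (q n) (p0 n) (q0 n) Z (mu n).
have hpsi n : unital_star_hom (psi n) by exact: drop_hom_star_hom.
have psiS n m (g : path_alg (drop_data R (p0 n) (q0 n))) : (n <= m)%N ->
    exists g', psi m g' = psi n g.
  move=> /subnK <-; elim: (m - n)%N => [|k [g' g'E]]; first by exists g.
  have [|f Df fE] := muS (k + n)%N (psi n g).
    by exists g' => //; exact: drop_path_in.
  by have [g2 g2E] := drop_hom_eq (p0 _) (q0 _) (muE _) Df; exists g2; rewrite -fE.
(* The additional 1 leaves room for the perturbation. Half of the slack between c and 1/4 is for the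
   approximation, the other half for the lifting. *)
pose K := \sum_k mnorm (e k) + 1; pose c' := (c + 4^-1) / 2.
have eK k : mnorm (e k) <= K - 1.
  rewrite /K addrK (bigD1 k)//= lerDl; apply: sumr_ge0 => ? _; exact: mnorm_ge0.
have K1 : 1 <= K by rewrite lerDr sumr_ge0// => k _; exact: mnorm_ge0.
have [||eps eps0 lift] := @near_partition_lift K c' 4^-1.
- lra.
- rewrite /c'; lra.
(* The three bounds keep the norms above 1/2, the defects below 2K eta <= eps/2, and the change of
   the sum below c' - c. *)
pose eta := Num.min 4^-1 (Num.min (eps / (4 * K)) ((c' - c) / 4)).
have eta0 : 0 < eta.
  rewrite !lt_min invr_gt0 ltr0n /=; apply/andP; split.
    by rewrite divr_gt0// mulr_gt0//; lra.
  by rewrite divr_gt0// /c'; lra.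
have eta4 : eta <= 4^-1 by rewrite ge_min lexx.
have etae : eta <= eps / (4 * K) by rewrite !ge_min lexx orbT.
have etac : eta <= (c' - c) / 4 by rewrite !ge_min lexx !orbT.
(* A quarter for each of the four entries of a matrix. *)
have near (x : 'I_3 * 'I_2 * 'I_2) : exists n, exists g, cnorm (e x.1.1 x.1.2 x.2 - psi n g) < eta / 4.
  have [|n [f Df fe]] := muD (e x.1.1 x.1.2 x.2) (eta / 4); first by rewrite divr_gt0.
  have [g gE] := drop_hom_eq (p0 n) (q0 n) (muE n) Df.
  by exists n, g; rewrite /psi gE.
have [n nP] := choice near.
pose N := \max_x n x.
have nearN (x : 'I_3 * 'I_2 * 'I_2) : exists g, cnorm (e x.1.1 x.1.2 x.2 - psi N g) < eta / 4.
  have [g gP] := nP x.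
  have [|g' g'E] := psiS _ N g; first exact: (leq_bigmax (F := n)).
  by exists g'; rewrite g'E.
have [g gP] := choice nearN.
pose G k : 'M[_]_2 := \matrix_(i, j) g (k, i, j).
have isoN f : cnorm (psi N f) = cnorm f by exact: drop_hom_isometric.
have mapM (M M' : 'M[_]_2) : map_mx (psi N) (M *m M') = map_mx (psi N) M *m map_mx (psi N) M'.
  apply/matrixP => i j; rewrite !mxE star_hom_sum//; apply: eq_bigr => l _.
  by have [_ hM _ _ _] := hpsi N; rewrite hM !mxE.
have mapB (M M' : 'M[_]_2) : map_mx (psi N) (M - M') = map_mx (psi N) M - map_mx (psi N) M'.
  by apply/matrixP => i j; rewrite !mxE star_homB.
have mapN (M : 'M[_]_2) : mnorm (map_mx (psi N) M) = mnorm M.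
  by apply: eq_bigr => i _; apply: eq_bigr => j _; rewrite mxE -[RHS]isoN.
have Ge k : mnorm (map_mx (psi N) (G k) - e k) <= eta.
  rewrite mnormB.
  have := @mnorm_lt R Z 2 (e k - map_mx (psi N) (G k)) (eta / 4).
  rewrite (_ : (2 * 2)%:R * (eta / 4) = eta); last by rewrite natrM; field.
  apply=> [|i j]; first by rewrite divr_gt0.
  by rewrite !mxE; exact: (gP (k, i, j)).
apply: (@drop_no_near_partition (p N) (q N) (p0 N) (q0 N)).
  by case/and3P: (pq N).
apply: (lift _ G) => [k|k|k|].
- rewrite -mapN -(subrK (e k) (map_mx _ _)) (le_trans (ler_mnormD _ _))//.
  by have := Ge k; have := eK k; lra.
- have := idempotent_mnorm_ge1 (ee k) (e0 k).
  have := ler_mnormD (map_mx (psi N) (G k)) (e k - map_mx (psi N) (G k)).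
  rewrite addrC subrK mnormB mapN; have := Ge k; lra.
- rewrite -mapN mapB mapM.
  have eta1 : eta <= 1 by lra.
  rewrite (le_lt_trans (idempotent_perturb (ee k) (Ge k) eta1))//.
  apply: (@le_lt_trans _ _ (eta * (2 * K))).
    by rewrite ler_wpM2l//; [exact: ltW|have := eK k; lra].
  have : eta * (4 * K) <= eps by rewrite -ler_pdivlMr//; lra.
  have : 0 < eta * K by rewrite mulr_gt0//; lra.
  lra.
- have -> : mnorm (\sum_k G k - 1%:M) = mnorm (\sum_k map_mx (psi N) (G k) - 1%:M).
    rewrite -mapN mapB; congr (mnorm (_ - _)); apply/matrixP => i j.
      by rewrite !mxE !summxE star_hom_sum//; apply: eq_bigr => k _; rewrite !mxE.
    rewrite !mxE; have [_ _ _ _ h1] := hpsi N.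
    by case: (i == j); rewrite ?h1 ?star_hom0.
  have -> : \sum_k map_mx (psi N) (G k) - 1%:M =
      \sum_k (map_mx (psi N) (G k) - e k) + (\sum_k e k - 1%:M).
    by rewrite sumrB addrA subrK.
  rewrite (le_lt_trans (ler_mnormD _ _))//.
  have : mnorm (\sum_k (map_mx (psi N) (G k) - e k)) <= 3 * eta.
    apply: (@le_trans _ _ (\sum_(k < 3) eta)); last first.
      by rewrite sumr_const card_ord mulr_natl.
    elim/big_rec2: _ => [|k x y _ h]; first by rewrite mnorm0.
    by rewrite (le_trans (ler_mnormD _ _))// lerD.
  have : c < c' by rewrite /c'; lra.
  move: etac ec; lra.
Qed.

End NearPartitions.

Lemma lrmorphism_star_hom (R : realType) (A B : cstarAlgType R)
  (f : {lrmorphism A -> B}) : star_preserving f -> unital_star_hom f.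
Proof.
move=> fS; split=> //.
- exact: rmorphD.
- exact: rmorphM.
- by move=> a x; rewrite linearZ.
- exact: rmorph1.
Qed.

(** * Descent from an ultrapower to its coordinates *)

Section UltrapowerDescent.
Variables (R : realType) (I : Type) (V : set_system I) (VU : UltraFilter V).
Variable A : cstarAlgType R.
Implicit Types X : 'I_2 -> 'I_2 -> linf I A.

Definition mx_ucls X : 'M[ultrapower V A]_2 := 
  \matrix_(i, j) (ucls (X i j) : ultrapower V A).
Definition mx_at X (s : I) : 'M[A]_2 := \matrix_(i, j) X i j s.

Lemma mx_at_cvg X : mnorm (mx_at X s) @[s --> V] --> mnorm (mx_ucls X).
Proof.
have FV : Filter V by exact: filter_filter.
rewrite /mnorm; apply: (cvg_big add_continuous) => i _.
apply: (cvg_big add_continuous) => j _.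
rewrite mxE -[cnorm _]/(unorm (ucls (X i j) : ultrapower V A)) unormE.
have -> : (fun s => cnorm (mx_at X s i j)) = (fun s => cnorm (X i j s)).
  by apply/funext => s; rewrite mxE.
exact: linf_norm_cvg.
Qed.

(** An instance of the theorem of Los: finitely many strict inequalities between limits along V hold
    together at some index, where the coordinates are approximate idempotents. The slack c' - c pays
    for lifting them. *)
Lemma near_partition_ultrapower (c c' : R) : c < c' ->
  near_partition (ultrapower V A) c -> near_partition A c'.
Proof.
move=> cc' [e [ee e0 ec]].
pose K := \sum_k mnorm (e k) + 1.
have eK k : mnorm (e k) < K.
  rewrite /K (bigD1 k)//= -addrA ltrDl ltr_wpDl// sumr_ge0// => ? _.
  exact: mnorm_ge0.
have K0 : 0 <= K by rewrite addr_ge0// sumr_ge0// => k _; exact: mnorm_ge0.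
have [eps eps0 hlift] := near_partition_lift K0 cc'.
pose X k i j : linf I A := urepr (e k i j).
pose o : 'I_2 := lift ord0 ord0.
(* [Q] and [S] represent the defects of idempotency and of the sum. Bounded families carry no ring
   structure, so the sums over two and three indices are written out. *)
pose Q k i j := linf_sub (linf_add (linf_mul (X k i ord0) (X k ord0 j))
  (linf_mul (X k i o) (X k o j))) (X k i j).
pose S i j := linf_sub (linf_add (X ord0 i j) (linf_add (X (lift ord0 ord0) i j)
  (X (lift ord0 (lift ord0 ord0)) i j))) (linf_cst I (i == j)%:R).
have XE k : mx_ucls (X k) = e k by apply/matrixP => i j; rewrite mxE ureprK.
have QE k : mx_ucls (Q k) = 0.
  apply/matrixP => i j; rewrite !mxE /Q -usubE -uaddE -!umulE !ureprK.
  have := congr1 (fun M : 'M[_]_2 => M i j) (ee k).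
  rewrite mxE !big_ord_recl big_ord0 addr0 => h.
  by rewrite (h : uadd (umul _ _) (umul _ _) = _) subrr.
have SE : mx_ucls S = \sum_k e k - 1%:M.
  apply/matrixP => i j; rewrite !mxE /S -usubE -!uaddE !ureprK summxE.
  rewrite !big_ord_recl big_ord0 addr0; congr (_ - _).
  by case: (i == j).
have ev_lt Y r : mnorm (mx_ucls Y) < r -> V [set s | mnorm (mx_at Y s) < r].
  by move=> Yr; exact: (cvgr_lt _ (@mx_at_cvg Y) _ Yr).
have ev_gt Y r : r < mnorm (mx_ucls Y) -> V [set s | r < mnorm (mx_at Y s)].
  by move=> Yr; exact: (cvgr_gt _ (@mx_at_cvg Y) _ Yr).
have FV : ProperFilter V by exact: ultra_proper.
have V1 : V [set s | forall k, mnorm (mx_at (X k) s) < K].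
  by apply: filter_forall => k; apply: ev_lt; rewrite XE.
have V2 : V [set s | forall k, 2^-1 < mnorm (mx_at (X k) s)].
  apply: filter_forall => k; apply: ev_gt; rewrite XE.
  by have := idempotent_mnorm_ge1 (ee k) (e0 k); lra.
have V3 : V [set s | forall k, mnorm (mx_at (Q k) s) < eps].
  by apply: filter_forall => k; apply: ev_lt; rewrite QE mnorm0.
have V4 : V [set s | mnorm (mx_at S s) < c] by apply: ev_lt; rewrite SE.
have [s [[s1 s2] [s3 s4]]] := filter_ex (filterI (filterI V1 V2) (filterI V3 V4)).
apply: (hlift A (fun k => mx_at (X k) s)) => [k|k|k|].
- exact: ltW (s1 k).
- exact: s2.
- have -> // : mx_at (X k) s *m mx_at (X k) s - mx_at (X k) s = mx_at (Q k) s.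
  by apply/matrixP => i j; rewrite !mxE !big_ord_recl big_ord0 addr0 !mxE.
- have -> // : \sum_k mx_at (X k) s - 1%:M = mx_at S s.
  apply/matrixP => i j; rewrite !mxE summxE !big_ord_recl big_ord0 addr0 !mxE /=.
  by case: (i == j).
Qed.

End UltrapowerDescent.

(** * The diagonal embedding into an ultrapower *)

Section DiagonalEmbedding.
Variables (R : realType) (I : Type) (V : set_system I) (VU : UltraFilter V).
Variable A : cstarAlgType R.

Definition diagonal (a : A) : ultrapower V A := ucst a.

Lemma diagonal_linear : linear diagonal.
Proof.
move=> a x y; rewrite /diagonal /ucst.
rewrite -[RHS]/(uadd (uscale a (ucls (linf_cst I x))) (ucls (linf_cst I y))).
rewrite uscaleE uaddE; congr ucls.
exact: linfP.
Qed.

Lemma diagonal_monoid : monoid_morphism diagonal.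
Proof.
split=> // x y; rewrite /diagonal /ucst [RHS]umulE; congr ucls.
exact: linfP.
Qed.

HB.instance Definition _ :=
  GRing.isLinear.Build R[i] A (ultrapower V A) _ diagonal diagonal_linear.
HB.instance Definition _ :=
  GRing.isMonoidMorphism.Build A (ultrapower V A) diagonal diagonal_monoid.

Lemma diagonal_star : star_preserving diagonal.
Proof.
move=> x; rewrite /diagonal /ucst [RHS]ustarE; congr ucls.
exact: linfP.
Qed.

Lemma diagonal_inj : injective diagonal.
Proof.
move=> x y /uclsP/linf_eqmodP xy; apply/eqP; rewrite -subr_eq0; apply/eqP.
apply: cnorm_small_eq0 => e /xy /filter_ex[s /= /ltW]; exact.
Qed.

Lemma isomorphic_embeds_ultrapower (B : cstarAlgType R) :
  isomorphic B A -> embeds B (ultrapower V A).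
Proof.
case=> f [fS fB]; exists (diagonal \o f : {lrmorphism B -> ultrapower V A}).
split; first by move=> x; rewrite /= fS diagonal_star.
by apply: inj_comp; [exact: diagonal_inj|exact: bij_inj].
Qed.

End DiagonalEmbedding.

(** * Games *)

Section Games.
Variables (R : realType) (F : connectives R).

(** Substitution of formulas into a composition of connectives, by which the density of connectives
    acts on formulas. *)
Fixpoint comp_formula n (g : composition F n) (phis : 'I_n -> formula F) : formula F :=
  match g with
  | cvar i => phis i
  | capp u gs => Conn (fun i => comp_formula (gs i) phis)
  end.

Lemma feval_comp_formula (A : cstarAlgType R) (c : constants A) n
    (g : composition F n) phis :
  feval c (comp_formula g phis) = comp_fun g (\row_i feval c (phis i)).
Proof.
elim: g => [i|u gs IH] /=; first by rewrite mxE.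
by congr conn_fun; apply/rowP => i; rewrite !mxE IH.
Qed.

(** After the opening [p0] the first player only repeats the current condition. Since a strategy
    sees all earlier moves, the recursion builds the list of moves. *)
Lemma play_exists (sigma : strategy F) (p0 : condition F) : legal sigma ->
  exists p : nat -> condition F, [/\ p 0%N = p0, play p & follows sigma p].
Proof.
move=> lsigma.
pose next n (s : seq (condition F)) :=
  if n is m.+1 then
    if odd n then sigma (take m s) (last p0 s) else last p0 s
  else p0.
pose fix hist n := if n is m.+1 then rcons (hist m) (next m (hist m)) else [::].
pose p n := next n (hist n).
have histE n : hist n = mkseq p n.
  by elim: n => [//|n IH]; rewrite mkseqS -IH.
have lastE n : last p0 (hist n.+1) = p n by rewrite /= last_rcons.
have pE n : p n.+1 = if odd n.+1 then sigma (mkseq p n) (p n) else p n.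
  rewrite {1}/p /next lastE; case: ifP => // _; congr sigma.
  by rewrite /= -cats1 take_size_cat ?histE ?size_mkseq.
exists p; split=> // [n|i].
  by rewrite pE; case: ifP => _; [exact: lsigma|exact: subset_refl].
by rewrite pE /= odd_double.
Qed.

(** An unsatisfiable set entails every value of an atomic formula, against uniqueness. *)
Lemma definitive_satisfiable (p : set (expression F)) : definitive p -> satisfiable p.
Proof.
move=> /(_ 1%N tone tone)[r [_ rU]]; apply: contrapT => np.
have ent r' : entails p (Atom F tone tone) r' by move=> A c sA cp; case: np; exists A, c.
by have := rU _ (ent (r + 1)); lra.
Qed.

(** Atomic formulas take their entailed values both in the compiled structure and in any model of p;
    by induction the two agree on all formulas, and the model satisfies p. *)
Lemma compiled_satisfies (p : set (expression F)) (A : cstarAlgType R)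
  (c : constants A) : definitive p -> compiled p c -> satisfies c p.
Proof.
move=> dp [cp _]; have [B [d [sB dB]]] := definitive_satisfiable dp.
have fE (phi : formula F) : feval c phi = feval d phi.
  elim: phi => [k s t|u phis IH] /=.
    have [r [er _]] := dp k s t.
    by rewrite (cp _ _ _ _ er); have /= -> := er B d sB dB.
  by congr conn_fun; apply/rowP => i; rewrite !mxE IH.
by move=> phi r /dB; rewrite fE.
Qed.

Lemma enforceable_satisfies (P : cstarAlgType R -> Prop) (p : condition F) :
  enforceable F P -> exists (A : cstarAlgType R) (c : constants A),
    satisfies c p /\ P A.
Proof.
case=> sigma lsigma win; have [q [q0 playq fq]] := play_exists p lsigma.
have [dq [A [c [cq PA]]]] := win q playq fq.
exists A, c; split=> // phi r pr; apply: (compiled_satisfies dq cq).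
by exists 0%N => //; rewrite q0.
Qed.

Lemma enforceable_impl (P Q : cstarAlgType R -> Prop) :
  (forall A, P A -> Q A) -> enforceable F P -> enforceable F Q.
Proof.
move=> PQ [sigma lsigma win]; exists sigma => // p playp fp.
have [dp [A [c [cp PA]]]] := win p playp fp.
by split=> //; exists A, c; split=> //; exact: PQ.
Qed.

(** A condition contains only upper bounds, so a lower bound on a norm has to be an upper bound on
    its negative, which is a formula only approximately and on a bounded range. *)
Lemma negation_formula (HF : dense_connectives F) (M e : R) : 0 < e ->
  exists neg : formula F -> formula F,
    forall (A : cstarAlgType R) (c : constants A) phi,
      `|feval c phi| <= M -> `|- feval c phi - feval c (neg phi)| < e.
Proof.
move=> e0; case: HF => _ /(_ 0%N (fun x => - x ord0 ord0)) dense.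
have [|g gP] := dense _ M e e0.
  move=> x; apply: (@continuous_comp _ _ _ (fun y : 'rV[R]_1 => y ord0 ord0) -%R).
    exact: coord_continuous.
  exact: opp_continuous.
exists (fun phi => comp_formula g (fun=> phi)) => A c phi phiM.
rewrite feval_comp_formula; set x := \row_i _.
have xE i : x ord0 i = feval c phi by rewrite mxE.
by rewrite -{1}(xE ord0); apply: gP => i; rewrite xE.
Qed.

End Games.

(** * The opening condition of the first player *)

Section OpeningMove.
Variables (R : realType) (F : connectives R) (HF : dense_connectives F).

Definition entry_index := ('I_3 * 'I_2 * 'I_2)%type.

Lemma rigid_opening : exists p : condition F,
  forall (A : cstarAlgType R) (c : constants A), satisfies c p ->
    near_partition A 8^-1.
Proof.
have neg_bound (a b : R) : - (1 / 8) < - a - b -> 1 <= a -> b < - (3 / 4) by lra.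
have norm_bound (a b : R) : - a - b < 1 / 8 -> b < - (3 / 4) -> 2^-1 < a by lra.
pose A0 := path_alg (rigid_data R).
pose th (x : entry_index) : A0 := rigid_idempotent R x.1.1 x.1.2 x.2.
have [N Nth] : exists N : nat, forall x, cnorm (th x) <= N.+1%:R.
  pose B := \sum_x cnorm (th x); exists (Num.truncn B) => x.
  rewrite (@le_trans _ _ B)//; last by rewrite ltW// truncnS_gt.
  by rewrite /B (bigD1 x)//= lerDl sumr_ge0// => ? _; exact: cnorm_ge0.
pose n := N.+1.
have Kn : 0 <= 4 * n%:R :> R by rewrite mulr_ge0.
have c18 : 16^-1 < 8^-1 :> R by lra.
have [eps eps0 hlift] := near_partition_lift Kn c18.
have e80 : 0 < eps / 8 by rewrite divr_gt0.
have [neg negP] := negation_formula HF n%:R (divr_gt0 ltr01 (ltr0n R 8)).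
have [dg dgP] := choice (@rigid_idempotent_norm R).
(* Each of the twelve entries is named by its own constant, of the ball of radius n that contains
   all of them. *)
pose T (k : 'I_3) (i j : 'I_2) : cterm n := tconst (ltn0Sn N) (pickle ((k, i, j) : entry_index)).
pose o : 'I_2 := lift ord0 ord0.
pose prod k i j : cterm (n * n + n * n) :=
  tadd (tmul (T k i ord0) (T k ord0 j)) (tmul (T k i o) (T k o j)).
(* An atomic formula compares terms of one sort, so the right-hand sides are included into the
   larger balls of the sums. *)
have le1 : (n <= n * n + n * n)%N by rewrite -{1}(muln1 n) (leq_trans _ (leq_addr _ _))// leq_mul.
pose sum i j : cterm (n + (n + n)) :=
  tadd (T ord0 i j) (tadd (T (lift ord0 ord0) i j) (T (lift ord0 (lift ord0 ord0)) i j)).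
have le2 : (1 <= n + (n + n))%N by [].
have le3 : (1 <= n)%N by [].
(* Over four entries the bounds add up to eps/2 < eps for the defects and, with 1/100 per entry in
   [ex2], to 1/25 < 1/16 for the sum. *)
pose ex1 (x : entry_index) : expression F :=
  (Atom F (prod x.1.1 x.1.2 x.2) (tincl le1 (T x.1.1 x.1.2 x.2)), eps / 8).
pose ex2 (x : 'I_2 * 'I_2) : expression F :=
  (Atom F (sum x.1 x.2) (tincl le2 (if x.1 == x.2 then tone else tzero)), 100^-1).
(* With error 1/8 in the negation, a norm of at least 1 gives a value below -7/8, hence below -3/4;
   conversely a value below -3/4 gives a norm above 5/8, hence above 1/2. *)
pose ex3 (k : 'I_3) : expression F :=
  (neg (Atom F (T k (dg k) (dg k)) (tincl le3 tzero)), - (3 / 4)).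
pose p := range ex1 `|` range ex2 `|` range ex3.
have pfin : finite_set p.
  by rewrite !finite_setU; do ![split]; apply: finite_image; exact: finite_finset.
have psat : satisfiable p.
  (* All other constants are interpreted by 0, which lies in every ball. *)
  pose val (m i : nat) : A0 :=
    if (m == n)%N then (if unpickle i is Some x then th x else 0) else 0.
  have val_ball m i : (0 < m)%N -> cnorm (val m i) <= m%:R.
    rewrite /val; case: eqP => [->|_]; last by rewrite cnorm0.
    by case: unpickle => [x|] _; [exact: Nth|rewrite cnorm0].
  pose c := Constants val_ball.
  have cE k i j : teval c (T k i j) = rigid_idempotent R k i j.
    by rewrite /= /val eqxx pickleK.
  exists A0, c; split; first exact: rigid_sfp.
  move=> phi r [[[x _ [<- <-]]|[x _ [<- <-]]]|[k _ [<- <-]]].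
  - change (cnorm (teval c (T x.1.1 x.1.2 ord0) * teval c (T x.1.1 ord0 x.2) +
      teval c (T x.1.1 x.1.2 o) * teval c (T x.1.1 o x.2) -
      teval c (T x.1.1 x.1.2 x.2)) < eps / 8); rewrite !cE.
    have := congr1 (fun M : 'M[_]_2 => M x.1.2 x.2) (rigid_idempotent_idem R x.1.1).
    by rewrite mxE !big_ord_recl big_ord0 addr0 => ->; rewrite subrr cnorm0.
  - change (cnorm (teval c (T ord0 x.1 x.2) +
      (teval c (T (lift ord0 ord0) x.1 x.2) +
       teval c (T (lift ord0 (lift ord0 ord0)) x.1 x.2)) -
      teval c (if x.1 == x.2 then tone else tzero)) < 100^-1); rewrite !cE.
    have := congr1 (fun M : 'M[_]_2 => M x.1 x.2) (rigid_idempotent_sum R).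
    rewrite summxE !big_ord_recl big_ord0 addr0 => ->.
    rewrite mxE; by case: (x.1 == x.2); rewrite /= ?mulr1n ?mulr0n subrr cnorm0 invr_gt0.
  - set phi0 := Atom F _ _.
    have fE : feval c phi0 = cnorm (rigid_idempotent R k (dg k) (dg k)).
      by rewrite -(cE k (dg k) (dg k)) /phi0 /= subr0.
    have := negP A0 c phi0; rewrite fE ger0_norm ?cnorm_ge0// => /(_ (Nth (k, dg k, dg k))).
    by rewrite ltr_norml => /andP[h1 _]; exact: (neg_bound _ _ h1 (dgP k)).
exists (Condition pfin psat) => A c cp.
pose h k : 'M[A]_2 := \matrix_(i, j) teval c (T k i j).
apply: (hlift A h) => [k|k|k|].
- rewrite /mnorm; apply: (@le_trans _ _ (\sum_(i < 2) \sum_(j < 2) n%:R)).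
    apply: ler_sum => i _; apply: ler_sum => j _; rewrite mxE; exact: teval_ball.
  by rewrite !sumr_const !card_ord -mulrnA mulr_natl.
- apply: (@lt_le_trans _ _ (cnorm (h k (dg k) (dg k)))); last exact: cnorm_le_mnorm.
  rewrite mxE; set y := teval c _.
  set phi0 := Atom F (T k (dg k) (dg k)) (tincl le3 tzero).
  have fE : feval c phi0 = cnorm y by rewrite /= subr0.
  have : feval c (neg phi0) < - (3 / 4) by apply: cp; right; exists k.
  have := negP A c phi0; rewrite fE ger0_norm ?cnorm_ge0// => /(_ (teval_ball _ _)).
  by rewrite ltr_norml => /andP[_ h2] h3; exact: (norm_bound _ _ h2 h3).
- apply: (@le_lt_trans _ _ ((2 * 2)%:R * (eps / 8))).
    apply: mnorm_lt => // i j; rewrite !mxE !big_ord_recl big_ord0 addr0 !mxE.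
    have := cp _ _ (or_introl (or_introl (ex_intro2 _ _ (k, i, j) I erefl)) : p (ex1 (k, i, j))).
    by [].
  by rewrite natrM; lra.
- apply: (@le_lt_trans _ _ ((2 * 2)%:R * 100^-1)).
    apply: mnorm_lt => [|i j]; first by rewrite invr_gt0.
    rewrite !mxE summxE !big_ord_recl big_ord0 addr0 !mxE.
    have := cp _ _ (or_introl (or_intror (ex_intro2 _ _ (i, j) I erefl)) : p (ex2 (i, j))).
    by rewrite /=; case: (i == j).
  by rewrite natrM; lra.
Qed.

End OpeningMove.

(** * Failure of embeddability, and the equivalence *)

Lemma not_embeds_ultrapower (R : realType) (Z : cstarAlgType R) (A : cstarAlgType R)
  (I : Type) (V : set_system I) (VU : UltraFilter V) : jiang_su Z ->
  near_partition A 8^-1 -> ~ embeds A (ultrapower V Z).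
Proof.
move=> HZ pA [f [fS fI]].
have pU := near_partition_hom (lrmorphism_star_hom fS) fI pA.
(* Any number strictly between 1/8 and 1/4 would do: the descent from the ultrapower and the limit
   argument in Z each need a strict margin. *)
have c68 : 8^-1 < 6^-1 :> R by lra.
have c64 : 6^-1 < 4^-1 :> R by lra.
exact: (jiang_su_no_near_partition HZ c64 (near_partition_ultrapower c68 pU)).
Qed.

Lemma rigid_near_partition (R : realType) (c : R) : 0 < c ->
  near_partition (path_alg (rigid_data R)) c.
Proof.
move=> c0; exists (rigid_idempotent R); split.
- exact: rigid_idempotent_idem.
- move=> k; have [i ci] := rigid_idempotent_norm R k.
  by apply/eqP => k0; move: ci; rewrite k0 mxE cnorm0; lra.
- by rewrite rigid_idempotent_sum subrr mnorm0.
Qed.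

Theorem theorem5p17 (R : realType) (F : connectives R)
    (HF : dense_connectives F) (Z : cstarAlgType R) (HZ : jiang_su Z)
    (U : set_system nat) (UU : UltraFilter U) (Unp : nonprincipal U) :
  [<-> (forall A : cstarAlgType R, sfp A -> ultrapower_embeddable U Z A);
       enforceable_algebra F Z;
       enforceable F (fun A => embeds A (ultrapower U Z))].
Proof.
tfae.
- move=> all_emb; have c0 : 0 < 8^-1 :> R by rewrite invr_gt0.
  have pA := rigid_near_partition c0.
  (* The obstruction holds for every index set, so both cases of embeddability are refuted alike and
     separability of the algebra is not decided. *)
  case: (all_emb _ (rigid_sfp R)) => [[_ emb]|[_ [I [V [VU emb]]]]].
    by case: (not_embeds_ultrapower HZ pA emb).
  by case: (not_embeds_ultrapower HZ pA emb).
- apply: enforceable_impl => A; exact: isomorphic_embeds_ultrapower.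
- move=> enf; have [p pP] := rigid_opening HF.
  have [A [c [cp emb]]] := enforceable_satisfies p enf.
  by case: (not_embeds_ultrapower HZ (pP A c cp) emb).
Qed.
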